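(* Let $k$ be an algebraically closed field of characteristic $0$ and $R=k\langle x,y\rangle/(xy-yx-y^2)$. For $n\ge1$ let $A_n=\rho_n(R)\subset M_n(k)$ be the image algebra of a representation $\rho_n:R\to M_n(k)$ with $\mathrm{rk}\,\rho_n(y)=n-1$. Then for every $n\ge5$ the algebra $A_n$ is wild; it has a quotient isomorphic to the wild algebra $k\langle x,y\rangle/(y^2,\,yx-xy,\,x^2y,\,x^3)$. The algebras $A_1$, $A_2$ and $A_3$ are tame.
   Context: Tame and wild refer to the representation type of the algebra (its category of finite dimensional modules); tame includes finite representation type. For any such $\rho_n$, $\rho_n(y)$ is nilpotent, so the condition $\mathrm{rk}\,\rho_n(y)=n-1$ means that its Jordan normal form is a single block. An algebra $A$ is local if $A=k\oplus \mathrm{Jac}(A)$, and complete if $A=\varprojlim A/\mathrm{Jac}(A)^m$; the algebra $k\langle x,y\rangle/(y^2,yx-xy,x^2y,x^3)$ is one of the algebras in Ringel's list of minimal wild local complete algebras. *)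

(* Defs.v *)
From HB Require Import structures.
From mathcomp Require Import all_boot all_algebra.
From mathcomp Require Import boolp.
From mathcomp Require finmap.
From mathcomp Require Export monalg.

Set Implicit Arguments.
Unset Strict Implicit.
Unset Printing Implicit Defensive.

Import GRing.Theory.
Local Open Scope ring_scope.

(* Two-sided ideals and quotient algebras.  MathComp's [idealr] is a proper  *)
(* additive subgroup closed under multiplication on the left; its quotient   *)
(* ring is only provided for commutative rings.                              *)

Record ideal (A : nzRingType) := Ideal {
  ideal_left :> idealr A;
  ideal_mulr : forall a u : A, u \in ideal_left -> u * a \in ideal_left
}.

Definition quot_alg (k : pzRingType) (A : algType k) (I : ideal A) : Type :=
  Quotient.quot (ideal_left I : zmodClosed A).

Section QuotAlg.
Local Open Scope quotient_scope.
Variables (k : pzRingType) (A : algType k) (I : ideal A).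
Local Notation Q := (quot_alg I).

HB.instance Definition _ := GRing.Zmodule.on Q.
HB.instance Definition _ :
  EqQuotient A (Quotient.equiv (ideal_left I : zmodClosed A)) Q :=
  EqQuotient.on Q.

Definition quot_pi (a : A) : Q := \pi_Q a.

Lemma quot_piE (a b : A) :
  (quot_pi a = quot_pi b) <-> (a - b \in (ideal_left I : {pred A})).
Proof. by rewrite Quotient.idealrBE; split=> [/eqP|/eqP]. Qed.

Lemma quot_piP (q : Q) : exists a, q = quot_pi a.
Proof. by exists (repr q); rewrite /quot_pi reprK. Qed.

Lemma quot_piK (q : Q) : quot_pi (repr q) = q.
Proof. exact: reprK. Qed.

Lemma quot_pi_is_zmod_morphism : zmod_morphism quot_pi.
Proof. by move=> a b; rewrite /quot_pi !piE. Qed.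
HB.instance Definition _ :=
  GRing.isZmodMorphism.Build A Q quot_pi quot_pi_is_zmod_morphism.

Definition quot_one : Q := quot_pi 1.
Definition quot_mul (p q : Q) : Q := quot_pi (repr p * repr q).
Definition quot_scale (c : k) (q : Q) : Q := quot_pi (c *: repr q).

Lemma repr_quot_pi (a : A) :
  repr (quot_pi a) - a \in (ideal_left I : {pred A}).
Proof. by apply/quot_piE; rewrite quot_piK. Qed.

Lemma quot_mulE (a b : A) : quot_mul (quot_pi a) (quot_pi b) = quot_pi (a * b).
Proof.
apply/quot_piE; set a' := repr _; set b' := repr _.
have -> : a' * b' - a * b = (a' - a) * b' + a * (b' - b).
  by rewrite mulrBl mulrBr addrA subrK.
by apply: rpredD; [apply: ideal_mulr | apply: idealMr]; apply: repr_quot_pi.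
Qed.

Lemma quot_scaleE (c : k) (a : A) : quot_scale c (quot_pi a) = quot_pi (c *: a).
Proof.
apply/quot_piE; rewrite -scalerBr -[_ - a]mul1r scalerAl.
exact/idealMr/repr_quot_pi.
Qed.

Fact quot_mulA : associative quot_mul.
Proof.
move=> p q r; have [a ->] := quot_piP p; have [b ->] := quot_piP q; have [c ->] := quot_piP r.
by rewrite !quot_mulE mulrA.
Qed.

Fact quot_mul1 : left_id quot_one quot_mul.
Proof. by move=> p; have [a ->] := quot_piP p; rewrite quot_mulE mul1r. Qed.

Fact quot_1mul : right_id quot_one quot_mul.
Proof. by move=> p; have [a ->] := quot_piP p; rewrite quot_mulE mulr1. Qed.

Fact quot_mulDl : left_distributive quot_mul +%R.
Proof.
move=> p q r; have [a ->] := quot_piP p; have [b ->] := quot_piP q; have [c ->] := quot_piP r.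
by rewrite -raddfD !quot_mulE mulrDl raddfD.
Qed.

Fact quot_mulDr : right_distributive quot_mul +%R.
Proof.
move=> p q r; have [a ->] := quot_piP p; have [b ->] := quot_piP q; have [c ->] := quot_piP r.
by rewrite -raddfD !quot_mulE mulrDr raddfD.
Qed.

Fact quot_one_neq0 : quot_one != 0.
Proof.
apply/eqP; rewrite -(raddf0 quot_pi) => /quot_piE.
by rewrite subr0 idealr1.
Qed.

HB.instance Definition _ := GRing.Zmodule_isNzRing.Build Q
  quot_mulA quot_mul1 quot_1mul quot_mulDl quot_mulDr quot_one_neq0.

Fact quot_scaleA (c d : k) (q : Q) :
  quot_scale c (quot_scale d q) = quot_scale (c * d) q.
Proof. by have [a ->] := quot_piP q; rewrite !quot_scaleE scalerA. Qed.

Fact quot_scale1 : left_id 1 quot_scale.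
Proof. by move=> q; have [a ->] := quot_piP q; rewrite quot_scaleE scale1r. Qed.

Fact quot_scaleDr : right_distributive quot_scale +%R.
Proof.
move=> c p q; have [a ->] := quot_piP p; have [b ->] := quot_piP q.
by rewrite -raddfD !quot_scaleE scalerDr raddfD.
Qed.

Fact quot_scaleDl (q : Q) : {morph quot_scale^~ q : c d / c + d}.
Proof.
move=> c d; have [a ->] := quot_piP q.
by rewrite !quot_scaleE scalerDl raddfD.
Qed.

HB.instance Definition _ := GRing.Zmodule_isLmodule.Build k Q
  quot_scaleA quot_scale1 quot_scaleDr quot_scaleDl.

Fact quot_scalerAl (c : k) (p q : Q) : c *: (p * q) = c *: p * q.
Proof.
have [a ->] := quot_piP p; have [b ->] := quot_piP q.
rewrite /GRing.scale /= /GRing.mul /= quot_mulE !quot_scaleE quot_mulE.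
by rewrite scalerAl.
Qed.
HB.instance Definition _ := GRing.Lmodule_isLalgebra.Build k Q quot_scalerAl.

Fact quot_scalerAr (c : k) (p q : Q) : c *: (p * q) = p * (c *: q).
Proof.
have [a ->] := quot_piP p; have [b ->] := quot_piP q.
rewrite /GRing.scale /= /GRing.mul /= quot_mulE !quot_scaleE quot_mulE.
by rewrite scalerAr.
Qed.
HB.instance Definition _ := GRing.Lalgebra_isAlgebra.Build k Q quot_scalerAr.

Fact quot_pi_is_monoid_morphism : monoid_morphism quot_pi.
Proof. by split=> // a b; rewrite [RHS]quot_mulE. Qed.
HB.instance Definition _ :=
  GRing.isMonoidMorphism.Build A Q quot_pi quot_pi_is_monoid_morphism.

Fact quot_pi_is_scalable : scalable quot_pi.
Proof. by move=> c a; rewrite [RHS]quot_scaleE. Qed.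
HB.instance Definition _ :=
  GRing.isScalable.Build k A Q *:%R quot_pi quot_pi_is_scalable.

End QuotAlg.

Definition alg_isomorphic (k : pzRingType) (A B : algType k) : Prop :=
  exists f : {lrmorphism A -> B}, bijective f.

Definition has_quotient_isomorphic_to
    (k : pzRingType) (A B : algType k) : Prop :=
  exists I : ideal A, alg_isomorphic (quot_alg I) B.

Definition two_sided_ideal (A : nzRingType) (P : A -> Prop) : Prop :=
  [/\ P 0, (forall u v, P u -> P v -> P (u - v)),
      (forall a u, P u -> P (a * u)) & (forall a u, P u -> P (u * a))].

Definition generated (A : nzRingType) (s : seq A) : {pred A} :=
  fun a => `[< forall P : A -> Prop,
                 two_sided_ideal P -> {in s, forall r, P r} -> P a >].

Section GeneratedIdeal.
Variables (A : nzRingType) (s : seq A) (s1 : 1 \notin generated s).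

(* The argument [s1] is a dummy, so that [ideal_by s1] can carry instances. *)
Definition ideal_by (_ : 1 \notin generated s) : {pred A} := generated s.

Fact ideal_by_closed : idealr_closed (ideal_by s1).
Proof.
split=> //; first by apply/asboolP=> P [].
move=> a u v /asboolP gu /asboolP gv; apply/asboolP=> P PI sP.
have [P0 PB PMl _] := PI; rewrite -[v]opprK -[- v]sub0r.
by apply: (PB); [apply: PMl; apply: gu | apply: (PB) => //; apply: gv].
Qed.
HB.instance Definition _ := isIdealr.Build A (ideal_by s1) ideal_by_closed.

Fact ideal_by_mulr (a u : A) : u \in ideal_by s1 -> u * a \in ideal_by s1.
Proof.
move=> /asboolP gu; apply/asboolP=> P PI sP.
by have [_ _ _] := PI; apply; apply: gu.
Qed.

Definition generated_ideal : ideal A := Ideal ideal_by_mulr.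
End GeneratedIdeal.

(* The free algebra k<x,y>: the algebra of the free monoid on two letters. *)
(* The algType instance that monalg declares on [malg] is reserved for        *)
(* commutative monoids, hence the type of its own; the operations are locked *)
(* only to keep unification from unfolding them.                             *)
Definition free_alg2 (k : comNzRingType) : Type := {malg k[{fmonom 'I_2}]}.

HB.lock Definition free_mul (k : comNzRingType) (p q : free_alg2 k) :
  free_alg2 k := (p : {malg k[{fmonom 'I_2}]}) * q.

HB.lock Definition free_scale (k : comNzRingType) (c : k) (p : free_alg2 k) :
  free_alg2 k := c *: (p : {malg k[{fmonom 'I_2}]}).

Section FreeAlg.
Variable k : comNzRingType.
Local Notation malgF := {malg k[{fmonom 'I_2}]}.
Local Notation F := (free_alg2 k).

HB.instance Definition _ := GRing.Zmodule.copy F malgF.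

Definition free_one : F := (1 : malgF).

Fact free_mulA : associative (@free_mul k).
Proof. by move=> p q r; rewrite free_mul.unlock; apply: (@mulrA malgF). Qed.
Fact free_mul1 : left_id free_one (@free_mul k).
Proof. by move=> p; rewrite free_mul.unlock; apply: (@mul1r malgF). Qed.
Fact free_1mul : right_id free_one (@free_mul k).
Proof. by move=> p; rewrite free_mul.unlock; apply: (@mulr1 malgF). Qed.
Fact free_mulDl : left_distributive (@free_mul k) +%R.
Proof. by move=> p q r; rewrite free_mul.unlock; apply: (@mulrDl malgF). Qed.
Fact free_mulDr : right_distributive (@free_mul k) +%R.
Proof. by move=> p q r; rewrite free_mul.unlock; apply: (@mulrDr malgF). Qed.
Fact free_one_neq0 : free_one != 0.
Proof. exact: (@oner_neq0 malgF). Qed.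
HB.instance Definition _ := GRing.Zmodule_isNzRing.Build F
  free_mulA free_mul1 free_1mul free_mulDl free_mulDr free_one_neq0.

Fact free_scaleA (c d : k) (p : F) :
  free_scale c (free_scale d p) = free_scale (c * d) p.
Proof. by rewrite free_scale.unlock; apply: (@scalerA _ malgF). Qed.
Fact free_scale1 : left_id 1 (@free_scale k).
Proof. by move=> p; rewrite free_scale.unlock; apply: (@scale1r _ malgF). Qed.
Fact free_scaleDr : right_distributive (@free_scale k) +%R.
Proof. by move=> c p q; rewrite free_scale.unlock; apply: (@scalerDr _ malgF). Qed.
Fact free_scaleDl (p : F) : {morph (@free_scale k)^~ p : c d / c + d}.
Proof. by move=> c d; rewrite free_scale.unlock; apply: (@scalerDl _ malgF). Qed.
HB.instance Definition _ := GRing.Zmodule_isLmodule.Build k F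
  free_scaleA free_scale1 free_scaleDr free_scaleDl.

Fact free_scalerAl (c : k) (p q : F) : c *: (p * q) = c *: p * q.
Proof.
rewrite /GRing.scale /GRing.mul /= free_scale.unlock free_mul.unlock.
exact: (@scalerAl _ malgF).
Qed.
HB.instance Definition _ := GRing.Lmodule_isLalgebra.Build k F free_scalerAl.

Let malg_scalerAr (c : k) (p q : malgF) : c *: (p * q) = p * (c *: q).
Proof.
rewrite (malgMEw (finmap.fsubset_refl _) (msuppZ_le c q)) malgME scaler_sumr.
apply: eq_bigr => u _; rewrite scaler_sumr; apply: eq_bigr => v _.
apply/malgP=> m; rewrite mcoeffZ [X in _ * X]mcoeffU [RHS]mcoeffU.
by rewrite mcoeffZ mulrnAr mulrCA.
Qed.

Fact free_scalerAr (c : k) (p q : F) : c *: (p * q) = p * (c *: q).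
Proof.
rewrite /GRing.scale /GRing.mul /= free_scale.unlock free_mul.unlock.
exact: malg_scalerAr.
Qed.
HB.instance Definition _ := GRing.Lalgebra_isAlgebra.Build k F free_scalerAr.

Lemma free_mulE (p q : F) : p * q = (p : malgF) * (q : malgF) :> malgF.
Proof. by rewrite [LHS]/GRing.mul /= free_mul.unlock. Qed.

Lemma free_scale_malgE (c : k) (p : F) : c *: p = c *: (p : malgF) :> malgF.
Proof. by rewrite [LHS]/GRing.scale /= free_scale.unlock. Qed.

Definition free_x : F := << fmu (ord0 : 'I_2) >>.
Definition free_y : F := << fmu (ord_max : 'I_2) >>.

Definition const_coef (p : F) : k := mcoeff mone p.

Lemma const_coefM (p q : F) : const_coef (p * q) = const_coef p * const_coef q.
Proof.
rewrite /const_coef free_mulE.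
exact: (rmorphM (mcoeff mone : {rmorphism malgF -> k})).
Qed.

Lemma const_coefB (p q : F) : const_coef (p - q) = const_coef p - const_coef q.
Proof. exact: mcoeffB. Qed.

Lemma const_coef_x : const_coef free_x = 0.
Proof. by rewrite /const_coef mcoeffU fm1_eq1. Qed.

Lemma const_coef_y : const_coef free_y = 0.
Proof. by rewrite /const_coef mcoeffU fm1_eq1. Qed.

Lemma generated_proper (s : seq F) :
  (forall r : F, r \in s -> const_coef r = 0) -> 1 \notin generated s.
Proof.
move=> s0; apply/negP=> /asboolP /(_ (fun p : F => const_coef p = 0)) H.
suff : const_coef 1 = 0.
  by rewrite /const_coef mcoeff1 eqxx => /eqP; rewrite oner_eq0.
apply: H => //; split=> [|u v u0 v0|a u u0|a u u0].
- exact: mcoeff0.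
- by rewrite const_coefB u0 v0 subr0.
- by rewrite const_coefM u0 mulr0.
- by rewrite const_coefM u0 mul0r.
Qed.

Local Notation x := free_x.
Local Notation y := free_y.

Definition jordan_rels : seq F := [:: x * y - y * x - y ^+ 2].

Definition ringel_rels : seq F :=
  [:: y ^+ 2; y * x - x * y; x ^+ 2 * y; x ^+ 3].

Let const_coefE := (expr2, exprS, const_coefB, const_coefM,
  const_coef_x, const_coef_y, mulr0, mul0r, subr0).

Fact jordan_rels_proper : 1 \notin generated jordan_rels.
Proof.
by apply: generated_proper => r; rewrite inE => /eqP ->; rewrite !const_coefE.
Qed.

Fact ringel_rels_proper : 1 \notin generated ringel_rels.
Proof.
apply: generated_proper => r; rewrite !inE => /or4P[] /eqP ->;
  by rewrite !const_coefE.
Qed.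
End FreeAlg.

Notation jordan_plane k :=
  (@quot_alg k (free_alg2 k) (generated_ideal (@jordan_rels_proper k))).
Notation ringel_alg k :=
  (@quot_alg k (free_alg2 k) (generated_ideal (@ringel_rels_proper k))).

Definition jordan_y (k : comNzRingType) : jordan_plane k :=
  quot_pi _ (free_y k).

Section ImageAlg.
Variables (k : pzRingType) (A B : algType k) (f : {lrmorphism A -> B}).

Definition in_image : {pred B} := fun b => `[< exists a, f a = b >].

Record image_alg := ImageAlg { image_val :> B; _ : in_image image_val }.

HB.instance Definition _ := [isSub for image_val].
HB.instance Definition _ := [Choice of image_alg by <:].

Fact in_image_closed : GRing.subalg_closed in_image.
Proof.
split=> [|c _ _ /asboolP[a <-] /asboolP[b <-]|_ _ /asboolP[a <-] /asboolP[b <-]].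
- by apply/asboolP; exists 1; rewrite rmorph1.
- by apply/asboolP; exists (c *: a + b); rewrite linearP.
- by apply/asboolP; exists (a * b); rewrite rmorphM.
Qed.
HB.instance Definition _ :=
  GRing.SubChoice_isSubAlgebra.Build k B in_image image_alg
    (GRing.subalg_closed_semi in_image_closed).
End ImageAlg.

(* A finite-dimensional left A-module of dimension d, given by the action of *)
(* A on column vectors; d = 0 is the zero module.                            *)

Record rep (k : fieldType) (A : algType k) (d : nat) := Rep {
  rep_act :> {rmorphism A -> 'M[k]_d};
  rep_scale : scalable rep_act
}.

Definition rep_iso (k : fieldType) (A : algType k) (d e : nat)
    (U : rep A d) (V : rep A e) : Prop :=
  exists (P : 'M[k]_(e, d)) (Q : 'M[k]_(d, e)),
    [/\ P *m Q = 1%:M, Q *m P = 1%:M & forall a, P *m U a = V a *m P].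

Section DirectSum.
Variables (k : fieldType) (A : algType k) (d e : nat).
Variables (U : rep A d) (V : rep A e).

Definition sum_act (a : A) : 'M[k]_(d + e) := block_mx (U a) 0 0 (V a).

Fact sum_act_zmod : zmod_morphism sum_act.
Proof.
move=> a b; rewrite /sum_act !rmorphB opp_block_mx add_block_mx.
by rewrite !oppr0 !addr0.
Qed.

Fact sum_act_monoid : monoid_morphism sum_act.
Proof.
split=> [|a b]; rewrite /sum_act ?rmorph1 -?scalar_mx_block //.
rewrite -[RHS]/(_ *m _) mulmx_block !(mulmx0, mul0mx, addr0, add0r).
by rewrite !rmorphM.
Qed.

HB.instance Definition _ :=
  GRing.isZmodMorphism.Build A 'M[k]_(d + e) sum_act sum_act_zmod.
HB.instance Definition _ :=
  GRing.isMonoidMorphism.Build A 'M[k]_(d + e) sum_act sum_act_monoid.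

Fact sum_act_scale : scalable sum_act.
Proof.
by move=> c a; rewrite /sum_act !rep_scale scale_block_mx !scaler0.
Qed.

Definition rep_sum : rep A (d + e) := Rep sum_act_scale.
End DirectSum.

Definition indecomposable (k : fieldType) (A : algType k) (d : nat)
    (U : rep A d) : Prop :=
  (0 < d)%N /\
  forall (d1 d2 : nat) (U1 : rep A d1) (U2 : rep A d2),
    rep_iso U (rep_sum U1 U2) -> d1 = 0%N \/ d2 = 0%N.

(* An A-S-bimodule that is free of rank m as a right S-module, i.e. the      *)
(* column space S^m on which A acts by k-linear matrices over S.             *)

Record bimod (k : fieldType) (A S : algType k) (m : nat) := Bimod {
  bimod_act :> {rmorphism A -> 'M[S]_m};
  bimod_scale : forall c a i j, bimod_act (c *: a) i j = c *: bimod_act a i j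
}.

(* M (x)_S V: as M is S^m as a right module, the space is the m-fold direct  *)
(* sum of V, and a acts by the matrix of M with every entry s replaced by    *)
(* the action of s on V.                                                     *)

Section Tensor.
Variables (k : fieldType) (A S : algType k) (m d : nat).
Variables (M : bimod A S m) (V : rep S d).

Definition tensor_act (a : A) : 'M[k]_(\sum_(i < m) d) :=
  \mxblock_(i < m, j < m) V (M a i j).

Fact tensor_act_zmod : zmod_morphism tensor_act.
Proof.
move=> a b; rewrite /tensor_act -mxblockB; apply/eq_mxblock => i j.
by rewrite rmorphB !mxE rmorphB.
Qed.

Fact tensor_act_monoid : monoid_morphism tensor_act.
Proof.
split=> [|a b]; rewrite /tensor_act.
  rewrite -[RHS]mxdiagZ; apply/eq_mxblock => i j.
  have -> : M 1 = 1%:M by exact: rmorph1.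
  case: (eqVneq i j) => [<-|ij]; first by rewrite conform_mx_id mxE eqxx rmorph1.
  by rewrite mxE (negbTE ij) rmorph0.
rewrite -[RHS]/(_ *m _) mul_mxblock; apply/eq_mxblock => i j.
have -> : M (a * b) = M a *m M b by exact: rmorphM.
rewrite mxE raddf_sum; apply: eq_bigr => l _.
exact: rmorphM.
Qed.

HB.instance Definition _ :=
  GRing.isZmodMorphism.Build A 'M[k]_(\sum_(i < m) d) tensor_act tensor_act_zmod.
HB.instance Definition _ :=
  GRing.isMonoidMorphism.Build A 'M[k]_(\sum_(i < m) d) tensor_act tensor_act_monoid.

Fact tensor_act_scale : scalable tensor_act.
Proof.
move=> c a; rewrite /tensor_act; apply/matrixP => s t.
by rewrite !mxE bimod_scale rep_scale mxE.
Qed.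

Definition tensor : rep A (\sum_(i < m) d) := Rep tensor_act_scale.
End Tensor.

(* The one-dimensional k[T]-module k[T]/(T - lambda). *)

Section Point.
Variables (k : fieldType) (lambda : k).

Definition point_act (p : {poly k}) : 'M[k]_1 := (p.[lambda])%:M.

Fact point_act_zmod : zmod_morphism point_act.
Proof. by move=> p q; rewrite /point_act hornerD hornerN raddfB. Qed.

Fact point_act_monoid : monoid_morphism point_act.
Proof. by split=> [|p q]; rewrite /point_act ?hornerC // hornerM scalar_mxM. Qed.

HB.instance Definition _ :=
  GRing.isZmodMorphism.Build {poly k} 'M[k]_1 point_act point_act_zmod.
HB.instance Definition _ :=
  GRing.isMonoidMorphism.Build {poly k} 'M[k]_1 point_act point_act_monoid.

Fact point_act_scale : scalable point_act.
Proof. by move=> c p; rewrite /point_act hornerZ scale_scalar_mx. Qed.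

Definition point : rep {poly k} 1 := Rep point_act_scale.
End Point.

(* Drozd's definitions.  Wild: some A-k<x,y>-bimodule M, free of finite rank *)
(* over k<x,y>, gives a functor M (x) - on finite-dimensional modules that   *)
(* preserves indecomposability and reflects isomorphism.                     *)

Definition wild (k : fieldType) (A : algType k) : Prop :=
  exists (m : nat) (M : bimod A (free_alg2 k) m),
    (forall d (V : rep (free_alg2 k) d),
       indecomposable V -> indecomposable (tensor M V)) /\
    (forall d e (V : rep (free_alg2 k) d) (W : rep (free_alg2 k) e),
       rep_iso (tensor M V) (tensor M W) -> rep_iso V W).

(* Tame: for each d there are finitely many A-k[T]-bimodules, free of finite *)
(* rank over k[T] (necessarily of rank d), such that all but finitely many   *)
(* isomorphism classes of d-dimensional indecomposables arise from them by   *)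
(* specializing T.  Algebras of finite type are tame (take no bimodules).    *)

Definition tame (k : fieldType) (A : algType k) : Prop :=
  forall d : nat, (0 < d)%N ->
    exists (p q : nat) (M : 'I_p -> bimod A {poly k} d) (E : 'I_q -> rep A d),
      forall U : rep A d, indecomposable U ->
        (exists i lambda, rep_iso U (tensor (M i) (point lambda))) \/
        (exists j, rep_iso U (E j)).

(* Main.v *)
Require Import Defs.
From HB Require Import structures.
From mathcomp Require Import all_boot all_algebra.
From mathcomp Require Import boolp perm zify ring.
From mathcomp Require finmap.

(** Write [R] for the algebra with generators [x], [y] and relations
[y^2 = yx - xy = x^2 y = x^3 = 0], and [A_n] for the image algebra in dimension
[n].

_Wildness of_ [R].  The algebra [R] has a covering by a grid with vertices [p_i],
[q_i], [r_i] and arrows [x : p_i -> q_i -> r_i], [y : p_i -> q_(i-1)] and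
[y : q_i -> r_(i-1)].  Five modules with one-dimensional or zero vertex spaces,
called strings below, are nonzero at [r_0], and their supports are so chosen
that modulo [r_0] a homomorphism between two different strings vanishes at [q_0]
and at [q_1], from where the arrows lead into [r_0].  For a module [V] over
[k<x,y>], tensor the strings with [V] and identify their five copies of [V] at
[r_0] with the subspaces of [V^2] spanned by the vectors [(1, 1)], [(1, 0)],
[(0, 1)], [(1, x)] and [(1, y)].  A homomorphism
between two modules obtained in this way respects the five subspaces.  As in
the five subspace problem it therefore acts on [V^2] as [diag(g, g)], where [g]
is a homomorphism for [x] and [y]; then it acts by [g] along every string
([string_hom]).  So the trace of an endomorphism is [25 tr g], an idempotent with
[g = 0] vanishes because its rank is its trace, and the construction preserves
indecomposability and reflects isomorphism ([ringel_wild]).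

_The quotient for_ [n >= 5].  On the stable image of [y] the relation would read
[y^-1 x - x y^-1 = 1], which a comparison of traces excludes
([jordan_relation_nilpotent]).  So [y] is a nilpotent Jordan block in a suitable
basis.  The relation then forces the first superdiagonal of [x] to be an
arithmetic progression and the second one to be constant.  In an arbitrary
element of [A_n] the entries of the first two superdiagonals are polynomials,
of degree at most one and two, in the row number.  The coefficients of these
polynomials multiply like the coordinates in [R] once the constant coefficient
on the second superdiagonal is forgotten ([diag_polyM]), and they can be read
off from the matrix as soon as the second superdiagonal has three entries, that
is, for [n >= 5] ([ringel_quotient]).  A module family over a quotient is one over
the algebra, so [A_n] is wild ([wild_pullback]).

_Tameness for_ [n <= 3].  Here [A_n] is generated by two elements [x], [z] with
[x^2 = z^2 = z x = 0], and [x = 0] if [n <= 2].  By Fitting's lemma two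
indecomposable modules are isomorphic as soon as there are homomorphisms in
both directions whose composite is not nilpotent ([rep_iso_of_homs]).  Such
homomorphisms come from the chains [u X = v1 Z, v1 X = v2 Z, ...] that filter
every module.  If [z] followed by [x] is nonzero on an indecomposable module,
then the two jumps of the filtration at which this is seen determine the module
([long_type_hom], [long_type_exists]).  Otherwise the module is a pencil of
matrices ([pencil_trichotomy]).  A pencil with a polynomial null vector on the
left or on the right contains a chain whose length determines it
([short_type_hom]).  A square pencil with nonzero determinant is invertible at
one of the integers [0, ..., p], by which it can be normalised to
[(1 - c f, f)]; indecomposability makes [f] the sum of a scalar [lambda] and a
nilpotent matrix determined by its nilpotency index ([regular_local],
[local_nilpotent_conj]).  So in each dimension there are finitely many discrete
classes and finitely many families with parameter [lambda]
([tame_of_coordinates]). *)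

Set Implicit Arguments.
Unset Strict Implicit.
Unset Printing Implicit Defensive.

Import GRing.Theory.
Local Open Scope ring_scope.

(** * Modules and Fitting's lemma *)

Lemma rep_build (k : fieldType) (A : algType k) (d : nat) (f : A -> 'M[k]_d) :
  linear f -> f 1 = 1 -> {morph f : a b / a * b} ->
  exists U : rep A d, forall a, U a = f a.
Proof.
move=> fL f1 fM.
have fB : zmod_morphism f by move=> a b; rewrite -scaleN1r addrC fL scaleN1r addrC.
have f_mon : monoid_morphism f by [].
pose za := GRing.isZmodMorphism.Build A 'M[k]_d f fB.
pose ma := GRing.isMonoidMorphism.Build A 'M[k]_d f f_mon.
pose F : {rmorphism A -> 'M[k]_d} := HB.pack f za ma.
have FZ : scalable F.
  by move=> c a; have := fL c a 0; rewrite -(subrr 0) fB !subrr !addr0.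
by exists (Rep FZ).
Qed.

Section RepIso.
Variables (k : fieldType) (A : algType k).

Lemma rep_linear d (U : rep A d) : linear U.
Proof. by move=> c a b; rewrite rmorphD rep_scale. Qed.

Lemma inverse_hom d e (U : rep A d) (V : rep A e) (P : 'M[k]_(e, d)) (Q : 'M[k]_(d, e)) :
  P *m Q = 1%:M -> Q *m P = 1%:M -> (forall a, P *m U a = V a *m P) ->
  forall a, Q *m V a = U a *m Q.
Proof.
move=> PQ QP PU a.
by rewrite -[V a]mulmx1 -PQ !mulmxA -(mulmxA Q) -PU mulmxA QP mul1mx.
Qed.

Lemma rep_iso_trans d e f (U : rep A d) (V : rep A e) (W : rep A f) :
  rep_iso U V -> rep_iso V W -> rep_iso U W.
Proof.
move=> [P [Q [PQ QP PU]]] [P' [Q' [PQ' QP' PU']]].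
exists (P' *m P), (Q *m Q'); split=> [||a].
- by rewrite mulmxA -(mulmxA P') PQ mulmx1.
- by rewrite mulmxA -(mulmxA Q) QP' mulmx1.
- by rewrite -mulmxA PU !mulmxA PU'.
Qed.

(** An idempotent endomorphism splits a module: its image and the image of the
complementary idempotent are the two summands. *)
Lemma rep_split d (U : rep A d) (e : 'M[k]_d) :
  e *m e = e -> (forall a, e *m U a = U a *m e) ->
  exists (U1 : rep A (\rank e)) (U2 : rep A (\rank (1%:M - e))),
    rep_iso U (rep_sum U1 U2).
Proof.
move=> ee eU; set e' := 1%:M - e.
have ee' : e' *m e' = e'.
  by rewrite /e' mulmxBl mul1mx mulmxBr mulmx1 ee subrr subr0.
have e_e' : e *m e' = 0 by rewrite /e' mulmxBr mulmx1 ee subrr.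
have e'_e : e' *m e = 0 by rewrite /e' mulmxBl mul1mx ee subrr.
have eU' a : e' *m U a = U a *m e' by rewrite mulmxBl mulmxBr mul1mx mulmx1 eU.
have cancel m n p (M N : 'M[k]_(m, n)) (C : 'M_(p, m)) (R : 'M_(n, p)) :
    row_full C -> row_free R -> C *m M *m R = C *m N *m R -> M = N.
  move=> Cf Rf /(row_free_inj Rf); exact: row_full_inj.
have baseM (f g fg : 'M[k]_d) : f *m g = fg ->
    col_base f *m (row_base f *m col_base g) *m row_base g = fg.
  by move=> <-; rewrite (mulmxA (col_base f)) mulmx_base -(mulmxA f) mulmx_base.
have sub (f : 'M[k]_d) : f *m f = f -> row_base f *m col_base f = 1%:M.
  move=> ff; apply: (cancel _ _ _ _ _ _ _ (col_base_full f) (row_base_free f)).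
  by rewrite (baseM _ _ _ ff) mulmx1 mulmx_base.
have orth (f g : 'M[k]_d) : f *m g = 0 -> row_base f *m col_base g = 0.
  move=> fg; apply: (cancel _ _ _ _ _ _ _ (col_base_full f) (row_base_free g)).
  by rewrite (baseM _ _ _ fg) mulmx0 mul0mx.
have Rf (f : 'M[k]_d) : f *m f = f -> row_base f *m f = row_base f.
  by move=> ff; rewrite -[X in _ *m X](mulmx_base f) mulmxA sub ?mul1mx.
have part (f : 'M[k]_d) : f *m f = f -> (forall a, f *m U a = U a *m f) ->
    exists V : rep A (\rank f), forall a, V a = row_base f *m U a *m col_base f.
  move=> ff fU; apply: rep_build => [c a b||a b].
  - by rewrite rep_linear mulmxDr mulmxDl -scalemxAr -scalemxAl.
  - by rewrite rmorph1 mulmx1 sub.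
  - move: (Rf f ff) (mulmx_base f); set C := col_base f; set R := row_base f.
    move=> Rf' CR; rewrite rmorphM -[X in _ = X]/(_ *m _) -[U a * U b]/(_ *m _).
    have -> : R *m U a *m C *m (R *m U b *m C) = R *m U a *m (C *m R) *m U b *m C.
      by rewrite !mulmxA.
    by rewrite CR -[R *m U a *m f]mulmxA -fU !mulmxA Rf'.
have [U1 U1E] := part e ee eU; have [U2 U2E] := part e' ee' eU'.
exists U1, U2, (col_mx (row_base e) (row_base e')), (row_mx (col_base e) (col_base e')).
split=> [||a].
- by rewrite mul_col_row !sub // !orth // -scalar_mx_block.
- by rewrite mul_row_col !mulmx_base addrC subrK.
- rewrite mul_col_mx /= /sum_act mul_block_col !mul0mx addr0 add0r U1E U2E.
  by congr col_mx; rewrite -mulmxA mulmx_base -mulmxA -?eU -?eU' mulmxA Rf.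
Qed.

Lemma indecomposable_idempotent d (U : rep A d) (e : 'M[k]_d) :
  indecomposable U -> e *m e = e -> (forall a, e *m U a = U a *m e) ->
  e = 0 \/ e = 1%:M.
Proof.
move=> [_ Uind] ee eU; have [U1 [U2 /Uind]] := rep_split ee eU.
case=> /eqP; rewrite mxrank_eq0 => /eqP; first by left.
by move=> /subr0_eq; right.
Qed.

(** Fitting's lemma.  Writing the characteristic polynomial of [f] as
[q * X^m] with [q] prime to [X], Bezout produces a polynomial in [f] that is
the idempotent projecting onto the stable image of [f]. *)
Lemma indecomposable_endo d (U : rep A d) (f : 'M[k]_d) :
  indecomposable U -> (forall a, f *m U a = U a *m f) ->
  f \in unitmx \/ exists n, f ^+ n = 0.
Proof.
case: d U f => [|d] U f Uind fU; first by case: Uind.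
have [n [q q0 chE]] := multiplicity_XsubC (char_poly f) 0.
rewrite monic_neq0 ?char_poly_monic //= in q0.
have fq_0 : horner_mx f (q * ('X - 0%:P) ^+ n) = 0 by rewrite -chE Cayley_Hamilton.
have cop : coprimep (('X - 0%:P) ^+ n) q by rewrite coprimep_expl // coprimep_sym coprimep_XsubC.
have [[u v] /= uvP] := Bezout_eq1_coprimepP _ _ cop.
have fX : horner_mx f (('X - 0%:P) ^+ n) = f ^+ n.
  by rewrite subr0 rmorphXn /= horner_mx_X.
have fq0 : horner_mx f q * f ^+ n = 0 by rewrite -fX -rmorphM.
have comm p : forall a, horner_mx f p *m U a = U a *m horner_mx f p.
  elim/poly_ind: p => [|p c IHp] a; first by rewrite rmorph0 mul0mx mulmx0.
  rewrite rmorphD rmorphM /= horner_mx_X horner_mx_C -[_ * f]/(_ *m f).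
  by rewrite mulmxDl mulmxDr -mulmxA fU !mulmxA IHp scalar_mxC.
have sum1 : horner_mx f u * f ^+ n + horner_mx f v * horner_mx f q = 1.
  by rewrite -fX -!rmorphM -rmorphD uvP rmorph1.
pose e := horner_mx f u * f ^+ n.
have ee : e *m e = e.
  rewrite -[_ *m _]/(e * e) -[RHS]mulr1 -sum1 mulrDr [X in _ + X](_ : _ = 0) ?addr0 //.
  rewrite /e -fX -!rmorphM (_ : _ * _ = u * v * (q * ('X - 0%:P) ^+ n)); last first.
    by rewrite mulrACA -!mulrA [q * _]mulrC.
  by rewrite rmorphM [X in _ * X]fq_0 mulr0.
have eU a : e *m U a = U a *m e by rewrite /e -fX -rmorphM comm.
have [e0|e1] := indecomposable_idempotent Uind ee eU.
- right; exists n; rewrite -[LHS]mul1r -sum1 -/e e0 add0r -mulrA.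
  by rewrite fq0 mulr0.
- left; have qf0 : horner_mx f q = 0.
    have qu : horner_mx f q * horner_mx f u = horner_mx f u * horner_mx f q.
      by rewrite -!rmorphM mulrC.
    by rewrite -[LHS]mulr1 -[1]e1 /e mulrA qu -mulrA fq0 mulr0.
  have copX : coprimep ('X - 0%:P) q by rewrite coprimep_sym coprimep_XsubC.
  have [[u' v'] /= uvP'] := Bezout_eq1_coprimepP _ _ copX.
  have : horner_mx f u' * horner_mx f ('X - 0%:P) + horner_mx f v' * horner_mx f q = 1.
    by rewrite -!rmorphM -rmorphD uvP' rmorph1.
  rewrite qf0 mulr0 addr0 subr0 horner_mx_X.
  by move=> /mulmx1_unit [].
Qed.

Lemma fixed_col_not_nilpotent d (N : 'M[k]_d) (w : 'cV[k]_d) n :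
  w != 0 -> N *m w = w -> N ^+ n != 0.
Proof.
move=> w0 Nw; apply: contra w0 => /eqP N0.
have <- : N ^+ n *m w = w; last by rewrite N0 mul0mx.
elim: n {N0} => [|n IHn]; first exact: mul1mx.
by rewrite exprS -[_ * _]/(_ *m _) -mulmxA IHn.
Qed.

Lemma fixed_row_not_nilpotent d (N : 'M[k]_d) (w : 'rV[k]_d) n :
  w != 0 -> w *m N = w -> N ^+ n != 0.
Proof.
move=> w0 wN; apply: contra w0 => /eqP N0.
have <- : w *m N ^+ n = w; last by rewrite N0 mulmx0.
elim: n {N0} => [|n IHn]; first exact: mulmx1.
by rewrite exprS -[_ * _]/(_ *m _) mulmxA wN.
Qed.

(** If no power of [g f] vanishes then no power of [f g] does, as
[(g f)^(n+1) = g (f g)^n f].  So both composites are invertible, and then [f] has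
a left and a right inverse. *)
Lemma invertible_of_composites d e (f : 'M[k]_(e, d)) (g : 'M[k]_(d, e)) :
  (forall n, (g *m f) ^+ n != 0) ->
  g *m f \in unitmx \/ (exists n, (g *m f) ^+ n = 0) ->
  f *m g \in unitmx \/ (exists n, (f *m g) ^+ n = 0) ->
  exists f', f *m f' = 1%:M /\ f' *m f = 1%:M.
Proof.
move=> gf_nil [gf_unit|[n gf0]] fg_cases; last first.
  by move: (gf_nil n); rewrite gf0 eqxx.
have fg_unit : f *m g \in unitmx.
  case: fg_cases => // -[n fg0]; move: (gf_nil n.+1).
  suff -> : (g *m f) ^+ n.+1 = g *m (f *m g) ^+ n *m f.
    by rewrite fg0 mulmx0 mul0mx eqxx.
  elim: {fg0} n => [|n IHn]; first by rewrite expr1 expr0 mulmx1.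
  by rewrite exprS IHn [in RHS]exprS -![_ * _]/(_ *m _) !mulmxA.
exists (invmx (g *m f) *m g); split; last by rewrite -mulmxA mulVmx.
have H : f *m (invmx (g *m f) *m g) *m (f *m g) = f *m g.
  by rewrite -!mulmxA (mulmxA g f g) (mulmxA (invmx _)) mulVmx // mul1mx.
by rewrite -[LHS]mulmx1 -(mulmxV fg_unit) mulmxA H mulmxV.
Qed.

(** Every isomorphism between indecomposable modules below is found in this way:
it suffices to construct homomorphisms in both directions whose composite has a
nonzero fixed vector. *)
Lemma rep_iso_of_homs d e (U : rep A d) (V : rep A e)
    (f : 'M[k]_(e, d)) (g : 'M[k]_(d, e)) :
  indecomposable U -> indecomposable V ->
  (forall a, f *m U a = V a *m f) -> (forall a, g *m V a = U a *m g) ->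
  (forall n, (g *m f) ^+ n != 0) -> rep_iso U V.
Proof.
move=> Uind Vind fU gV gf_nil.
have [||f' [ff' f'f]] := invertible_of_composites gf_nil.
- by apply: (indecomposable_endo Uind) => a; rewrite -mulmxA fU !mulmxA gV.
- by apply: (indecomposable_endo Vind) => a; rewrite -mulmxA gV !mulmxA fU.
- by exists f, f'.
Qed.
End RepIso.

(** * The linear relation [u X = v Z] *)

Section Pull.
Variables (k : fieldType) (d : nat).
Implicit Types (X Z W : 'M[k]_d).

(** The subspace of all [u] with [u X] in [W Z], that is, the preimage of [W]
under the linear relation [u X = v Z].  Subspaces are row spaces. *)
Definition pull X Z W : 'M[k]_d := kermx (X *m cokermx (W *m Z)).

Lemma sub_pull X Z W m (u : 'M_(m, d)) :
  (u <= pull X Z W)%MS = (u *m X <= W *m Z)%MS.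
Proof. by rewrite (sameP sub_kermxP eqP) mulmxA -submxE. Qed.

Lemma pullS X Z W W' : (W <= W')%MS -> (pull X Z W <= pull X Z W')%MS.
Proof.
move=> WW'; rewrite sub_pull.
have : (pull X Z W *m X <= W *m Z)%MS by rewrite -sub_pull.
by move/submx_trans; apply; apply: submxMr.
Qed.

Lemma ker_sub_pull X Z W m (u : 'M_(m, d)) : u *m X = 0 -> (u <= pull X Z W)%MS.
Proof. by move=> uX; rewrite sub_pull uX sub0mx. Qed.

Lemma pull_step X Z W (u : 'rV_d) :
  (u <= pull X Z W)%MS -> exists2 v : 'rV_d, (v <= W)%MS & u *m X = v *m Z.
Proof.
rewrite sub_pull => /submxP[c ->]; exists (c *m W); rewrite ?submxMl //.
by rewrite mulmxA.
Qed.

(** Duality for the relation: the functionals that vanish on the preimage of [W]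
are the functionals [X psi] with [Z psi] vanishing on [W]. *)
Lemma pull_dual X Z W (phi : 'cV_d) :
  pull X Z W *m phi = 0 ->
  exists psi : 'cV_d, phi = X *m psi /\ W *m (Z *m psi) = 0.
Proof.
set K := X *m cokermx (W *m Z) => K0.
have /submxP[c phiE] : (phi^T <= K^T)%MS.
  rewrite submxE; set C := cokermx K^T.
  have /submxP[D CE] : (C^T <= kermx K)%MS.
    by apply/sub_kermxP/trmx_inj; rewrite trmx_mul trmxK mulmx_coker trmx0.
  by apply/eqP/trmx_inj; rewrite trmx_mul trmxK CE -mulmxA [_ *m phi]K0 mulmx0 trmx0.
have {}phiE : phi = K *m c^T by apply: trmx_inj; rewrite trmx_mul trmxK.
exists (cokermx (W *m Z) *m c^T); split; first by rewrite mulmxA.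
by rewrite -[RHS](mul0mx _ c^T) -(mulmx_coker (W *m Z)) !mulmxA.
Qed.

(** A monotone operator that starts below (above) its first value stabilises
after [d] iterations, since the rank can only move [d] times. *)
Lemma iter_stable_up (f : 'M[k]_d -> 'M[k]_d) W :
  (forall A B, (A <= B)%MS -> (f A <= f B)%MS) -> (W <= f W)%MS ->
  (iter d.+1 f W <= iter d f W)%MS.
Proof.
move=> fS W0.
have inc n : (iter n f W <= iter n.+1 f W)%MS by elim: n => //= n; apply: fS.
have st n : (iter n.+1 f W <= iter n f W)%MS \/ (n < \rank (iter n.+1 f W))%N.
  elim: n => [|n IHn].
    case: (boolP (iter 1 f W <= W)%MS) => [|nle]; [by left | right].
    by apply: leq_ltn_trans (leq0n (\rank W)) _; apply: rank_ltmx; rewrite ltmxE W0.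
  case: IHn => [/fS|IHn]; first by left.
  case: (boolP (iter n.+2 f W <= iter n.+1 f W)%MS) => [|nle]; [by left | right].
  by apply: leq_ltn_trans IHn _; apply: rank_ltmx; rewrite ltmxE inc.
by case: (st d) => //; rewrite ltnNge rank_leq_col.
Qed.

Lemma iter_stable_down (f : 'M[k]_d -> 'M[k]_d) W :
  (forall A B, (A <= B)%MS -> (f A <= f B)%MS) -> (f W <= W)%MS ->
  (iter d f W <= iter d.+1 f W)%MS.
Proof.
move=> fS W0.
have dec n : (iter n.+1 f W <= iter n f W)%MS by elim: n => //= n; apply: fS.
have st n : (iter n f W <= iter n.+1 f W)%MS \/ (\rank (iter n.+1 f W) + n < d)%N.
  elim: n => [|n IHn].
    case: (boolP (W <= iter 1 f W)%MS) => [|nle]; [by left | right].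
    rewrite addn0; apply: leq_trans (rank_leq_col W); apply: rank_ltmx.
    by rewrite ltmxE W0.
  case: IHn => [/fS|IHn]; first by left.
  case: (boolP (iter n.+1 f W <= iter n.+2 f W)%MS) => [|nle]; [by left | right].
  rewrite addnS; apply: leq_ltn_trans IHn; rewrite ltn_add2r.
  by apply: rank_ltmx; rewrite ltmxE dec.
by case: (st d) => //; rewrite ltnNge leq_addl.
Qed.

Lemma iter_pull_inc X Z W n :
  (W <= pull X Z W)%MS -> (iter n (pull X Z) W <= iter n.+1 (pull X Z) W)%MS.
Proof. by move=> W0; elim: n => //= n; apply: pullS. Qed.

Lemma iter_pull_dec X Z n :
  (iter n.+1 (pull X Z) 1%:M <= iter n (pull X Z) 1%:M)%MS.
Proof. by elim: n => [|n]; [exact: submx1 | apply: pullS]. Qed.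

(** If [u X = v Z] with [v] in [A], then [u] is in [A]; and every [u] in [B] has such
a [v] in [B].  So [v |-> u] maps a subspace of [B] modulo [A] onto [B] modulo [A],
and by dimension it is a bijection of [B] modulo [A].  Taking [u = 0] shows that
[Z] kills nothing in [B] outside [A].  This applies to the limits [A] of the
increasing and [B] of the decreasing filtration by chains. *)
Lemma pull_regular_part X Z A B :
  (pull X Z A <= A)%MS -> (B <= pull X Z B)%MS ->
  (forall b : 'rV_d, (b <= B)%MS -> b *m Z = 0 -> (b <= A)%MS) /\
  (forall b : 'rV_d, (b <= B)%MS ->
     exists2 b' : 'rV_d, (b - b' <= A)%MS & (b' *m Z <= X)%MS).
Proof.
move=> AA; rewrite sub_pull => /submxP[T]; rewrite mulmxA => BX.
(* [T] sends the basis of [B] to continuations of its vectors: [B X = B' Z]. *)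
pose B' := T *m B; pose K := cokermx A.
have inA m (u : 'M_(m, d)) : (u <= A)%MS = (u *m K == 0) by rewrite submxE.
have kerS : (kermx (B' *m K) <= kermx (B *m K))%MS.
  set C := kermx _; have CA : (C *m B' <= A)%MS by rewrite inA -mulmxA mulmx_ker.
  apply/sub_kermxP/eqP; rewrite mulmxA -inA; apply: submx_trans AA.
  by rewrite sub_pull -mulmxA BX mulmxA; apply: submxMr.
have B'B : (B' *m K <= B *m K)%MS by rewrite -mulmxA submxMl.
have BK : (B *m K <= B' *m K)%MS.
  rewrite -(geq_leqif (mxrank_leqif_sup B'B)).
  have := mxrankS kerS; rewrite !mxrank_ker.
  have := rank_leq_row (B *m K); have := rank_leq_row (B' *m K).
  set r := \rank _; set r' := \rank _ => rd r'd le; rewrite leqNgt; apply/negP => lt.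
  by have := ltn_sub2l (leq_trans lt r'd) lt; rewrite ltnNge le.
have split_ (b : 'rV_d) : (b <= B)%MS -> exists2 c : 'rV_d, (b - c *m B' <= A)%MS & True.
  move=> /submxP[c ->]; have : (c *m B *m K <= B' *m K)%MS.
    by apply: submx_trans BK; rewrite -mulmxA submxMl.
  case/submxP=> c' cE; exists c' => //; rewrite inA mulmxBl cE.
  by rewrite -(mulmxA c') subrr.
have rk : (kermx (B *m K) <= kermx (B' *m K))%MS.
  rewrite -(geq_leqif (mxrank_leqif_sup kerS)) !mxrank_ker leq_sub2l //.
  exact: mxrankS.
split=> [b /split_[c bc _] bZ|b /split_[c bc _]]; last first.
  exists (c *m B') => //; rewrite /B' -!mulmxA (mulmxA T) -BX mulmxA.
  exact: submxMl.
have : (c *m B <= A)%MS.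
  apply: submx_trans AA; rewrite sub_pull -mulmxA BX mulmxA.
  have -> : c *m (T *m B) *m Z = - ((b - c *m B') *m Z).
    by rewrite mulmxBl bZ sub0r opprK.
  by rewrite -mulNmx; apply: submxMr; rewrite eqmx_opp.
rewrite inA -mulmxA => /eqP/sub_kermxP/submx_trans/(_ rk)/sub_kermxP/eqP.
rewrite mulmxA -inA => cA; rewrite -[b](subrK (c *m B')).
by rewrite addmx_sub.
Qed.
End Pull.

(** * Homomorphisms built from chains *)

Section Chains.
Variable k : fieldType.

(** A jump of the filtration of ['rV_d] by chains [u X = v1 Z, v1 X = v2 Z, ...].
[(true, n)] is the jump between chains that die in [W] after [n] and [n + 1]
steps, [(false, n)] the jump between chains that survive [n + 1] and [n]
steps. *)
Definition jump := (bool * nat)%type.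

Definition lower d (X Z W : 'M[k]_d) (s : jump) : 'M[k]_d :=
  if s.1 then iter s.2 (pull X Z) W else iter s.2.+1 (pull X Z) 1%:M.

Definition upper d (X Z W : 'M[k]_d) (s : jump) : 'M[k]_d :=
  if s.1 then iter s.2.+1 (pull X Z) W else iter s.2 (pull X Z) 1%:M.

Section HalfChain.
Variables (d1 d2 : nat) (X1 Z1 : 'M[k]_d1) (X2 Z2 : 'M[k]_d2).

(** The contribution [phi *m u + Z1 *m D + D' *m X2] of a chain starting at
[u] to a homomorphism, where [phi] is dual to [u]: it intertwines [X1], [X2]
and [Z1], [Z2] except for the term [phi *m u *m Z2] at the start. *)
Definition half_hom (phi : 'cV[k]_d1) (u : 'rV[k]_d2) (D D' : 'M[k]_(d1, d2)) :=
  X1 *m D' *m X2 = (phi *m u + Z1 *m D) *m X2 /\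
  Z1 *m D' *m X2 = Z1 *m D *m Z2.

Lemma half_hom_step phi psi (u v : 'rV[k]_d2) D D' :
  phi = X1 *m psi -> u *m X2 = v *m Z2 -> half_hom (Z1 *m psi) v D D' ->
  half_hom phi u (psi *m v + D) (psi *m u + D').
Proof.
move=> -> uX [hX hZ]; split.
  by rewrite [in LHS]mulmxDr mulmxDl hX [in RHS]mulmxDr !mulmxDl !mulmxA.
by rewrite !mulmxDr !mulmxDl hZ -!mulmxA uX.
Qed.

(** Follow a chain from [u] in the second module, and dually a chain of
functionals from [phi] in the first; the sum of the rank one maps made of
corresponding members satisfies the equations.  If [phi] kills the lower and
[u] lies in the upper subspace of the same jump, then at the last step either
the vector is in [W2], where [X2] and [Z2] vanish, or the functional is zero, so
that nothing is left over. *)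
Lemma half_chain (W1 : 'M[k]_d1) (W2 : 'M[k]_d2) (s : jump) phi (u : 'rV[k]_d2) :
  W2 *m X2 = 0 -> W2 *m Z2 = 0 ->
  lower X1 Z1 W1 s *m phi = 0 -> (u <= upper X2 Z2 W2 s)%MS ->
  exists D D', half_hom phi u D D' /\
    (s.1 -> (Z1 *m D <= lower X2 Z2 W2 s)%MS).
Proof.
move=> WX WZ; case: s => [[] n]; rewrite /lower /upper /=.
- elim: n => [|n IHn] in phi u *.
    move=> _ /pull_step[v /submxP[c ->] uX].
    exists 0, 0; split; last by rewrite mulmx0 sub0mx.
    rewrite /half_hom !mulmx0 !mul0mx addr0; split=> //.
    by rewrite -mulmxA uX -!mulmxA WZ !mulmx0.
  move=> /pull_dual[psi [phiE psi0]] /pull_step[v vT uX].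
  have [D [D' [hD /(_ isT) ZD]]] := IHn _ _ psi0 vT.
  exists (psi *m v + D), (psi *m u + D'); split=> [|_].
    exact: half_hom_step.
  rewrite mulmxDr addmx_sub //; last first.
    by apply: submx_trans ZD _; apply: iter_pull_inc; exact: ker_sub_pull.
  by rewrite mulmxA mulmx_sub.
- elim: n => [|n IHn] in phi u *.
    move=> /pull_dual[psi [phiE]]; rewrite mul1mx => psi0 _.
    exists 0, (psi *m u); split=> //; rewrite /half_hom !mulmx0 addr0.
    by rewrite !mulmxA -phiE psi0 !mul0mx.
  move=> /pull_dual[psi [phiE psi0]] /pull_step[v vT uX].
  have [D [D' [hD _]]] := IHn _ _ psi0 vT.
  by exists (psi *m v + D), (psi *m u + D'); split=> //; apply: half_hom_step.
Qed.
End HalfChain.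

Section Long.

(** For row vectors [v Z X] is the action of [z] followed by [x].  The jumps [a]
and [j] are those at which [v] and [v Z] enter the filtration, and [phi]
certifies that [v Z] is nonzero modulo the lower subspace of [j] and the image
of the lower subspace of [a]. *)
Definition long_type (a j : jump) d (X Z : 'M[k]_d) (w : 'rV[k]_d) :=
  exists (v : 'rV[k]_d) (phi : 'cV[k]_d),
    [/\ (v <= upper X Z 0 a)%MS, (v *m Z <= upper X Z 0 j)%MS,
        lower X Z 0 j *m phi = 0, lower X Z 0 a *m (Z *m phi) = 0 &
        v *m Z *m phi = 1%:M] /\ w = v *m Z *m X /\ w <> 0.

(** The homomorphism is the sum of the contributions of a chain from [v2 Z] and
a chain from [v2].  Each fails to commute with [Z] by the term
[Z1 phi v2 Z2], with opposite signs. *)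
Lemma long_type_hom a j d1 d2 (X1 Z1 : 'M[k]_d1) (X2 Z2 : 'M[k]_d2) w1 w2 :
  X1 *m X1 = 0 -> Z1 *m Z1 = 0 -> X1 *m Z1 = 0 ->
  X2 *m X2 = 0 -> Z2 *m Z2 = 0 -> X2 *m Z2 = 0 ->
  long_type a j X1 Z1 w1 -> long_type a j X2 Z2 w2 ->
  exists M, [/\ X1 *m M = M *m X2, Z1 *m M = M *m Z2 & w1 *m M = w2].
Proof.
move=> XX1 ZZ1 XZ1 XX2 ZZ2 XZ2.
move=> [v1 [phi [[_ uj phij phia uphi] [w1E w1N]]]].
move=> [v2 [_ [[va2 uj2 _ _ _] [w2E _]]]].
set u2 := v2 *m Z2 in uj2 w2E.
have Xphi : X1 *m phi = 0.
  suff /submxP[c ->] : (X1 <= lower X1 Z1 0 j)%MS by rewrite -mulmxA phij mulmx0.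
  case: j uj phij {uj2} => [[] [|n]]; rewrite /lower /upper /=.
  - case/pull_step=> v /submxP[c ->] uX; case: w1N.
    by rewrite w1E uX mulmx0 mul0mx.
  - by move=> _ _; apply: ker_sub_pull.
  - by move=> _ _; apply: ker_sub_pull.
  - by move=> _ _; apply: ker_sub_pull.
have [D [D' [[hX hZ] _]]] := half_chain (mul0mx _ _) (mul0mx _ _) phij uj2.
have [E [E' [[kX kZ] _]]] := half_chain (mul0mx _ _) (mul0mx _ _) phia va2.
have uZ : u2 *m Z2 = 0 by rewrite /u2 -mulmxA ZZ2 mulmx0.
pose P := phi *m u2 + Z1 *m D; pose P' := Z1 *m phi *m v2 + Z1 *m E.
have XP : X1 *m P = 0 by rewrite /P mulmxDr !mulmxA Xphi XZ1 !mul0mx addr0.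
have XP' : X1 *m P' = 0 by rewrite /P' mulmxDr !mulmxA XZ1 !mul0mx addr0.
have ZP : Z1 *m P = Z1 *m phi *m u2.
  by rewrite /P mulmxDr !mulmxA ZZ1 !mul0mx addr0.
have ZP' : Z1 *m P' = 0 by rewrite /P' mulmxDr !mulmxA ZZ1 !mul0mx addr0.
have PZ : P *m Z2 = Z1 *m D *m Z2 by rewrite /P mulmxDl -mulmxA uZ mulmx0 add0r.
have P'Z : P' *m Z2 = Z1 *m phi *m u2 + Z1 *m E *m Z2.
  by rewrite /P' mulmxDl -[_ *m v2 *m _]mulmxA.
have PXE : P *m X2 = X1 *m D' *m X2 by rewrite hX.
have P'XE : P' *m X2 = X1 *m E' *m X2 by rewrite kX.
clearbody P P'.
pose M := P + D' *m X2 + (P' + E' *m X2).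
have MZ : M *m Z2 = P *m Z2 + P' *m Z2.
  by rewrite /M !mulmxDl -!(mulmxA _ X2) XZ2 !mulmx0 !addr0.
have XM : X1 *m M = M *m X2.
  rewrite /M !mulmxDr !mulmxDl XP XP' !add0r -!(mulmxA _ X2) XX2 !mulmx0 !addr0.
  by rewrite !mulmxA PXE P'XE.
have ZM : Z1 *m M = M *m Z2.
  rewrite MZ PZ P'Z /M !mulmxDr ZP ZP' add0r !mulmxA hZ kZ.
  by rewrite addrCA addrA.
clearbody M; exists M; split=> //.
rewrite w1E -(mulmxA _ X1) XM mulmxA -(mulmxA v1) ZM MZ PZ P'Z.
rewrite -mulmxA !mulmxDl -hZ -kZ -!(mulmxA _ X2) XX2 !mulmx0 add0r addr0.
by rewrite -mulmxA -w2E !mulmxA uphi mul1mx.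
Qed.
End Long.
End Chains.

(** * Indecomposable modules on which [z] followed by [x] is nonzero *)

Lemma separating_functional (k : fieldType) d (S : 'M[k]_d) (u : 'rV[k]_d) :
  ~~ (u <= S)%MS -> exists2 phi : 'cV[k]_d, S *m phi = 0 & u *m phi = 1%:M.
Proof.
rewrite submxE => /rV0Pn[j uKj]; have SK : S *m cokermx S = 0 by rewrite mulmx_coker.
move: (cokermx S) uKj SK => K uKj SK.
exists (((u *m K) 0 j)^-1 *: (K *m delta_mx j 0)); rewrite -scalemxAr.
  by rewrite mulmxA SK mul0mx scaler0.
by rewrite mulmxA -colE [col j _]mx11_scalar scale_scalar_mx [col _ _ _ _]mxE mulVf.
Qed.

Section LongExists.
Variables (k : fieldType) (d : nat) (X Z : 'M[k]_d).
Hypotheses (XX : X *m X = 0) (ZZ : Z *m Z = 0).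
Let T := pull X Z.

(** The increasing filtration [T^i 0], for [i <= d], followed by the decreasing
one, [T^(2d + 1 - i) 1], read backwards.  All steps are jumps except the one
from [filt d] to [filt d.+1], where the relation is bijective. *)
Let filt (i : nat) : 'M[k]_d :=
  if (i <= d)%N then iter i T 0 else iter (d.*2.+1 - i) T 1%:M.
Let jmp (i : nat) : jump := if (i < d)%N then (true, i) else (false, d.*2 - i)%N.

Let lower_jmp i : (i <= d.*2)%N -> i != d -> lower X Z 0 (jmp i) = filt i.
Proof.
move=> id2 id; rewrite /lower /jmp /filt (leq_eqVlt i d) (negPf id) /=.
by case: (ltnP i d) => //= _; rewrite subSn.
Qed.

Let upper_jmp i : (i <= d.*2)%N -> i != d -> upper X Z 0 (jmp i) = filt i.+1.
Proof.
move=> id2 id; rewrite /upper /jmp /filt.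
by case: (ltnP i d) => //= _; rewrite subSS.
Qed.

Let jmp_lt i : (i <= d.*2)%N -> i != d -> ((jmp i).2 < d)%N.
Proof.
move=> id2 id; rewrite /jmp; case: (ltnP i d) => //= di.
have lt_di : (d < i)%N by rewrite ltn_neqAle eq_sym id.
by rewrite ltn_subLR // -addnn ltn_add2r.
Qed.

Let regular := pull_regular_part (iter_stable_up (@pullS k d X Z) (sub0mx _ _))
  (iter_stable_down (@pullS k d X Z) (submx1 _)).

Let filt_inc i : (filt i <= filt i.+1)%MS.
Proof.
rewrite /filt; case: (ltngtP i d) => [id|id|->].
- by rewrite iter_pull_inc // sub0mx.
- case: (ltnP d.*2 i) => id2; last by rewrite subSS subSn // iter_pull_dec.
  by rewrite (eqP (_ : d.*2.+1 - i.+1 == 0)%N) ?submx1 // subn_eq0 ltnS ltnW.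
- rewrite subSS -addnn addnK; elim: (X in iter X) => [|n IHn]; first exact: sub0mx.
  exact: pullS.
Qed.

Let filt_mono i j : (i <= j)%N -> (filt i <= filt j)%MS.
Proof.
by move/subnK <-; elim: (j - i)%N => //= n /submx_trans; apply; rewrite addSn.
Qed.

(** If no pair of jumps is seen by [Z X], then [v Z X = 0] for [v] in the [a]-th and
[v Z] in the [j]-th term of the filtration, by induction on [a] and [j]: at a
pair of jumps one may subtract from [v] a vector of smaller index, and at the
bijective step this is [pull_regular_part]. *)
Lemma long_type_exists : Z *m X != 0 ->
  exists (a j : jump) w, [/\ (a.2 < d)%N, (j.2 < d)%N & long_type a j X Z w].
Proof.
move=> ZX; apply: contrapT => noType.
suff Pr a j (v : 'rV[k]_d) : (a <= d.*2.+1)%N -> (j <= d.*2.+1)%N ->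
    (v <= filt a)%MS -> (v *m Z <= filt j)%MS -> v *m Z *m X = 0.
  move/negP: ZX; apply; apply/eqP/row_matrixP => i; rewrite row0 rowE mulmxA.
  have filt1 : filt d.*2.+1 = 1%:M.
    by rewrite /filt subnn ltnNge -addnn leq_addr.
  by apply: (Pr d.*2.+1 d.*2.+1) => //; rewrite filt1 submx1.
elim: a => [|a IHa] in j v *.
  by move=> _ _ /= /submx0null ->; rewrite !mul0mx.
elim: j => [|j IHj] in v *.
  by move=> _ _ _ /= /submx0null ->; rewrite mul0mx.
move=> ale jle va uj.
(* The bijective step, for [v Z] and then for [v]. *)
have [jd|jd] := eqVneq j d.
  apply: (IHj _ ale (ltnW jle) va).
  have [+ _] := regular; rewrite jd /filt leqnn; apply.
    by move: uj; rewrite /filt jd ltnn -addnn subSS addnK.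
  by rewrite -mulmxA ZZ mulmx0.
have [ad|ad] := eqVneq a d.
  have [_ /(_ v)] := regular; case.
    by move: va; rewrite /filt ad ltnn -addnn subSS addnK.
  move=> b vb /submxP[c bZ].
  have bX : b *m Z *m X = 0 by rewrite bZ -mulmxA XX mulmx0.
  have : (v - b) *m Z *m X = 0.
    apply: (IHa j.+1 _ (ltnW ale) jle); first by rewrite ad /filt leqnn.
    rewrite mulmxBl addmx_sub // eqmx_opp.
    apply: submx_trans (filt_mono (isT : 0 < j.+1)%N).
    rewrite /filt; case: ifP => _; first exact: ker_sub_pull.
    by case: (d.*2.+1 - 1)%N => [|n]; [exact: submx1 | exact: ker_sub_pull].
  by rewrite !mulmxBl bX subr0.
apply: contrapT => uX0; apply: noType.
have [a2 j2] : (a <= d.*2)%N /\ (j <= d.*2)%N by [].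
exists (jmp a), (jmp j), (v *m Z *m X).
rewrite !jmp_lt //; split=> //.
rewrite /long_type !lower_jmp // !upper_jmp //.
exists v.
have : ~~ (v *m Z <= filt j + filt a *m Z)%MS.
  apply/negP => /sub_addsmxP[[p q] /= pq]; apply: uX0.
  have qX : q *m filt a *m Z *m X = 0.
    apply: (IHa j.+1 _ (ltnW ale) jle); first exact: submxMl.
    have -> : q *m filt a *m Z = v *m Z - p *m filt j by rewrite pq addrAC subrr add0r mulmxA.
    by rewrite addmx_sub // eqmx_opp mulmx_sub // filt_inc.
  have : (v - q *m filt a) *m Z *m X = 0.
    apply: (IHj _ ale (ltnW jle)).
      by rewrite addmx_sub // eqmx_opp mulmx_sub // filt_inc.
    by rewrite mulmxBl pq mulmxA addrK submxMl.
  by rewrite !mulmxBl qX subr0.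
case/separating_functional=> phi Sphi uphi; exists phi; split=> //.
have van m (A : 'M_(m, d)) : (A <= filt j + filt a *m Z)%MS -> A *m phi = 0.
  by case/submxP=> c ->; rewrite -mulmxA Sphi mulmx0.
by split=> //; rewrite ?mulmxA; apply: van; [apply: addsmxSl | apply: addsmxSr].
Qed.
End LongExists.

(** * Pencils with a polynomial null vector *)

Section Short.
Variable k : fieldType.

(** The end [u] of a chain of length [n], not contained in the smaller subspace of
shorter chains; chains are counted modulo the images of [X] and [Z], on which
[X] and [Z] vanish. *)
Definition short_type (n : nat) d (X Z : 'M[k]_d) (phi : 'cV[k]_d) :=
  exists u : 'rV[k]_d,
    [/\ u *m Z = 0, (u <= upper X Z (X + Z)%MS (true, n))%MS,
        lower X Z (X + Z)%MS (true, n) *m phi = 0 & u *m phi = 1%:M].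

Lemma sums_mul0 d (X Z Y : 'M[k]_d) :
  X *m Y = 0 -> Z *m Y = 0 -> (X + Z)%MS *m Y = 0.
Proof.
move=> XY ZY; apply/eqP; rewrite -submx0 (eqmxMr _ (addsmxE _ _)) mul_col_mx.
by rewrite XY ZY col_mx0 sub0mx.
Qed.

Lemma sub_lower d (X Z W : 'M[k]_d) n :
  W *m X = 0 -> (W <= lower X Z W (true, n))%MS.
Proof.
move=> WX; rewrite /lower /=; elim: n => //= n IHn; apply: submx_trans IHn _.
by apply: iter_pull_inc; apply: ker_sub_pull.
Qed.

Lemma short_type_hom n d1 d2 (X1 Z1 : 'M[k]_d1) (X2 Z2 : 'M[k]_d2) phi1 phi2 :
  X1 *m X1 = 0 -> Z1 *m Z1 = 0 -> X1 *m Z1 = 0 -> Z1 *m X1 = 0 ->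
  X2 *m X2 = 0 -> Z2 *m Z2 = 0 -> X2 *m Z2 = 0 -> Z2 *m X2 = 0 ->
  short_type n X1 Z1 phi1 -> short_type n X2 Z2 phi2 ->
  exists M, [/\ X1 *m M = M *m X2, Z1 *m M = M *m Z2 & M *m phi2 = phi1].
Proof.
move=> XX1 ZZ1 XZ1 ZX1 XX2 ZZ2 XZ2 ZX2 [u1 [_ _ lo1 _]] [u2 [uZ up2 lo2 uphi2]].
have [D [D' [[hX hZ] /(_ isT) ZD]]] :=
  half_chain (sums_mul0 XX2 ZX2) (sums_mul0 XZ2 ZZ2) lo1 up2.
have kill d (X Z A : 'M[k]_d) (phi : 'cV[k]_d) : X *m X = 0 -> Z *m X = 0 ->
    lower X Z (X + Z)%MS (true, n) *m phi = 0 -> (A <= (X + Z)%MS)%MS -> A *m phi = 0.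
  move=> XX ZX lo /submx_trans/(_ (sub_lower Z n (sums_mul0 XX ZX)))/submxP[c ->].
  by rewrite -mulmxA lo mulmx0.
have Xphi1 := kill _ _ _ _ _ XX1 ZX1 lo1 (addsmxSl X1 Z1).
have Zphi1 := kill _ _ _ _ _ XX1 ZX1 lo1 (addsmxSr X1 Z1).
have Xphi2 := kill _ _ _ _ _ XX2 ZX2 lo2 (addsmxSl X2 Z2).
exists (phi1 *m u2 + Z1 *m D + D' *m X2); split.
- rewrite mulmxDr [RHS]mulmxDl -[D' *m X2 *m X2]mulmxA XX2 mulmx0 addr0 -hX.
  by rewrite mulmxDr !mulmxA Xphi1 XZ1 !mul0mx !add0r.
- rewrite !mulmxDr !mulmxDl -[D' *m X2 *m Z2]mulmxA XZ2 mulmx0 addr0.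
  by rewrite !mulmxA Zphi1 ZZ1 !mul0mx !add0r hZ -(mulmxA phi1) uZ mulmx0 add0r.
- rewrite !mulmxDl -!(mulmxA phi1) uphi2 mulmx1 -(mulmxA D') Xphi2 mulmx0 addr0.
  by case/submxP: ZD => c ->; rewrite -mulmxA lo2 mulmx0 addr0.
Qed.

(** The end of the chain lies in some term of the filtration, and in the first
such term it defines a jump; the filtration is stable after [d] terms. *)
Lemma short_type_of_chain d (X Z : 'M[k]_d) (w : nat -> 'rV[k]_d) N :
  X *m X = 0 -> Z *m X = 0 ->
  w 0 *m X = 0 -> (forall i, w i.+1 *m X = - (w i *m Z)) -> w N *m Z = 0 ->
  ~~ (w N <= X + Z)%MS -> exists n phi, (n < d)%N /\ short_type n X Z phi.
Proof.
move=> XX ZX w0 wS wN wNS; set W := (X + Z)%MS in wNS.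
have wT i : (w i <= iter i.+1 (pull X Z) W)%MS.
  elim: i => [|i IHi]; first exact: ker_sub_pull.
  by rewrite iterS sub_pull wS eqmx_opp; apply: submxMr.
have exn : exists n, (w N <= iter n (pull X Z) W)%MS by exists N.+1.
case: (ex_minnP exn) => -[|n] wn min; first by rewrite wn in wNS.
have {}min : ~~ (w N <= iter n (pull X Z) W)%MS.
  by apply/negP => /min; rewrite ltnn.
have [phi lo uphi] := separating_functional min.
exists n, phi; split; last by exists (w N).
rewrite ltnNge; apply/negP => dn; move/negP: min; apply; apply: submx_trans wn _.
have W0 : (W <= pull X Z W)%MS by apply: ker_sub_pull; exact: sums_mul0.
rewrite -(subnK dn) -addnS !iterD; elim: (n - d)%N => [|m IHm]; last exact: pullS.
by apply: iter_stable_up => // A B; apply: pullS.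
Qed.

(** The coefficients of a polynomial null vector of [A + T B] form a chain. *)
Lemma poly_chain p q (A B : 'M[k]_(p, q)) (v : 'rV[{poly k}]_p) :
  v != 0 -> v *m (map_mx polyC A + 'X *: map_mx polyC B) = 0 ->
  exists (a : nat -> 'rV[k]_p) N,
    [/\ a 0 *m A = 0, (forall i, a i.+1 *m A = - (a i *m B)), a N *m B = 0 & a N != 0].
Proof.
move=> v0 vM; pose a i : 'rV[k]_p := map_mx (coefp i) v.
have aS j : (v *m (map_mx polyC A + 'X *: map_mx polyC B)) 0 j =
   (v *m map_mx polyC A) 0 j + 'X * (v *m map_mx polyC B) 0 j.
  by rewrite mulmxDr -scalemxAr !mxE.
have coefM (D : 'M[k]_(p, q)) i j : ((v *m map_mx polyC D) 0 j)`_i = (a i *m D) 0 j.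
  rewrite !mxE coef_sum; apply: eq_bigr => l _; by rewrite !mxE coefMC.
have a0 : a 0 *m A = 0.
  apply/rowP => j; have := congr1 (fun M : 'rV[{poly k}]_q => (M 0 j)`_0) vM.
  by rewrite /= aS coefD coefXM coefM addr0 !mxE coef0.
have aSS i : a i.+1 *m A = - (a i *m B).
  apply/rowP => j; have := congr1 (fun M : 'rV[{poly k}]_q => (M 0 j)`_i.+1) vM.
  rewrite /= aS coefD coefXM !coefM /= [in X in _ = X -> _]mxE coef0.
  by move/eqP; rewrite addr_eq0 => /eqP ->; rewrite [in RHS]mxE.
pose s := \max_(j < p) size (v 0%R j).
have aN i : (s <= i)%N -> a i = 0.
  move=> si; apply/rowP => j; rewrite !mxE /= nth_default // (leq_trans _ si) //.
  by rewrite (leq_bigmax j).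
have [j vj] : exists j, v 0 j != 0 by apply/rV0Pn.
have p0 : (0 < #|'I_p|)%N by rewrite card_ord (leq_ltn_trans _ (ltn_ord j)).
have [j' sE] := eq_bigmax (fun j => size (v 0 j)) p0.
have s0 : (0 < s)%N.
  by apply: leq_trans (leq_bigmax j); rewrite size_poly_gt0.
exists a, s.-1; split=> //.
  by rewrite -[LHS]opprK -aSS prednK // aN // mul0mx oppr0.
apply/rV0Pn; exists j'; rewrite mxE /= -/(lead_coef _) /s sE -/(lead_coef _).
by rewrite lead_coef_eq0 -size_poly_gt0 -sE.
Qed.

(** Completing a matrix with more rows than columns by zero columns gives a square
matrix of determinant zero. *)
Lemma left_null_vector (R : idomainType) p q (M : 'M[R]_(p, q)) :
  (q < p)%N -> exists2 v : 'rV[R]_p, v != 0 & v *m M = 0.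
Proof.
move=> qp; pose A := \matrix_(i < p, j < p) oapp (M i) 0 (insub (j : nat)).
have : \det A == 0.
  rewrite -det_tr; apply/det0P; exists (delta_mx 0 (Ordinal qp)).
    apply/rV0Pn; exists (Ordinal qp); by rewrite mxE !eqxx oner_eq0.
  by rewrite -rowE; apply/rowP => i; rewrite !mxE /= insubF ?ltnn.
case/det0P => v v0 vA; exists v => //; apply/rowP => j.
have jp := ltn_trans (ltn_ord j) qp.
have := congr1 (fun u : 'rV_p => u 0 (Ordinal jp)) vA; rewrite !mxE => {2}<-.
apply: eq_bigr => i _; rewrite !mxE /= (insubT (fun n => n < q)%N (ltn_ord j)) /=.
by congr (_ * M _ _); apply: val_inj.
Qed.

(** [C] is a complement of the row space [R] of [X] and [Z], and [H] the projection
onto it, so that the module is the pencil [A + T B] from [C] to [R]. *)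
Lemma short_type_of_null_vector d p q (X Z : 'M[k]_d) (A B : 'M[k]_(p, q))
    (C : 'M[k]_(p, d)) (R : 'M[k]_(q, d)) (H : 'M[k]_(d, p)) (v : 'rV[{poly k}]_p) :
  C *m H = 1%:M -> R *m H = 0 -> X = H *m A *m R -> Z = H *m B *m R ->
  v != 0 -> v *m (map_mx polyC A + 'X *: map_mx polyC B) = 0 ->
  exists n phi, (n < d)%N /\ short_type n X Z phi.
Proof.
move=> CH RH XE ZE v0 vM; have [a [N [a0 aS aN aN0]]] := poly_chain v0 vM.
have CX (c : 'rV_p) : c *m C *m X = c *m A *m R.
  by rewrite XE !mulmxA -(mulmxA c) CH mulmx1.
have CZ (c : 'rV_p) : c *m C *m Z = c *m B *m R.
  by rewrite ZE !mulmxA -(mulmxA c) CH mulmx1.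
apply: (@short_type_of_chain _ _ _ (fun i => a i *m C) N).
- by rewrite XE !mulmxA -(mulmxA _ R) RH mulmx0 !mul0mx.
- by rewrite XE ZE !mulmxA -(mulmxA _ R) RH mulmx0 !mul0mx.
- by rewrite CX a0 mul0mx.
- by move=> i; rewrite CX CZ aS mulNmx.
- by rewrite CZ aN mul0mx.
- apply: contra aN0 => aNC; have : (a N *m C <= R)%MS.
    by apply: submx_trans aNC _; rewrite XE ZE addsmx_sub !submxMl.
  case/submxP => b bE; rewrite -[a N]mulmx1 -CH mulmxA bE -mulmxA RH.
  by rewrite mulmx0.
Qed.

End Short.

(** * Kronecker's trichotomy *)

(** A pencil from [k^p] to [k^p] as a square-zero endomorphism of [k^p + k^p]. *)
Definition nil_block (R : nmodType) p (f : 'M[R]_p) : 'M[R]_(p + p) := block_mx 0 f 0 0.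

Section Regular.
Variable k : fieldType.

Lemma natr_inj : [pchar k] =i pred0 -> injective (fun n : nat => n%:R : k).
Proof.
move=> /pcharf0P char0 m n.
wlog le_mn : m n / (m <= n)%N => [sym|].
  by case: (leqP m n) => [|/ltnW] /sym // + /esym e => /(_ e) ->.
move/eqP; rewrite eq_sym -subr_eq0 -natrB // char0 subn_eq0 => le_nm.
by apply/eqP; rewrite eqn_leq le_mn.
Qed.

Lemma size_det_linear p (A B : 'M[k]_p) :
  (size (\det (map_mx polyC A + 'X *: map_mx polyC B)) <= p.+1)%N.
Proof.
rewrite /determinant; apply: (leq_trans (size_sum _ _ _)); apply/bigmax_leqP => s _.
have sizeN (b : bool) (q : {poly k}) : size (if b then - q else q) = size q.
  by case: b; rewrite ?size_polyN.
rewrite mulr_sign sizeN.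
apply: leq_trans (size_prod_leq _ _) _; rewrite /= card_ord.
apply: (@leq_trans ((\sum_(i < p) 2).+1 - p)); last first.
  by rewrite sum_nat_const card_ord muln2 -addnn -addSn addnK.
apply: leq_sub2r; rewrite ltnS; apply: leq_sum => i _; rewrite !mxE.
apply: leq_trans (size_polyD _ _) _; rewrite geq_max; apply/andP; split.
  by apply: leq_trans (size_polyC_leq1 _) _.
by rewrite mulrC; apply: leq_trans (size_polyMleq _ _) _; rewrite size_polyX addn2 /= ltnS size_polyC_leq1.
Qed.

(** The determinant has degree at most [p], and the integers [0, ..., p] are distinct
in characteristic zero, so not all of them are roots. *)
Lemma pencil_unit_at p (A B : 'M[k]_p) : [pchar k] =i pred0 ->
  \det (map_mx polyC A + 'X *: map_mx polyC B) != 0 ->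
  exists2 c : nat, (c <= p)%N & A + c%:R *: B \in unitmx.
Proof.
move=> char0 det0; set D := \det _ in det0.
have Dc (c : k) : D.[c] = \det (A + c *: B).
  rewrite /D -horner_evalE -det_map_mx; congr (\det _); apply/matrixP => i j.
  by rewrite !mxE /= /horner_eval hornerD hornerM hornerX !hornerC.
pose rs : seq k := [seq i%:R | i <- iota 0 p.+1].
have rsU : uniq rs.
  rewrite map_inj_uniq ?iota_uniq //; apply: (natr_inj char0).
have [rs0|] := boolP (all (root D) rs).
  have := leq_trans (max_poly_roots det0 rs0 rsU) (size_det_linear A B).
  by rewrite size_map size_iota ltnn.
case/allPn=> r /mapP[c]; rewrite mem_iota add0n ltnS /= => cp {r}-> cD.
by exists c => //; rewrite unitmxE unitfE -Dc; apply: contra cD.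
Qed.

Definition conjugate d d' (X Z : 'M[k]_d) (X' Z' : 'M[k]_d') :=
  exists (G : 'M[k]_(d', d)) (H : 'M[k]_(d, d')),
    [/\ G *m H = 1%:M, H *m G = 1%:M, G *m X = X' *m G & G *m Z = Z' *m G].

(** The rows of [X] and [Z] span a subspace [S] on which both vanish, so the module
is a pencil from a complement of [S] to [S].  It has a polynomial null vector on
the left or on the right, which happens in particular if it is not square, or
its determinant is a nonzero polynomial.  In the last case the basis of [S] is
changed by the value of the pencil at an integer where it is invertible. *)
Lemma pencil_trichotomy d (X Z : 'M[k]_d) : [pchar k] =i pred0 ->
  X *m X = 0 -> Z *m Z = 0 -> X *m Z = 0 -> Z *m X = 0 ->
  [\/ exists n phi, (n < d)%N /\ short_type n X Z phi,
      exists n phi, (n < d)%N /\ short_type n X^T Z^T phi |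
      exists (c p : nat) (f : 'M[k]_p), [/\ (c <= p)%N, (p + p)%N = d &
        conjugate X Z (nil_block (1%:M - c%:R *: f)) (nil_block f)]].
Proof.
move=> char0 XX ZZ XZ ZX; pose S := (X + Z)%MS.
pose C := row_base S^C%MS; pose R := row_base S; pose G := col_mx C R.
have pq : (\rank S^C + \rank S)%N = d by rewrite mxrank_compl subnK ?rank_leq_col.
have Gfull : row_full G.
  rewrite -sub1mx; have := addsmx_compl_full S; rewrite -sub1mx => /submx_trans; apply.
  rewrite addsmx_sub /G -!addsmxE; apply/andP; split.
    by apply: submx_trans (addsmxSr _ _); rewrite eq_row_base.
  by apply: submx_trans (addsmxSl _ _); rewrite eq_row_base.
have Gfree : row_free G by move: Gfull; rewrite /row_free /row_full => /eqP ->; rewrite eq_sym pq.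
have [H [GH HG]] : exists H, G *m H = 1%:M /\ H *m G = 1%:M.
  by exists (pinvmx G); rewrite mulmxVp // mulVpmx.
have Sk (Y : 'M[k]_d) : X *m Y = 0 -> Z *m Y = 0 -> R *m Y = 0.
  move=> XY ZY; have /submxP[c ->] : (R <= S)%MS by rewrite eq_row_base.
  by rewrite -mulmxA sums_mul0 ?mulmx0.
have [A CX] : exists A, C *m X = A *m R.
  by apply/submxP; rewrite eq_row_base mulmx_sub // addsmxSl.
have [B CZ] : exists B, C *m Z = B *m R.
  by apply/submxP; rewrite eq_row_base mulmx_sub // addsmxSr.
have RX : R *m X = 0 by apply: Sk.
have RZ : R *m Z = 0 by apply: Sk.
move: A B CX CZ RX RZ H GH HG Gfull Gfree; rewrite /G.
clear G Sk; move: C R; move: pq; move: (\rank S^C) (\rank S) => p q.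
move=> pq C R A B CX CZ RX RZ H; rewrite -[H]hsubmxK.
move: (lsubmx H) (rsubmx H) => {H} H1 H2 GH HG _ _.
have [CH1 CH2 RH1 RH2] : [/\ C *m H1 = 1%:M, C *m H2 = 0, R *m H1 = 0 & R *m H2 = 1%:M].
  move: GH; rewrite mul_col_row scalar_mx_block => /eq_block_mx[-> -> -> ->].
  by [].
rewrite mul_row_col in HG.
have XE : X = H1 *m A *m R.
  by rewrite -[LHS]mul1mx -HG mulmxDl -!mulmxA RX CX mulmx0 addr0.
have ZE : Z = H1 *m B *m R.
  by rewrite -[LHS]mul1mx -HG mulmxDl -!mulmxA RZ CZ mulmx0 addr0.
pose M := map_mx polyC A + 'X *: map_mx polyC B.
have left_null (v : 'rV[{poly k}]_p) : v != 0 -> v *m M = 0 ->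
    exists n phi, (n < d)%N /\ short_type n X Z phi.
  exact: short_type_of_null_vector CH1 RH1 XE ZE.
have right_null (v : 'rV[{poly k}]_q) : v != 0 -> v *m M^T = 0 ->
    exists n phi, (n < d)%N /\ short_type n X^T Z^T phi.
  rewrite /M linearD linearZ /= !map_trmx.
  apply: (@short_type_of_null_vector _ _ _ _ _ _ _ _ H2^T H1^T R^T).
  - by rewrite -trmx_mul RH2 trmx1.
  - by rewrite -trmx_mul RH1 trmx0.
  - by rewrite XE !trmx_mul mulmxA.
  - by rewrite ZE !trmx_mul mulmxA.
case: (ltngtP q p) => [qp|pq'|e].
- by have [v v0 vM] := left_null_vector M qp; constructor 1; apply: left_null vM.
- by have [v v0 vM] := left_null_vector M^T pq'; constructor 2; apply: right_null vM.
subst q; have [det0|] := eqVneq (\det M) 0.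
  by case/eqP/det0P: det0 => v v0 vM; constructor 1; apply: left_null vM.
case/(pencil_unit_at char0) => c cp; set Y := A + _ => Yu.
constructor 3; exists c, p, (B *m invmx Y); split=> //.
have AE : 1%:M - c%:R *: (B *m invmx Y) = A *m invmx Y.
  by rewrite -(mulmxV Yu) {1}/Y mulmxDl scalemxAl addrK.
exists (col_mx C (Y *m R)), (row_mx H1 (H2 *m invmx Y)); split.
- rewrite mul_col_row -!mulmxA (mulmxA R) RH1 RH2 (mulmxA C) CH1 CH2.
  by rewrite mulmx0 mul0mx mul1mx mulmxV // -scalar_mx_block.
- by rewrite mul_row_col -!mulmxA (mulmxA _ Y) mulVmx // mul1mx.
- rewrite AE mul_col_mx mul_block_col !mul0mx addr0 add0r CX -!mulmxA.
  by rewrite RX mulmx0 (mulmxA _ Y) mulVmx // mul1mx.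
- rewrite mul_col_mx mul_block_col !mul0mx addr0 add0r CZ -!mulmxA.
  by rewrite RZ mulmx0 (mulmxA _ Y) mulVmx // mul1mx.
Qed.
End Regular.

(** * Nilpotency indices and discrete classes *)

(** The decreasing images of the powers are stable after [d] steps. *)
Lemma nilpotent_exp (k : fieldType) d (N : 'M[k]_d) m : N ^+ m = 0 -> N ^+ d = 0.
Proof.
move=> Nm; pose f (A : 'M[k]_d) := A *m N.
have fE n : iter n f 1%:M = N ^+ n.
  by elim: n => //= n ->; rewrite exprSr.
have st : (N ^+ d <= N ^+ d.+1)%MS.
  rewrite -!fE; apply: iter_stable_down; last exact: submx1.
  by move=> A B AB; apply: submxMr.
have stn n : (N ^+ d <= N ^+ (d + n))%MS.
  elim: n => [|n IHn]; first by rewrite addn0.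
  apply: submx_trans st _; rewrite addnS !exprSr; exact: submxMr.
by apply/eqP; rewrite -submx0 -(mulmx0 _ (N ^+ d)) -Nm; have := stn m; rewrite exprD.
Qed.

Section Classes.
Variables (k : fieldType) (A : algType k).

(** Classically, a property that determines an indecomposable module up to
isomorphism is represented by at most one module. *)
Lemma finitely_many_classes d (I : finType) (P : I -> rep A d -> Prop) :
  (forall i (U V : rep A d), indecomposable U -> indecomposable V ->
     P i U -> P i V -> rep_iso U V) ->
  exists (q : nat) (E : 'I_q -> rep A d), forall U : rep A d,
    indecomposable U -> (exists i, P i U) -> exists j, rep_iso U (E j).
Proof.
move=> P_iso; have [[U0 _]|none] := pselect (exists U : rep A d, indecomposable U); last first.
  by exists 0, (fun i : 'I_0 => False_rect _ (notF (ltn_ord i))) => U /(ex_intro _ U)/none.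
have choose i : exists V : rep A d, forall U, indecomposable U -> P i U -> rep_iso U V.
  have [[V [Vind PV]]|no] := pselect (exists V, indecomposable V /\ P i V).
    by exists V => U Uind PU; apply: P_iso PU PV.
  by exists U0 => U Uind PU; case: no; exists U.
have {choose} [E EP] := choice choose.
exists #|I|, (fun j => E (enum_val j)) => U Uind [i PU].
by exists (enum_rank i); rewrite enum_rankK; apply: EP.
Qed.
End Classes.

(** * Modules over an algebra with two generators *)

(** Generation as an induction principle for predicates closed under linear
combinations and products. *)
Definition generates (k : pzRingType) (A : algType k) (x z : A) :=
  forall P : A -> Prop, P 1 -> P x -> P z ->
    (forall c a b, P a -> P b -> P (c *: a + b)) ->
    (forall a b, P a -> P b -> P (a * b)) -> forall a, P a.

Lemma conjugate_sym (k : fieldType) d e (X Z : 'M[k]_d) (X' Z' : 'M[k]_e) :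
  conjugate X Z X' Z' -> conjugate X' Z' X Z.
Proof.
move=> [G [H [GH HG GX GZ]]]; exists H, G; split=> //.
- by rewrite -[X']mulmx1 -GH (mulmxA X') -GX !mulmxA HG mul1mx.
- by rewrite -[Z']mulmx1 -GH (mulmxA Z') -GZ !mulmxA HG mul1mx.
Qed.

Lemma conjugate_trans (k : fieldType) d e f (X Z : 'M[k]_d) (X' Z' : 'M[k]_e)
    (X2 Z2 : 'M[k]_f) :
  conjugate X Z X' Z' -> conjugate X' Z' X2 Z2 -> conjugate X Z X2 Z2.
Proof.
move=> [G [H [GH HG GX GZ]]] [G' [H' [GH' HG' GX' GZ']]].
exists (G' *m G), (H *m H'); split.
- by rewrite mulmxA -(mulmxA G') GH mulmx1.
- by rewrite mulmxA -(mulmxA H) HG' mulmx1.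
- by rewrite -mulmxA GX !mulmxA GX'.
- by rewrite -mulmxA GZ !mulmxA GZ'.
Qed.

Lemma trmx_neq0 (k : fieldType) m n (w : 'M[k]_(m, n)) : w != 0 -> w^T != 0.
Proof. by apply: contra => /eqP/(congr1 trmx); rewrite trmxK trmx0 => ->. Qed.

Section TwoGenerators.
Variables (k : fieldType) (A : algType k) (x z : A).
Hypothesis Agen : generates x z.

Lemma hom_of_generators d e (U : rep A d) (V : rep A e) (f : 'M[k]_(e, d)) :
  f *m U x = V x *m f -> f *m U z = V z *m f -> forall a, f *m U a = V a *m f.
Proof.
move=> fx fz; apply: Agen => // [|c a b fa fb|a b fa fb].
- by rewrite !rmorph1 mulmx1 mul1mx.
- by rewrite !rep_linear mulmxDr mulmxDl -scalemxAr -scalemxAl fa fb.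
- by rewrite !rmorphM mulmxA fa -[LHS]mulmxA fb mulmxA.
Qed.

Definition trx d (U : rep A d) : 'M[k]_d := (U x)^T.
Definition trz d (U : rep A d) : 'M[k]_d := (U z)^T.

(** Transposing makes [A] act on the right of row vectors, so that subspaces
are row spaces. *)
Lemma hom_of_transposed d e (U : rep A d) (V : rep A e) (M : 'M[k]_(d, e)) :
  trx U *m M = M *m trx V -> trz U *m M = M *m trz V ->
  forall a, M^T *m U a = V a *m M^T.
Proof.
rewrite /trx /trz => Mx Mz.
by apply: hom_of_generators; apply: trmx_inj; rewrite !trmx_mul !trmxK.
Qed.

Lemma rep_iso_of_conjugate d e (U : rep A d) (V : rep A e) :
  conjugate (trx U) (trz U) (trx V) (trz V) -> rep_iso U V.
Proof.
case/conjugate_sym => G [H [GH HG GX GZ]]; exists G^T, H^T; split.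
- by rewrite -trmx_mul HG trmx1.
- by rewrite -trmx_mul GH trmx1.
- by move/esym: GX => GX; move/esym: GZ => GZ; apply: hom_of_transposed.
Qed.

Lemma local_endo d (U : rep A d) (M : 'M[k]_d) : indecomposable U ->
  trx U *m M = M *m trx U -> trz U *m M = M *m trz U ->
  M \in unitmx \/ exists n, M ^+ n = 0.
Proof.
move=> Uind Mx Mz.
case: (indecomposable_endo Uind (hom_of_transposed Mx Mz)) => [|[n Mn]].
  by rewrite unitmx_tr; left.
right; exists n; apply: trmx_inj; rewrite trmx0 -Mn.
elim: n {Mn} => [|n IHn]; rewrite ?trmx1 // exprS exprSr.
by rewrite -[in LHS]/(_ *m _) trmx_mul IHn.
Qed.

Hypotheses (xx : x * x = 0) (zz : z * z = 0) (zx : z * x = 0).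

Section Relations.
Variables (d : nat) (U : rep A d).

Lemma trxx : trx U *m trx U = 0.
Proof. by rewrite -trmx_mul -[_ *m _]/(U x * U x) -rmorphM xx rmorph0 trmx0. Qed.
Lemma trzz : trz U *m trz U = 0.
Proof. by rewrite -trmx_mul -[_ *m _]/(U z * U z) -rmorphM zz rmorph0 trmx0. Qed.
Lemma trxz : trx U *m trz U = 0.
Proof. by rewrite -trmx_mul -[_ *m _]/(U z * U x) -rmorphM zx rmorph0 trmx0. Qed.
End Relations.

(** The composite of the homomorphisms of [long_type_hom] in both directions fixes
the nonzero vector [w]; the two lemmas on short types work in the same way with
the functional [phi]. *)
Lemma long_iso a j d e (U : rep A d) (V : rep A e) w w' :
  indecomposable U -> indecomposable V ->
  long_type a j (trx U) (trz U) w -> long_type a j (trx V) (trz V) w' ->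
  rep_iso U V.
Proof.
move=> Uind Vind Uw Vw.
have [M [Mx Mz wM]] := long_type_hom (trxx U) (trzz U) (trxz U) (trxx V) (trzz V) (trxz V) Uw Vw.
have [N [Nx Nz wN]] := long_type_hom (trxx V) (trzz V) (trxz V) (trxx U) (trzz U) (trxz U) Vw Uw.
apply: (rep_iso_of_homs Uind Vind (hom_of_transposed Mx Mz) (hom_of_transposed Nx Nz)) => n.
apply: (@fixed_col_not_nilpotent _ _ _ w^T).
  by case: Uw => [v [phi [_ [_ /eqP w0]]]]; apply: trmx_neq0.
by rewrite -!trmx_mul mulmxA wM wN.
Qed.

Lemma short_type_neq0 n d (X Z : 'M[k]_d) phi : short_type n X Z phi -> phi != 0.
Proof.
case=> u [_ _ _ uphi]; apply/eqP => phi0; move: uphi; rewrite phi0 mulmx0.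
by move/matrixP/(_ 0 0); rewrite !mxE => /esym/eqP; rewrite oner_eq0.
Qed.

Lemma short_iso n d e (U : rep A d) (V : rep A e) phi phi' :
  indecomposable U -> indecomposable V ->
  trz U *m trx U = 0 -> trz V *m trx V = 0 ->
  short_type n (trx U) (trz U) phi -> short_type n (trx V) (trz V) phi' ->
  rep_iso U V.
Proof.
move=> Uind Vind UZX VZX Uphi Vphi.
have [M [Mx Mz Mphi]] :=
  short_type_hom (trxx U) (trzz U) (trxz U) UZX (trxx V) (trzz V) (trxz V) VZX Uphi Vphi.
have [N [Nx Nz Nphi]] :=
  short_type_hom (trxx V) (trzz V) (trxz V) VZX (trxx U) (trzz U) (trxz U) UZX Vphi Uphi.
apply: (rep_iso_of_homs Uind Vind (hom_of_transposed Mx Mz) (hom_of_transposed Nx Nz)) => n'.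
apply: (@fixed_row_not_nilpotent _ _ _ phi^T).
  exact: trmx_neq0 (short_type_neq0 Uphi).
by rewrite mulmxA -!trmx_mul Nphi Mphi.
Qed.

Lemma short_dual_iso n d e (U : rep A d) (V : rep A e) phi phi' :
  indecomposable U -> indecomposable V ->
  trz U *m trx U = 0 -> trz V *m trx V = 0 ->
  short_type n (trx U)^T (trz U)^T phi -> short_type n (trx V)^T (trz V)^T phi' ->
  rep_iso U V.
Proof.
move=> Uind Vind UZX VZX Uphi Vphi.
have tr0 d' (B C : 'M[k]_d') : B *m C = 0 -> C^T *m B^T = 0.
  by move=> BC; rewrite -trmx_mul BC trmx0.
have T d' (W : rep A d') := conj (tr0 _ _ _ (trxx W)) (conj (tr0 _ _ _ (trzz W)) (tr0 _ _ _ (trxz W))).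
have [UXX [UZZ UXZ]] := T _ U; have [VXX [VZZ VXZ]] := T _ V.
have [M [Mx Mz Mphi]] := short_type_hom UXX UZZ (tr0 _ _ _ UZX) UXZ VXX VZZ (tr0 _ _ _ VZX) VXZ Uphi Vphi.
have [N [Nx Nz Nphi]] := short_type_hom VXX VZZ (tr0 _ _ _ VZX) VXZ UXX UZZ (tr0 _ _ _ UZX) UXZ Vphi Uphi.
rewrite !trmxK in Mx Mz Nx Nz.
apply: (rep_iso_of_homs Uind Vind (hom_of_generators (esym Nx) (esym Nz))
         (hom_of_generators (esym Mx) (esym Mz))) => n'.
apply: (fixed_col_not_nilpotent _ (short_type_neq0 Uphi)).
by rewrite -mulmxA Nphi Mphi.
Qed.
End TwoGenerators.

(** * Regular pencils *)

Section Regular.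
Variables (k : closedFieldType).

(** A nilpotent matrix whose centraliser is local is a single Jordan block, here
of size [n + 1]. *)
Definition local_nilpotent n p (N : 'M[k]_p) :=
  [/\ N ^+ n != 0, N ^+ n.+1 = 0 &
      forall g, g *m N = N *m g -> g \in unitmx \/ exists m, g ^+ m = 0].

Lemma mx_neq0_functionals m n (M : 'M[k]_(m, n)) : M != 0 ->
  exists (u : 'rV[k]_m) (phi : 'cV[k]_n), u *m M *m phi = 1%:M.
Proof.
move=> M0; have [[i j] /= Mij|allM0] := pickP (fun ij => M ij.1 ij.2 != 0); last first.
  case/eqP: M0; apply/matrixP => i j; rewrite mxE; apply/eqP.
  by have /negbFE := allM0 (i, j).
exists (delta_mx 0 i), ((M i j)^-1 *: delta_mx j 0).
by rewrite -scalemxAr -rowE -colE [col j _]mx11_scalar scale_scalar_mx !mxE mulVf.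
Qed.

(** The telescoping sum that intertwines two nilpotent matrices of the same
index: moving a factor [N] from the left to the right shifts the summands, and
the first and last ones vanish. *)
Definition shift_hom n p q (N : 'M[k]_p) (N' : 'M[k]_q) phi u : 'M[k]_(p, q) :=
  \sum_(i < n.+1) N ^+ i *m (phi : 'cV_p) *m ((u : 'rV_q) *m N' ^+ (n - i)).

Lemma shift_hom_comm n p q (N : 'M[k]_p) (N' : 'M[k]_q) phi u :
  N ^+ n.+1 = 0 -> N' ^+ n.+1 = 0 ->
  N *m shift_hom n N N' phi u = shift_hom n N N' phi u *m N'.
Proof.
move=> Nn N'n; rewrite /shift_hom mulmx_sumr mulmx_suml.
rewrite big_ord_recr [RHS]big_ord_recl /= subn0 subnn.
rewrite !mulmxA -[N *m _ ^+ n]exprS Nn !mul0mx addr0.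
rewrite expr0 mul1mx -(mulmxA phi) -!mulmxA -[_ *m N']exprSr N'n !mulmx0 add0r.
apply: eq_bigr => i _; rewrite !mulmxA -[N *m _]exprS -!mulmxA.
by rewrite -[_ ^+ (n - _) *m N']exprSr /bump add1n subnSK.
Qed.

Lemma shift_hom_top n p q (N : 'M[k]_p) (N' : 'M[k]_q) phi u v :
  N ^+ n.+1 = 0 -> v *m N ^+ n *m phi = 1%:M ->
  v *m N ^+ n *m shift_hom n N N' phi u = u *m N' ^+ n.
Proof.
move=> Nn vphi; rewrite mulmx_sumr big_ord_recl big1 => [|i _].
  by rewrite addr0 subn0 expr0 mul1mx !mulmxA vphi mul1mx.
rewrite !mulmxA -(mulmxA v) -[_ *m N ^+ _]exprD lift0 addnS -addSn exprD Nn.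
by rewrite mul0r mulmx0 !mul0mx.
Qed.

(** Choosing [phi] dual to a vector that survives [N^n] makes the composite of the
two intertwiners fix a nonzero vector, so both are invertible. *)
Lemma local_nilpotent_conj n p q (N : 'M[k]_p) (N' : 'M[k]_q) :
  local_nilpotent n N -> local_nilpotent n N' ->
  exists (G : 'M[k]_(p, q)) (H : 'M[k]_(q, p)),
    [/\ G *m H = 1%:M, H *m G = 1%:M & N *m G = G *m N'].
Proof.
move=> [N0 Nn Nloc] [N'0 N'n N'loc].
have [u [phi uphi]] := mx_neq0_functionals N0.
have [u' [phi' uphi']] := mx_neq0_functionals N'0.
have MN := shift_hom_comm phi u' Nn N'n; have MN' := shift_hom_comm phi' u N'n Nn.
have top := shift_hom_top N' u' Nn uphi.
have top' := shift_hom_top N u N'n uphi'.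
move: (shift_hom _ _ _ _ _) MN top => G GN top.
move: (shift_hom _ _ _ _ _) MN' top' => H HN top'.
have HG_nil m : (H *m G) ^+ m != 0.
  apply: (@fixed_row_not_nilpotent _ _ _ (u' *m N' ^+ n)); last by rewrite mulmxA top' top.
  apply/eqP => uN; move: uphi'; rewrite uN mul0mx => /matrixP/(_ 0 0).
  by rewrite !mxE => /esym/eqP; rewrite oner_eq0.
have [||G' [GG' G'G]] := invertible_of_composites HG_nil.
- by apply: N'loc; rewrite -mulmxA -GN mulmxA -HN mulmxA.
- by apply: Nloc; rewrite -mulmxA -HN mulmxA -GN mulmxA.
by exists G, G'; split.
Qed.

Lemma expr_block_diag p q (f : 'M[k]_p) (g : 'M[k]_q) m :
  (block_mx f 0 0 g) ^+ m = block_mx (f ^+ m) 0 0 (g ^+ m).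
Proof.
elim: m => [|m IHm]; first by rewrite !expr0 -scalar_mx_block.
rewrite !exprS IHm -[LHS]/(_ *m _) mulmx_block.
by rewrite !mulmx0 !mul0mx !addr0 !add0r.
Qed.

(** A matrix that commutes with [f] acts on both halves of the pencil as an
endomorphism of the module, so the centraliser of [f] is local; in particular
[f - lambda] is nilpotent for any eigenvalue [lambda]. *)
Lemma regular_local (A : algType k) (x z : A) d (U : rep A d) p (f : 'M[k]_p) c :
  generates x z -> indecomposable U ->
  conjugate (trx x U) (trz z U) (nil_block (1%:M - c *: f)) (nil_block f) ->
  (0 < p)%N ->
  exists (lambda : k) (n : nat), (n < p)%N /\ local_nilpotent n (f - lambda%:M).
Proof.
move=> Agen Uind [G [H [GH HG GX GZ]]] p0.
have fcomm (g : 'M_p) : g *m f = f *m g -> g \in unitmx \/ exists m, g ^+ m = 0.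
  move=> gf; pose D := block_mx g 0 0 g.
  have Dblock (h : 'M_p) : g *m h = h *m g -> D *m nil_block h = nil_block h *m D.
    move=> gh; rewrite /D /nil_block !mulmx_block.
    by rewrite !mulmx0 !mul0mx !addr0 !add0r gh.
  have DX : D *m nil_block (1%:M - c *: f) = nil_block (1%:M - c *: f) *m D.
    apply: Dblock; rewrite mulmxBr mulmxBl mulmx1 mul1mx -scalemxAr -scalemxAl.
    by rewrite gf.
  have HX B B' : G *m B = B' *m G -> D *m B' = B' *m D ->
      B *m (H *m D *m G) = (H *m D *m G) *m B.
    move=> GB DB; have BH : B *m H = H *m B'.
      by rewrite -[B]mul1mx -HG -(mulmxA H) GB -!mulmxA GH mulmx1.
    by rewrite !mulmxA BH -(mulmxA _ G) GB -(mulmxA H) -DB !mulmxA.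
  have endX := HX _ _ GX DX; have endZ := HX _ _ GZ (Dblock _ gf).
  case: (local_endo Agen Uind endX endZ) => [u|[m Dm]]; [left | right].
    have Du : D \in unitmx.
      have /mulmx1_unit[//] : D *m (G *m invmx (H *m D *m G) *m H) = 1%:M.
      have DG : D *m G = G *m (H *m D *m G) by rewrite !mulmxA GH mul1mx.
      by rewrite !mulmxA DG -(mulmxA G) mulmxV // mulmx1.
    by move: Du; rewrite !unitmxE det_ublock unitrM => /andP[].
  exists m; have : D ^+ m = 0.
    have HDG : (H *m D *m G) ^+ m = H *m D ^+ m *m G.
      elim: m {Dm} => [|m IHm]; first by rewrite !expr0 mulmx1.
      rewrite !exprS IHm -![_ * _]/(_ *m _) !mulmxA -(mulmxA (H *m D) G) GH.
      by rewrite mulmx1.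
    rewrite -[LHS]mul1mx -GH -[LHS]mulmx1 -GH !mulmxA -(mulmxA G H).
    by rewrite -(mulmxA G _ G) -HDG Dm mulmx0 mul0mx.
  by rewrite expr_block_diag => /eqP; rewrite -block_mx0 => /eqP/eq_block_mx[].
have [lambda root_l] : exists l, root (char_poly f) l.
  by apply/closed_rootP; rewrite size_char_poly eqSS -lt0n.
have [v vf v0] : exists2 v : 'rV_p, v *m f = lambda *: v & v != 0.
  by apply/eigenvalueP; rewrite eigenvalue_root_char.
have comm : (f - lambda%:M) *m f = f *m (f - lambda%:M).
  by rewrite mulmxBl mulmxBr scalar_mxC.
case: (fcomm _ comm) => [u|[m fm]].
  case/eqP: v0; rewrite -[v]mulmx1 -(mulmxV u) mulmxA mulmxBr vf mul_mx_scalar.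
  by rewrite subrr mul0mx.
have ex : exists m, (f - lambda%:M) ^+ m == 0 by exists m; rewrite fm.
case: (ex_minnP ex) => -[|n] /eqP fn min.
  move: v0; rewrite -[v]mulmx1 -[1%:M]/((f - lambda%:M) ^+ 0) fn mulmx0.
  by rewrite eqxx.
exists lambda, n; have fn0 : (f - lambda%:M) ^+ n != 0.
  by apply/negP => /min; rewrite ltnn.
split; last split=> // g gN; last first.
  apply: fcomm; move: gN; rewrite mulmxBr mulmxBl mul_mx_scalar mul_scalar_mx.
  by move/(addIr _).
rewrite ltnNge; apply: contra fn0 => pn; rewrite -(subnK pn) exprD.
by rewrite (nilpotent_exp fn) mulr0.
Qed.
End Regular.

(** * The discrete types *)

Section Evaluation.
Variables (k : fieldType) (A : algType k) (d : nat) (M : bimod A {poly k} d).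

(** Tensoring with a point of the line evaluates the matrix entries there; the
isomorphism replaces the one-by-one blocks by entries. *)
Lemma tensor_point (lambda : k) : exists W : rep A d,
  (forall a, W a = map_mx (horner_eval lambda) (M a)) /\
  rep_iso W (tensor M (point lambda)).
Proof.
have [||| W WE] := @rep_build _ A d (fun a => map_mx (horner_eval lambda) (M a)).
- move=> c a b; apply/matrixP => i j; rewrite !mxE rmorphD.
  by rewrite mxE bimod_scale /horner_eval hornerD hornerZ.
- by rewrite rmorph1; apply: map_mx1.
- by move=> a b; rewrite rmorphM; apply: map_mxM.
exists W; split=> //.
exists (\mxcol_(i < d) row i (1%:M : 'M[k]_d)), (\mxrow_(j < d) col j (1%:M : 'M[k]_d)).
split=> [||a].
- rewrite mul_mxcol_mxrow -[RHS]mxdiagZ; apply/eq_mxblock => i j.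
  rewrite (colE j) mul1mx -colE [col j _]mx11_scalar !mxE.
  by case: eqVneq => _; rewrite ?conform_mx_id // raddf0.
- rewrite mul_mxrow_mxcol; apply/matrixP => i j; rewrite summxE.
  transitivity ((1%:M *m 1%:M : 'M[k]_d) i j); last by rewrite mulmx1.
  by rewrite [RHS]mxE; apply: eq_bigr => l _; rewrite mxE big_ord1 !mxE.
- rewrite mxcol_mul /= /tensor_act mul_mxblock_mxrow; apply/eq_mxcol => i.
  rewrite -row_mul mul1mx WE; apply/matrixP => u j; rewrite ord1 summxE !mxE.
  rewrite (bigD1 j) //= big1 => [|l lj]; last first.
    by rewrite /point_act mul_scalar_mx !mxE (negPf lj) mulr0.
  by rewrite /point_act mul_scalar_mx !mxE eqxx mulr1 addr0.
Qed.
End Evaluation.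

Section Tame.
Variables (k : closedFieldType) (A : algType k) (x z : A).
Hypotheses (char0 : [pchar k] =i pred0) (Agen : generates x z).
Hypotheses (xx : x * x = 0) (zz : z * z = 0) (zx : z * x = 0).

(** Jumps of length at most [d]: pairs of them for the long types, and single ones
for the short types and their duals. *)
Definition discrete_index d : finType :=
  ((bool * 'I_d) * (bool * 'I_d) + ('I_d + 'I_d))%type.

Definition discrete_type d (i : discrete_index d) (U : rep A d) : Prop :=
  let X := trx x U in let Z := trz z U in
  match i with
  | inl (a, j) => exists w, long_type (a.1, val a.2) (j.1, val j.2) X Z w
  | inr (inl n) => Z *m X = 0 /\ exists phi, short_type n X Z phi
  | inr (inr n) => Z *m X = 0 /\ exists phi, short_type n X^T Z^T phi
  end.

Lemma discrete_type_iso d (i : discrete_index d) (U V : rep A d) :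
  indecomposable U -> indecomposable V ->
  discrete_type i U -> discrete_type i V -> rep_iso U V.
Proof.
move=> Uind Vind; case: i => [[a j] [w Uw] [w' Vw]|[n|n] [UZX [phi Up]] [VZX [psi Vp]]].
- by refine (long_iso Agen xx zz zx Uind Vind Uw Vw).
- by refine (short_iso Agen xx zz zx Uind Vind UZX VZX Up Vp).
- by refine (short_dual_iso Agen xx zz zx Uind Vind UZX VZX Up Vp).
Qed.

Lemma indecomposable_cases d (U : rep A d) : indecomposable U ->
  (exists i, discrete_type i U) \/
  exists (c p : nat) (f : 'M[k]_p), [/\ (c <= p)%N, (p + p)%N = d &
    conjugate (trx x U) (trz z U) (nil_block (1%:M - c%:R *: f)) (nil_block f)].
Proof.
move=> Uind; have XX := trxx xx U; have ZZ := trzz zz U; have XZ := trxz zx U.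
have [ZX|ZX] := eqVneq (trz z U *m trx x U) 0; last first.
  left; have [[b n] [[b' n'] [w [/= an jn type]]]] := long_type_exists XX ZZ ZX.
  by exists (inl ((b, Ordinal an), (b', Ordinal jn))), w.
have [[n [phi [nd type]]]|[n [phi [nd type]]]|] := pencil_trichotomy char0 XX ZZ XZ ZX.
- by left; exists (inr (inl (Ordinal nd))); split=> //; exists phi.
- by left; exists (inr (inr (Ordinal nd))); split=> //; exists phi.
- by right.
Qed.

(** When [x = 0] the regular modules form discrete classes as well, because the
normal form [(1 - c f, f)] then forces [c f = 1]. *)
Lemma tame_of_square_zero : x = 0 -> tame A.
Proof.
move=> x0 d d0.
pose P (i : discrete_index d + 'I_d.+1) (U : rep A d) : Prop := match i with
  | inl j => discrete_type j U
  | inr c => exists (p : nat) (f : 'M[k]_p), (p + p)%N = d /\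
      conjugate (trx x U) (trz z U) (nil_block (1%:M - (val c)%:R *: f)) (nil_block f)
  end.
have [|q [E EP]] := @finitely_many_classes k A d _ P.
  case=> [j|c] U V Uind Vind; first exact: discrete_type_iso.
  case=> p [f [pd cU]] [p' [f' [p'd cV]]].
  have pp' : p' = p by apply: double_inj; rewrite -!addnn p'd pd.
  subst p'; clear p'd.
  have scal (W : rep A d) g : conjugate (trx x W) (trz z W)
      (nil_block (1%:M - (val c)%:R *: g)) (nil_block g) -> (val c)%:R *: g = 1%:M :> 'M[k]_p.
    move=> [G [H [GH _ GX _]]]; move: GX; rewrite /trx x0 rmorph0 trmx0 mulmx0.
    move/(congr1 (mulmx^~ H)); rewrite mul0mx -mulmxA GH mulmx1 => /esym/eqP.
    by rewrite -block_mx0 => /eqP/eq_block_mx[_ /eqP + _ _]; rewrite subr_eq0 => /eqP.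
  have ff' : f = f'.
    have cf := scal _ _ cU; have cf' := scal _ _ cV.
    have [c0|c0] := eqVneq ((val c)%:R : k) 0; last first.
      by apply: (scalerI c0); rewrite cf cf'.
    move: cf; rewrite c0 scale0r => /esym one0.
    by rewrite -[f]mulmx1 -[f']mulmx1 one0 !mulmx0.
  apply: (rep_iso_of_conjugate Agen); apply: conjugate_trans cU _.
  by rewrite ff'; apply: conjugate_sym.
have noI : 'I_0 -> bimod A {poly k} d by case.
exists 0, q, noI, E => U Uind; right; apply: EP => //.
have [[i Ui]|[c [p [f [cp pd cU]]]]] := indecomposable_cases Uind.
  by exists (inl i).
have cd : (c < d.+1)%N by rewrite ltnS (leq_trans cp) // -pd leq_addr.
by exists (inr (Ordinal cd)), p, f.
Qed.
End Tame.

(** * One-parameter families *)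

Lemma bimod_build (k : fieldType) (A S : algType k) m (f : A -> 'M[S]_m) :
  {morph f : a b / a + b} -> (forall c a i j, f (c *: a) i j = c *: f a i j) ->
  f 1 = 1%:M -> (forall a b, f (a * b) = f a *m f b) ->
  exists M : bimod A S m, forall a, M a = f a.
Proof.
move=> fD fZ f1 fM.
have fB : zmod_morphism f.
  move=> a b; rewrite fD; congr (_ + _); apply/matrixP => i j.
  by rewrite -scaleN1r fZ scaleN1r mxE.
have f_mon : monoid_morphism f by [].
pose za := GRing.isZmodMorphism.Build A 'M[S]_m f fB.
pose ma := GRing.isMonoidMorphism.Build A 'M[S]_m f f_mon.
pose F : {rmorphism A -> 'M[S]_m} := HB.pack f za ma.
by exists (@Bimod _ _ _ _ F fZ).
Qed.

Lemma nil_blockM (R : pzSemiRingType) p (f g : 'M[R]_p) : nil_block f *m nil_block g = 0.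
Proof.
by rewrite /nil_block mulmx_block !mul0mx !mulmx0 !addr0 block_mx0.
Qed.

(** The functionals [al], [be], [ga] are the coordinates of the algebra modulo the
product [x z], on which the families below vanish. *)
Section Family.
Variables (k : closedFieldType) (A : algType k) (x z : A) (al be ga : A -> k).
Hypotheses (char0 : [pchar k] =i pred0) (Agen : generates x z).
Hypotheses (xx : x * x = 0) (zz : z * z = 0) (zx : z * x = 0).
Hypotheses (alL : forall c a b, al (c *: a + b) = c * al a + al b)
  (beL : forall c a b, be (c *: a + b) = c * be a + be b)
  (gaL : forall c a b, ga (c *: a + b) = c * ga a + ga b).
Hypotheses (al1 : al 1 = 1) (be1 : be 1 = 0) (ga1 : ga 1 = 0).
Hypotheses (alM : forall a b, al (a * b) = al a * al b)
  (beM : forall a b, be (a * b) = al a * be b + be a * al b)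
  (gaM : forall a b, ga (a * b) = al a * ga b + ga a * al b).
Hypotheses (alx : al x = 0) (bex : be x = 1) (gax : ga x = 0)
  (alz : al z = 0) (bez : be z = 0) (gaz : ga z = 1).

(** The regular pencil [(1 - c F, F)] with [F = N + T], where the parameter [T] is the
eigenvalue. *)
Definition family_mx p (c : k) (N : 'M[k]_p) : 'M[{poly k}]_p * 'M[{poly k}]_p :=
  let F := map_mx polyC N + 'X%:M in (1%:M - c%:P *: F, F).

Lemma regular_family p (c : k) (N : 'M[k]_p) :
  exists M : bimod A {poly k} (p + p), forall a,
    M a = (al a)%:P%:M + (be a)%:P *: (nil_block (family_mx c N).1)^T
          + (ga a)%:P *: (nil_block (family_mx c N).2)^T.
Proof.
case: (family_mx c N) => F1 F2 /=.
have FF (f g : 'M[{poly k}]_p) : (nil_block f)^T *m (nil_block g)^T = 0.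
  by rewrite -trmx_mul nil_blockM trmx0.
move: (FF F1 F1) (FF F1 F2) (FF F2 F1) (FF F2 F2).
move: (nil_block F1)^T (nil_block F2)^T => X Z XX XZ ZX ZZ {FF F1 F2}.
have lin (h : A -> k) : (forall c a b, h (c *: a + b) = c * h a + h b) ->
    (forall a b, h (a + b) = h a + h b) /\ (forall c a, h (c *: a) = c * h a).
  move=> hL; have hD a b : h (a + b) = h a + h b by rewrite -[a]scale1r hL mul1r scale1r.
  split=> // c' a; have := hL c' a 0; rewrite addr0 => ->.
  by have := hD 0 0; rewrite addr0 => /eqP; rewrite -subr_eq subrr eq_sym => /eqP ->; rewrite addr0.
have [alD alZ] := lin _ alL; have [beD beZ] := lin _ beL; have [gaD gaZ] := lin _ gaL.
apply: bimod_build => [a b|c' a i j||a b].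
- rewrite alD beD gaD; apply/matrixP => i j; rewrite !mxE !polyCD.
  ring.
- rewrite alZ beZ gaZ !mxE !polyCM -[RHS]mul_polyC; ring.
- by rewrite al1 be1 ga1 !scale0r !addr0.
- rewrite !mulmxDr !mulmxDl !mul_scalar_mx !mul_mx_scalar -!scalemxAl -!scalemxAr.
  rewrite XX XZ ZX ZZ !scaler0 !addr0 alM beM gaM; apply/matrixP => i j.
  rewrite !mxE !polyCD !polyCM; ring.
Qed.

Lemma conjugate_nil_block p (f g G H : 'M[k]_p) c :
  G *m H = 1%:M -> H *m G = 1%:M -> G *m f = g *m G ->
  conjugate (nil_block (1%:M - c *: f)) (nil_block f)
            (nil_block (1%:M - c *: g)) (nil_block g).
Proof.
move=> GH HG Gf; exists (block_mx G 0 0 G), (block_mx H 0 0 H).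
have blk (h h' : 'M_p) : G *m h = h' *m G ->
    block_mx G 0 0 G *m nil_block h = nil_block h' *m block_mx G 0 0 G.
  by move=> e; rewrite /nil_block !mulmx_block !mul0mx !mulmx0 !addr0 !add0r e.
split; try by rewrite mulmx_block !mul0mx !mulmx0 !addr0 !add0r ?GH ?HG -scalar_mx_block.
- by apply: blk; rewrite mulmxBr mulmxBl mulmx1 mul1mx -scalemxAr -scalemxAl Gf.
- exact: blk.
Qed.

(** There is one family for each integer [c] at which the pencil is invertible and
each nilpotency index [n]; a nilpotent matrix of index [n] with local
centraliser is chosen classically, if there is one. *)
Lemma tame_of_coordinates : tame A.
Proof.
move=> d d0.
have [//|q [E EP]] := @finitely_many_classes k A d _ (@discrete_type _ _ x z d).
  by move=> i U V Uind Vind; apply: (discrete_type_iso Agen xx zz zx).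
have [pd|pd] := eqVneq (d./2 + d./2)%N d; last first.
  have noI : 'I_0 -> bimod A {poly k} d by case.
  exists 0, q, noI, E => U Uind; right; apply: EP => //.
  have [//|[c [p [f [_ pd' _]]]]] := indecomposable_cases char0 xx zz zx Uind.
  by case/eqP: pd; rewrite -pd' (addnn p) doubleK addnn.
move: (d./2) pd => p pd; subst d.
have chooseN n : exists N' : 'M[k]_p, forall N : 'M[k]_p,
    local_nilpotent n N -> local_nilpotent n N'.
  have [[N NP]|no] := pselect (exists N : 'M[k]_p, local_nilpotent n N); first by exists N.
  by exists 0 => N NP; case: no; exists N.
have {chooseN} [Nf NfP] := choice chooseN.
pose J := ('I_p.+1 * 'I_p)%type.
have chooseM (i : J) := regular_family (i.1 : nat)%:R (Nf i.2).
have {chooseM} [M MP] := choice chooseM.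
exists #|{: J}|, q, (fun i => M (enum_val i)), E => U Uind.
have [|[c [p' [f [cp pp' cU]]]]] := indecomposable_cases char0 xx zz zx Uind.
  by move=> ?; right; apply: EP.
have {}pp' : p' = p by apply: double_inj; rewrite -!addnn.
subst p'; left.
have p0 : (0 < p)%N by move: d0; rewrite addn_gt0 orbb.
have [lam [n [np fn]]] := regular_local Agen Uind cU p0.
have [G [H [GH HG NG]]] := local_nilpotent_conj (NfP _ _ fn) fn.
have cp' : (c < p.+1)%N by [].
exists (enum_rank ((Ordinal cp', Ordinal np) : J)), lam; rewrite enum_rankK.
have [W [WE Wiso]] := tensor_point (M (Ordinal cp', Ordinal np)) lam.
apply: rep_iso_trans Wiso.
apply: (rep_iso_of_conjugate Agen); apply: conjugate_trans cU _.
have Gf : G *m f = (Nf n + lam%:M) *m G.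
  by rewrite -[f](subrK lam%:M) mulmxDr mulmxDl NG scalar_mxC.
have ev g : map_mx (horner_eval lam) (nil_block g) =
    nil_block (map_mx (horner_eval lam) g) :> 'M[k]_(p + p).
  by rewrite /nil_block map_block_mx !map_mx0.
have evN : map_mx (horner_eval lam) (map_mx polyC (Nf n) + 'X%:M) = Nf n + lam%:M.
  by apply/matrixP => i j; rewrite !mxE /= /horner_eval hornerD hornerC hornerMn hornerX.
rewrite /trx /trz !WE !MP alx bex gax alz bez gaz !raddf0 !polyC1 !scale1r !scale0r.
rewrite !add0r !addr0 -!map_trmx !trmxK !ev /= map_mxB map_mxZ map_mx1 /= evN.
have -> : horner_eval lam (c%:R)%:P = c%:R by exact: hornerC.
exact: conjugate_nil_block GH HG Gf.
Qed.
End Family.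

(** * The free algebra on two letters *)

Section FreeAlgebra.
Variable k : comNzRingType.
Notation F := (free_alg2 k).
Notation malgF := {malg k[{fmonom 'I_2}]}.

Lemma free_alg_generates : generates (free_x k) (free_y k).
Proof.
move=> P P1 Px Py PL PM.
have P0 : P 0 by have := PL (-1) 1 1 P1 P1; rewrite scaleN1r addNr.
have Pmon (m : {fmonom 'I_2}) : P (<< m >> : malgF).
  case: m => s; elim: s => [|i s IHs].
    suff -> : FMonom [::] = mone :> {fmonom 'I_2} by exact: P1.
    by apply/val_inj; rewrite /= fm1.
  have -> : (<< FMonom (i :: s) >> : malgF) =
      ((<< fmu i >> : malgF) : F) * ((<< FMonom s >> : malgF) : F).
    rewrite free_mulE [RHS]fgmulUU mulr1; congr << _ >>.
    by apply/val_inj; rewrite /= fmM fmU.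
  apply: PM => //; have [->|->] : i = ord0 \/ i = ord_max; [|exact: Px|exact: Py].
  by case: i => -[|[]] // lt; [left | right]; apply: val_inj.
move=> p; rewrite [p]monalgE.
elim: (finmap.enum_fset _) => [|m s IHs]; first by rewrite big_nil; exact: P0.
rewrite big_cons; set t := \sum_(i <- s) _ in IHs *.
have -> : << p@_m *g m >> + t = p@_m *: ((<< m >> : malgF) : F) + (t : F) :> malgF.
  congr (_ + _); rewrite free_scale_malgE; apply/malgP => m'.
  by rewrite mcoeffZ !mcoeffU mulr_natr.
exact: PL.
Qed.

(** The universal property, for a ring with a central morphism [iota] from [k]; it
is applied to matrices over a noncommutative [k]-algebra. *)
Lemma free_alg_eval (T : nzRingType) (iota : {rmorphism k -> T}) (tx ty : T) :
  (forall c t, iota c * t = t * iota c) ->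
  exists phi : {rmorphism F -> T},
    [/\ phi (free_x k) = tx, phi (free_y k) = ty &
        forall c p, phi (c *: p) = iota c * phi p].
Proof.
move=> iotaC.
pose h0 (m : {fmonom 'I_2}) : T := \prod_(i <- (m : seq _)) (if i == ord0 then tx else ty).
have hM : mmorphism h0.
  by split=> [m1 m2|]; rewrite /h0 ?fmM ?fm1 ?big_cat ?big_nil.
pose h : {mmorphism {fmonom 'I_2} -> T} := HB.pack h0 (monalg.isMultiplicative.Build _ _ h0 hM).
pose f (p : F) : T := mmap iota h p.
have fB : zmod_morphism f by move=> a b; apply: mmapB.
have f_mon : monoid_morphism f.
  split; first exact: mmap1.
  move=> a b; rewrite /f free_mulE.
  have [fM _] := @commr_mmap_is_multiplicative _ _ _ iota h (fun g m m' => iotaC _ _).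
  exact: fM.
pose za := GRing.isZmodMorphism.Build F T f fB.
pose ma := GRing.isMonoidMorphism.Build F T f f_mon.
pose phi : {rmorphism F -> T} := HB.pack f za ma.
exists phi; split.
- by rewrite [LHS]mmapU [X in X * _](rmorph1 iota) mul1r /= /h0 fmU big_seq1.
- by rewrite [LHS]mmapU [X in X * _](rmorph1 iota) mul1r /= /h0 fmU big_seq1.
- by move=> c p; rewrite /= /f free_scale_malgE mmapZ.
Qed.
End FreeAlgebra.

(** * Matrices with [X Y - Y X = Y^2] *)

Section JordanPlane.
Variable k : fieldType.
Hypothesis char0 : [pchar k] =i pred0.

Lemma jordan_relation_pow n (X Y : 'M[k]_n) j :
  X * Y - Y * X = Y ^+ 2 -> X * Y ^+ j - Y ^+ j * X = Y ^+ j.+1 *+ j.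
Proof.
move=> rel; elim: j => [|j IHj]; first by rewrite expr0 mulr1 mul1r subrr.
have -> : X * Y ^+ j.+1 - Y ^+ j.+1 * X =
    (X * Y ^+ j - Y ^+ j * X) * Y + Y ^+ j * (X * Y - Y * X).
  by rewrite exprSr mulrBl mulrBr !mulrA addrA subrK.
by rewrite IHj rel mulrnAl -exprSr -exprD addn2 mulrSr.
Qed.

(** On the stable image of [Y] the relation reads [[Y^-1, X] = 1], which is
impossible in characteristic zero on a nonzero finite-dimensional space by
taking traces. *)
Lemma jordan_relation_nilpotent n (X Y : 'M[k]_n) :
  X * Y - Y * X = Y ^+ 2 -> Y ^+ n = 0.
Proof.
move=> rel; pose W := row_base (Y ^+ n).
have Wfree : row_free W by apply: row_base_free.
have WY_eq : (W :=: Y ^+ n)%MS := eq_row_base _.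
clearbody W.
have st : (Y ^+ n <= Y ^+ n.+1)%MS.
  pose f (A : 'M[k]_n) := A *m Y.
  have fE j : iter j f 1%:M = Y ^+ j by elim: j => //= j ->; rewrite exprSr.
  rewrite -!fE; apply: iter_stable_down; last exact: submx1.
  by move=> A B AB; apply: submxMr.
have [Y' WY] : exists Y', W *m Y = Y' *m W.
  apply/submxP; rewrite WY_eq; have : (Y ^+ n *m Y <= Y ^+ n)%MS.
    by rewrite -[_ *m _]exprSr exprS -[Y * _]/(Y *m _) submxMl.
  by apply: submx_trans; apply: submxMr; rewrite WY_eq.
have [X' WX] : exists X', W *m X = X' *m W.
  apply/submxP; rewrite WY_eq; have : (Y ^+ n *m X <= Y ^+ n)%MS.
    have -> : Y ^+ n *m X = X *m Y ^+ n - (Y ^+ n.+1) *+ n.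
      by rewrite -(jordan_relation_pow n rel) opprB addrC subrK.
    rewrite addmx_sub ?submxMl // eqmx_opp -scaler_nat scalemx_sub //.
    by rewrite exprS -[Y * _]/(Y *m _) submxMl.
  by apply: submx_trans; apply: submxMr; rewrite WY_eq.
have [D DY] : exists D, D *m Y' = 1%:M.
  have /submxP[D WE] : (W <= W *m Y)%MS.
    rewrite WY_eq; apply: submx_trans st _; rewrite exprSr -[_ * Y]/(_ *m Y).
    by apply: submxMr; rewrite WY_eq.
  exists D; apply: (row_free_inj Wfree); rewrite mul1mx {2}WE WY.
  by rewrite mulmxA.
have rel' : X' *m Y' - Y' *m X' = Y' *m Y'.
  have lift2 B B' C C' : W *m B = B' *m W -> W *m C = C' *m W ->
      B' *m C' *m W = W *m (B *m C).
    by move=> WB WC; rewrite -mulmxA -WC !mulmxA WB.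
  apply: (row_free_inj Wfree); rewrite mulmxBl (lift2 X X' Y Y') // (lift2 Y Y' X X') //.
  rewrite (lift2 Y Y' Y Y') // -mulmxBr -[X *m Y]/(X * Y) -[Y *m X]/(Y * X).
  by rewrite rel expr2.
have /mulmx1C YD := DY.
have : \tr (D *m X' - X' *m D) = (\rank (Y ^+ n))%:R.
  have -> : D *m X' - X' *m D = D *m (X' *m Y' - Y' *m X') *m D.
    rewrite mulmxBr mulmxBl !mulmxA DY mul1mx -[D *m X' *m Y' *m D]mulmxA YD.
    by rewrite mulmx1.
  by rewrite rel' mulmxA DY mul1mx YD mxtrace1.
rewrite raddfB /= mxtrace_mulC subrr => /esym/eqP.
by rewrite (proj1 (pcharf0P _) char0) mxrank_eq0 => /eqP.
Qed.

Definition shift_mx m : 'M[k]_m.+1 := \matrix_(i, j) (j == i.+1 :> nat)%:R.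

(** A cyclic basis [v, v Y, v Y^2, ...] for a vector [v] with [v Y^m] nonzero, which exists
because each factor [Y] lowers the rank by at most one. *)
Lemma jordan_basis m (Y : 'M[k]_m.+1) : Y ^+ m.+1 = 0 -> \rank Y = m ->
  exists2 P, P \in unitmx & P *m Y = shift_mx m *m P.
Proof.
move=> Yn rkY.
have rk j : (j <= m.+1)%N -> (m.+1 - j <= \rank (Y ^+ j))%N.
  elim: j => [|j IHj] jm; first by rewrite mxrank1 subn0.
  have := mxrank_mul_min (Y ^+ j) Y; rewrite -[_ *m _]exprSr rkY; apply: leq_trans.
  by have := IHj (ltnW jm); lia.
have Ym : Y ^+ m != 0 by rewrite -mxrank_eq0 -lt0n; have := rk m (leqnSn _); rewrite subSnn.
have [v vY] : exists v : 'rV_m.+1, v *m Y ^+ m != 0.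
  by have /rowV0Pn[w /submxP[c ->] w0] := Ym; exists c.
pose P := \matrix_(i < m.+1) (v *m Y ^+ i).
have PE i : row i P = v *m Y ^+ i by rewrite rowK.
exists P.
  rewrite -row_free_unit -kermx_eq0; apply/eqP/row_matrixP => r; rewrite row0.
  set c := row r _; have cP : c *m P = 0 by rewrite -row_mul mulmx_ker row0.
  apply/rowP => j; rewrite [RHS]mxE; move: {2}(j : nat) (leqnn j) => s.
  elim/ltn_ind: s j => s IHs j js.
  have : c *m P *m Y ^+ (m - j) = 0 by rewrite cP mul0mx.
  rewrite [c *m P]mulmx_sum_row mulmx_suml (bigD1 j) //= big1 => [|i ij].
    rewrite addr0 PE -scalemxAl -mulmxA -[Y ^+ j *m _]exprD subnKC; last by rewrite -ltnS.
    by move/eqP; rewrite scaler_eq0 (negPf vY) orbF => /eqP.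
  rewrite PE -scalemxAl; case: (ltngtP i j) => [lt|gt|/val_inj e].
  - by rewrite (IHs i) ?scale0r // (leq_trans lt).
  - rewrite -mulmxA -[Y ^+ i *m _]exprD (_ : i + (m - j) = m.+1 + (i - j.+1))%N.
      by rewrite exprD Yn mul0r mulmx0 scaler0.
    by have := ltn_ord j; lia.
  - by rewrite e eqxx in ij.
apply/row_matrixP => i; rewrite !row_mul PE -mulmxA -[_ *m Y]exprSr.
have [im|im] := ltnP i m.
  have -> : row i (shift_mx m) = delta_mx 0 (Ordinal (im : i.+1 < m.+1)%N).
    by apply/rowP => j; rewrite !mxE.
  by rewrite -rowE PE.
have -> : row i (shift_mx m) = 0.
  apply/rowP => j; rewrite !mxE; case: eqP => // ji.
  by have := ltn_ord j; rewrite ji ltnS ltnNge im.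
have -> : (i.+1 = m.+1)%N by apply/eqP; rewrite eqSS eqn_leq im -ltnS ltn_ord.
by rewrite Yn mulmx0 mul0mx.
Qed.
End JordanPlane.

(** * Generators of quotients and images *)

Section Quotients.
Variable k : comNzRingType.

Lemma quot_generates (I : ideal (free_alg2 k)) :
  generates (quot_pi I (free_x k)) (quot_pi I (free_y k)).
Proof.
move=> P P1 Px Py PL PM q; have [a ->] := quot_piP q.
apply: (free_alg_generates (P := fun a => P (quot_pi I a))) => // [c {}a b Pa Pb|{}a b Pa Pb].
- by rewrite linearP; apply: PL.
- by rewrite rmorphM; apply: PM.
Qed.

Lemma quot_relation (s : seq (free_alg2 k)) (s1 : 1 \notin generated s) (r : free_alg2 k) :
  r \in s -> quot_pi (generated_ideal s1) r = 0.
Proof.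
move=> rs; rewrite -(raddf0 (quot_pi _)); apply/quot_piE; rewrite subr0.
by apply/asboolP => P _; apply.
Qed.

End Quotients.

Section ImageGenerators.
Variables (k : comNzRingType) (A B : algType k) (f : {lrmorphism A -> B}).

Lemma in_image_apply a : f a \in in_image f.
Proof. by apply/asboolP; exists a. Qed.

Definition to_image (a : A) : image_alg f := ImageAlg (in_image_apply a).

Lemma to_imageP (b : image_alg f) : exists a, b = to_image a.
Proof.
by case: b => b bP; have /asboolP[a ab] := bP; exists a; apply: val_inj.
Qed.

Lemma image_generates (x y : A) :
  generates x y -> generates (to_image x) (to_image y).
Proof.
move=> gen P P1 Px Py PL PM b; have [a ->] := to_imageP b.
apply: (gen (fun a => P (to_image a))) => // [|c {}a a' Pa Pa'|{}a a' Pa Pa'].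
- suff -> : to_image 1 = 1 by [].
  by apply: val_inj; rewrite /= !rmorph1.
- suff -> : to_image (c *: a + a') = c *: to_image a + to_image a' by exact: PL.
  by apply: val_inj; rewrite /= !linearP.
- suff -> : to_image (a * a') = to_image a * to_image a' by exact: PM.
  by apply: val_inj; rewrite /= !rmorphM.
Qed.
End ImageGenerators.

(** Linear combinations of the new generators and of [1] suffice to recover the
old ones. *)
Lemma generates_change (k : pzRingType) (A : algType k) (x y x' y' : A) :
  generates x y ->
  (forall P : A -> Prop, P 1 -> P x' -> P y' ->
     (forall c a b, P a -> P b -> P (c *: a + b)) -> P x /\ P y) ->
  generates x' y'.
Proof.
move=> gen H P P1 Px Py PL PM; have [Px0 Py0] := H P P1 Px Py PL.
exact: gen.
Qed.

(** * Upper triangular matrices with constant diagonal *)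

Section Triangular.
Variables (R : comNzRingType) (m : nat).
Implicit Types M : 'M[R]_m.+1.

(** Entries with natural numbers as indices, so that the superdiagonals [(i, i + t)]
can be handled by arithmetic. *)
Definition entry M i j : R := M (inord i) (inord j).

Lemma entryD M M' i j : entry (M + M') i j = entry M i j + entry M' i j.
Proof. by rewrite /entry mxE. Qed.
Lemma entryN M i j : entry (- M) i j = - entry M i j.
Proof. by rewrite /entry mxE. Qed.
Lemma entryZ c M i j : entry (c *: M) i j = c * entry M i j.
Proof. by rewrite /entry mxE. Qed.
Lemma entry1 i j : (i <= m)%N -> (j <= m)%N -> entry 1%:M i j = (i == j)%:R.
Proof.
by move=> im jm; rewrite /entry mxE -(inj_eq val_inj) /= !inordK.
Qed.
Lemma entryM M M' i j :
  entry (M *m M') i j = \sum_(0 <= l < m.+1) entry M i l * entry M' l j.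
Proof.
rewrite /entry mxE big_mkord; apply: eq_bigr => l _.
by rewrite inord_val.
Qed.

Definition upper_const M c : Prop :=
  (forall i j, (i <= m)%N -> (j < i)%N -> entry M i j = 0) /\
  (forall i, (i <= m)%N -> entry M i i = c).

(** Only the indices between [i] and [i + t] contribute to the product. *)
Lemma entryM_triangular M M' c c' i t : upper_const M c -> upper_const M' c' ->
  (i + t <= m)%N ->
  entry (M *m M') i (i + t) = \sum_(0 <= l < t.+1) entry M i (i + l) * entry M' (i + l) (i + t).
Proof.
move=> [M0 _] [M'0 _] itm; rewrite entryM.
have e1 : (i <= m.+1)%N by lia.
have e2 : (i <= (i + t).+1)%N by lia.
have e3 : ((i + t).+1 <= m.+1)%N by lia.
rewrite (big_cat_nat (leq0n i) e1) (big_cat_nat e2 e3) /=.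
rewrite [X in X + _](_ : _ = 0); last first.
  by rewrite big_nat; apply: big1 => l li; rewrite M0 ?mul0r //; lia.
rewrite [X in _ + (_ + X)](_ : _ = 0); last first.
  by rewrite big_nat; apply: big1 => l li; rewrite M'0 ?mulr0 //; lia.
rewrite add0r addr0 -[X in index_iota X _]add0n big_addn -addnS addKn.
by apply: eq_bigr => l _; rewrite addnC.
Qed.

Lemma upper_constM M M' c c' : upper_const M c -> upper_const M' c' ->
  upper_const (M *m M') (c * c').
Proof.
move=> MU M'U; have [M0 Mc] := MU; have [M'0 M'c] := M'U; split=> [i j im ji|i im].
  rewrite entryM big_nat; apply: big1 => l lm.
  have [li|il] := ltnP l i; first by rewrite M0 ?mul0r.
  by rewrite M'0 ?mulr0 //; lia.
have := @entryM_triangular _ _ _ _ i 0 MU M'U; rewrite addn0 => -> //.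
by rewrite big_nat1 addn0 Mc // M'c.
Qed.

Lemma entryM1 M M' c c' i : upper_const M c -> upper_const M' c' -> (i < m)%N ->
  entry (M *m M') i i.+1 = c * entry M' i i.+1 + entry M i i.+1 * c'.
Proof.
move=> MU M'U im; have := @entryM_triangular _ _ _ _ i 1 MU M'U.
rewrite addn1 => -> //; rewrite big_nat_recr //= big_nat1 addn0 addn1.
have [_ Mc] := MU; have [_ M'c] := M'U; rewrite Mc ?M'c //; exact: ltnW.
Qed.

Lemma entryM2 M M' c c' i : upper_const M c -> upper_const M' c' -> (i.+1 < m)%N ->
  entry (M *m M') i i.+2 =
  c * entry M' i i.+2 + entry M i i.+1 * entry M' i.+1 i.+2 + entry M i i.+2 * c'.
Proof.
move=> MU M'U im; have := @entryM_triangular _ _ _ _ i 2 MU M'U.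
rewrite addn2 => -> //; rewrite big_nat_recr // big_nat_recr // big_nat1 /= addn0 addn1 addn2.
have [_ Mc] := MU; have [_ M'c] := M'U; rewrite Mc ?M'c //; lia.
Qed.

Lemma upper_constL a M M' c c' : upper_const M c -> upper_const M' c' ->
  upper_const (a *: M + M') (a * c + c').
Proof.
move=> [M0 Mc] [M'0 M'c]; split=> [i j im ji|i im]; rewrite entryD entryZ.
  by rewrite M0 // M'0 // mulr0 addr0.
by rewrite Mc // M'c.
Qed.

Lemma upper_const1 : upper_const 1%:M 1.
Proof.
split=> [i j im ji|i im]; rewrite entry1 ?eqxx //; last by lia.
by rewrite (gtn_eqF ji).
Qed.
End Triangular.

(** Multiplication by [N] shifts rows or columns, so the relation is a recursion
along each superdiagonal. *)
Section ShiftCommutator.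
Variables (k : fieldType) (m : nat) (X : 'M[k]_m.+1).
Let N := shift_mx k m.
Hypothesis rel : X *m N - N *m X = N *m N.

Lemma entry_shift i j : (i <= m)%N -> (j <= m)%N -> entry N i j = (j == i.+1)%:R.
Proof. by move=> im jm; rewrite /entry mxE !inordK. Qed.

Lemma entry_shift_mul (M : 'M[k]_m.+1) i j : (i < m)%N ->
  entry (N *m M) i j = entry M i.+1 j.
Proof.
move=> im; rewrite entryM big_mkord (bigD1 (inord i.+1)) //= big1 => [|l li].
  by rewrite inordK // entry_shift ?(ltnW im) // eqxx mul1r addr0.
rewrite entry_shift ?(ltnW im) -1?ltnS //; case: eqP => [e|_]; last by rewrite mul0r.
by case/eqP: li; apply: val_inj; rewrite /= e inordK.
Qed.

Lemma entry_mul_shiftS (M : 'M[k]_m.+1) i j : (j < m)%N ->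
  entry (M *m N) i j.+1 = entry M i j.
Proof.
move=> jm; rewrite entryM big_mkord (bigD1 (inord j)) //= big1 => [|l lj].
  by rewrite inordK ?entry_shift ?(ltnW jm) ?eqxx ?mulr1 ?addr0 // ltnW.
rewrite entry_shift -1?ltnS // eqSS; case: eqP => [e|_]; last by rewrite mulr0.
by case/eqP: lj; apply: val_inj; rewrite /= e inordK // -e.
Qed.

Lemma entry_mul_shift0 (M : 'M[k]_m.+1) i : entry (M *m N) i 0 = 0.
Proof.
rewrite entryM big_mkord big1 // => l _.
by rewrite entry_shift -1?ltnS // mulr0.
Qed.

Lemma commutator_entry0 i : (i < m)%N -> entry X i.+1 0 = 0.
Proof.
move=> im; have := congr1 (fun M => entry M i 0) rel.
rewrite entryD entryN !entry_mul_shift0 sub0r entry_shift_mul // => /eqP.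
by rewrite oppr_eq0 => /eqP.
Qed.

Lemma commutator_entry i j : (i < m)%N -> (j < m)%N ->
  entry X i.+1 j.+1 = entry X i j - (j == i.+1)%:R.
Proof.
move=> im jm; have := congr1 (fun M => entry M i j.+1) rel.
rewrite entryD entryN !entry_mul_shiftS // entry_shift_mul //.
rewrite (entry_shift (ltnW im) (ltnW jm)) => <-.
by rewrite opprB addrC subrK.
Qed.

Lemma commutator_upper_const : upper_const X (entry X 0 0).
Proof.
split=> [i j im ji|i im].
  elim: j i im ji => [|j IHj] [|i] // im ji; first exact: commutator_entry0.
  rewrite commutator_entry //; last by lia.
  rewrite IHj ?(ltnW im) // sub0r; case: eqP => [e|_]; rewrite ?oppr0 //.
  by lia.
elim: i im => // i IHi im; rewrite commutator_entry // IHi ?(ltnW im) //.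
by rewrite ltn_eqF // subr0.
Qed.

Lemma commutator_entry1 i : (i < m)%N -> entry X i i.+1 = entry X 0 1 - i%:R.
Proof.
elim: i => [|i IHi] im; first by rewrite subr0.
by rewrite commutator_entry ?(ltnW im) // IHi ?(ltnW im) // eqxx -addrA -opprD natr1.
Qed.

Lemma commutator_entry2 i : (i.+1 < m)%N -> entry X i i.+2 = entry X 0 2.
Proof.
elim: i => [//|i IHi] im; rewrite commutator_entry ?IHi; try lia.
by rewrite gtn_eqF // subr0.
Qed.
End ShiftCommutator.

Lemma shift_upper_const (k : fieldType) m : upper_const (shift_mx k m) 0.
Proof.
split=> [i j im ji|i im]; rewrite entry_shift //; last by rewrite ltn_eqF.
  by rewrite ltn_eqF // ltnW.
by lia.
Qed.

(** * Surjective algebra morphisms *)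

Section Kernel.
Variables (k : pzRingType) (A B : algType k) (f : {lrmorphism A -> B}).

Definition ker_pred : {pred A} := fun a => f a == 0.

Fact ker_pred_closed : idealr_closed (ker_pred).
Proof.
split=> [||a u v].
- by rewrite unfold_in /ker_pred rmorph0.
- by rewrite unfold_in /ker_pred rmorph1 oner_eq0.
- rewrite !unfold_in /ker_pred => /eqP fu /eqP fv.
  by rewrite rmorphD /= rmorphM /= fu fv mulr0 addr0.
Qed.
HB.instance Definition _ := isIdealr.Build A (ker_pred) ker_pred_closed.

Fact ker_pred_mulr (a u : A) : u \in ker_pred -> u * a \in ker_pred.
Proof. by rewrite !unfold_in => /eqP fu; rewrite rmorphM /= fu mul0r. Qed.

Definition ker_ideal : ideal A := Ideal ker_pred_mulr.

Lemma quotient_by_kernel : (forall b, exists a, f a = b) -> has_quotient_isomorphic_to A B.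
Proof.
move=> surj; exists ker_ideal.
pose g (q : quot_alg ker_ideal) : B := f (repr q).
have gE a : g (quot_pi ker_ideal a) = f a.
  by apply/eqP; rewrite -subr_eq0 -rmorphB; exact: (repr_quot_pi ker_ideal a).
have gB : zmod_morphism g.
  move=> p q; have [a ->] := quot_piP p; have [b ->] := quot_piP q.
  by rewrite -rmorphB !gE rmorphB.
have g_mon : monoid_morphism g.
  split=> [|p q]; first by rewrite -(rmorph1 (quot_pi ker_ideal)) gE rmorph1.
  have [a ->] := quot_piP p; have [b ->] := quot_piP q.
  by rewrite -rmorphM !gE rmorphM.
have gZ : scalable g.
  by move=> c q; have [a ->] := quot_piP q; rewrite -linearZ !gE linearZ.
pose za := GRing.isZmodMorphism.Build (quot_alg ker_ideal) B g gB.
pose ma := GRing.isMonoidMorphism.Build (quot_alg ker_ideal) B g g_mon.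
pose sa := GRing.isScalable.Build k (quot_alg ker_ideal) B *:%R g gZ.
pose G : {lrmorphism quot_alg ker_ideal -> B} := HB.pack g za ma sa.
have [s sK] := choice surj.
exists G, (fun b => quot_pi ker_ideal (s b)) => [q|b] /=; last by rewrite gE.
have [a ->] := quot_piP q; rewrite gE; apply/quot_piE.
by rewrite unfold_in /= /ker_pred rmorphB /= sK subrr.
Qed.
End Kernel.

Section Pullback.
Variables (k : fieldType) (A B : algType k) (f : {lrmorphism A -> B}).
Hypothesis surj : forall b, exists a, f a = b.

Lemma indecomposable_pullback d (U : rep A d) (W : rep B d) :
  (forall a, U a = W (f a)) -> indecomposable W -> indecomposable U.
Proof.
move=> UE [d0 Wind]; split=> // d1 d2 U1 U2 [P [Q [PQ QP PU]]].
have ker a : f a = 0 -> U1 a = 0 /\ U2 a = 0.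
  move=> fa; have : sum_act U1 U2 a = 0.
    by rewrite -[LHS]mulmx1 -PQ mulmxA -[sum_act _ _ a *m P]PU UE fa rmorph0 mulmx0 mul0mx.
  by move/eqP; rewrite -block_mx0 => /eqP/eq_block_mx[].
have [s sK] := choice surj.
have descend e (V : rep A e) : (forall a, f a = 0 -> V a = 0) ->
    exists V' : rep B e, forall a, V' (f a) = V a.
  move=> V0; have VE a b : f a = f b -> V a = V b.
    move=> ab; apply/eqP; rewrite -subr_eq0 -rmorphB V0 //.
    by rewrite rmorphB /= ab subrr.
  have [||| V' V'E] := @rep_build k B e (fun b => V (s b)).
  - move=> c a b; rewrite -rep_linear; apply: VE.
    by rewrite linearP /= !sK.
  - by rewrite -(rmorph1 V); apply: VE; rewrite sK rmorph1.
  - by move=> a b; rewrite -rmorphM; apply: VE; rewrite rmorphM /= !sK.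
  by exists V' => a; rewrite V'E; apply: VE; rewrite sK.
have [V1 V1E] := descend _ U1 (fun a fa => (ker a fa).1).
have [V2 V2E] := descend _ U2 (fun a fa => (ker a fa).2).
apply: (Wind _ _ V1 V2); exists P, Q; split=> // b.
by have [a <-] := surj b; rewrite -UE PU /= /sum_act V1E V2E.
Qed.

(** Let [A] act on a bimodule over [B] through [f].  Any decomposition over [A] of a
module over [B] is one over [B], since the kernel of [f] acts by zero on the
summands. *)
Lemma wild_pullback : wild B -> wild A.
Proof.
case=> m [M [Mind Miso]].
have [||||M' M'E] := @bimod_build k A (free_alg2 k) m (fun a => M (f a)).
- by move=> a b; rewrite !rmorphD.
- by move=> c a i j; rewrite linearZ bimod_scale.
- by rewrite !rmorph1.
- by move=> a b; rewrite !rmorphM.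
have tE d (V : rep _ d) a : tensor M' V a = tensor M V (f a).
  by rewrite /= /tensor_act; apply: eq_mxblock => i j; rewrite M'E.
exists m, M'; split=> [d V Vind|d e V W [P [Q [PQ QP PU]]]].
  by apply: (@indecomposable_pullback _ _ (tensor M V)); [exact: tE | exact: Mind].
apply: Miso; exists P, Q; split=> // b; have [a <-] := surj b.
by rewrite -!tE.
Qed.
End Pullback.

(** * The image algebras in a Jordan basis *)

Section JordanImage.
Variables (k : closedFieldType) (m : nat) (rho : {lrmorphism jordan_plane k -> 'M[k]_m.+1}).
Hypotheses (char0 : [pchar k] =i pred0) (rk : \rank (rho (jordan_y k)) = m).

Definition im_x : image_alg rho := to_image rho (quot_pi _ (free_x k)).
Definition im_y : image_alg rho := to_image rho (quot_pi _ (free_y k)).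

Lemma im_generates : generates im_x im_y.
Proof. by apply: image_generates; apply: quot_generates. Qed.

Lemma im_relation : val im_x * val im_y - val im_y * val im_x = val im_y ^+ 2.
Proof.
pose X : jordan_plane k := quot_pi _ (free_x k).
pose Y : jordan_plane k := quot_pi _ (free_y k).
have rel : X * Y - Y * X = Y * Y.
  rewrite /X /Y -!rmorphM -rmorphB; apply/eqP; rewrite -subr_eq0 -rmorphB; apply/eqP.
  by rewrite [LHS]quot_relation // inE expr2.
have := congr1 rho rel; rewrite rmorphB !rmorphM /= expr2; exact.
Qed.

Lemma im_basis : exists2 P, P \in unitmx & P *m val im_y = shift_mx k m *m P.
Proof.
apply: jordan_basis rk; exact: jordan_relation_nilpotent char0 _ _ _ im_relation.
Qed.

Section Basis.
Variable P : 'M[k]_m.+1.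
Hypotheses (Pu : P \in unitmx) (PY : P *m val im_y = shift_mx k m *m P).

(** An element of the image algebra as a matrix in the basis where [y] is a Jordan
block. *)
Definition cj (a : image_alg rho) : 'M[k]_m.+1 := P *m val a *m invmx P.
Definition ent a i j := entry (cj a) i j.

Lemma cjL c a b : cj (c *: a + b) = c *: cj a + cj b.
Proof. by rewrite /cj /= mulmxDr mulmxDl -scalemxAr -scalemxAl. Qed.
Lemma cj1 : cj 1 = 1%:M.
Proof. by rewrite /cj /= mulmx1 mulmxV. Qed.
Lemma cjM a b : cj (a * b) = cj a *m cj b.
Proof. by rewrite /cj !mulmxA mulmxKV. Qed.
Lemma cj_inj : injective cj.
Proof.
move=> a b /(congr1 (fun M => invmx P *m M *m P)).
by rewrite /cj !mulmxA mulVmx // !mul1mx -!mulmxA mulVmx // !mulmx1 => /val_inj.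
Qed.
Lemma cj_y : cj im_y = shift_mx k m.
Proof. by rewrite /cj PY -mulmxA mulmxV // mulmx1. Qed.

Lemma cj_rel : cj im_x *m shift_mx k m - shift_mx k m *m cj im_x =
  shift_mx k m *m shift_mx k m.
Proof.
rewrite -!cj_y -!cjM -[LHS]addrC -scaleN1r -cjL; congr cj.
by rewrite scaleN1r addrC; apply: val_inj; rewrite /= im_relation expr2.
Qed.

Lemma ut_x : upper_const (cj im_x) (ent im_x 0 0).
Proof. exact: commutator_upper_const cj_rel. Qed.
Lemma ut_y : upper_const (cj im_y) 0.
Proof. by rewrite cj_y; apply: shift_upper_const. Qed.

Lemma ut_all a : upper_const (cj a) (ent a 0 0).
Proof.
suff [c ac] : exists c, upper_const (cj a) c.
  by have [_ cE] := ac; rewrite /ent cE.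
apply: (im_generates (P := fun a => exists c, upper_const (cj a) c)).
- by exists 1; rewrite cj1; apply: upper_const1.
- by exists (ent im_x 0 0); apply: ut_x.
- by exists 0; apply: ut_y.
- by move=> c {}a b [c1 a1] [c2 b2]; exists (c * c1 + c2); rewrite cjL; apply: upper_constL.
- by move=> {}a b [c1 a1] [c2 b2]; exists (c1 * c2); rewrite cjM; apply: upper_constM.
Qed.

Lemma entL c a b i j : ent (c *: a + b) i j = c * ent a i j + ent b i j.
Proof. by rewrite /ent cjL entryD entryZ. Qed.
Lemma ent0M a b : ent (a * b) 0 0 = ent a 0 0 * ent b 0 0.
Proof.
by have [_ e] := upper_constM (ut_all a) (ut_all b); rewrite -(e 0%N) // /ent cjM.
Qed.
Lemma ent1M a b i : (i < m)%N ->
  ent (a * b) i i.+1 = ent a 0 0 * ent b i i.+1 + ent a i i.+1 * ent b 0 0.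
Proof. by move=> im; rewrite /ent cjM (entryM1 (ut_all a) (ut_all b)). Qed.
Lemma ent2M a b i : (i.+1 < m)%N ->
  ent (a * b) i i.+2 = ent a 0 0 * ent b i i.+2 + ent a i i.+1 * ent b i.+1 i.+2
    + ent a i i.+2 * ent b 0 0.
Proof. by move=> im; rewrite /ent cjM (entryM2 (ut_all a) (ut_all b)). Qed.
Lemma ent1 i j : (i <= m)%N -> (j <= m)%N -> ent 1 i j = (i == j)%:R.
Proof. by move=> im jm; rewrite /ent cj1 entry1. Qed.
Lemma ent_y i j : (i <= m)%N -> (j <= m)%N -> ent im_y i j = (j == i.+1)%:R.
Proof. by move=> im jm; rewrite /ent cj_y entry_shift. Qed.
Lemma ent_x1 i : (i < m)%N -> ent im_x i i.+1 = ent im_x 0 1 - i%:R.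
Proof. by move=> im; rewrite /ent (commutator_entry1 cj_rel). Qed.
Lemma ent_x2 i : (i.+1 < m)%N -> ent im_x i i.+2 = ent im_x 0 2.
Proof. by move=> im; rewrite /ent (commutator_entry2 cj_rel). Qed.

(** Below the diagonal the entries vanish, and on it they are constant. *)
Lemma ent_ext a b : ent a 0 0 = ent b 0 0 ->
  (forall i j, (i < j)%N -> (j <= m)%N -> ent a i j = ent b i j) -> a = b.
Proof.
move=> ab0 ab; apply: cj_inj; apply/matrixP => i j.
suff : ent a i j = ent b i j by rewrite /ent /entry !inord_val.
have im := ltn_ord i; have jm := ltn_ord j; rewrite !ltnS in im jm.
have [a0 ac] := ut_all a; have [b0 bc] := ut_all b.
case: (ltngtP i j) => [ij|ji|->]; first exact: ab.
  by rewrite /ent a0 // b0.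
by rewrite /ent ac // bc.
Qed.

(** The generator [x] shifted so that its first superdiagonal is [0, -1, -2, ...]. *)
Definition red_x : image_alg rho := im_x - ent im_x 0 0 *: 1 - ent im_x 0 1 *: im_y.

Lemma entB a b i j : ent (a - b) i j = ent a i j - ent b i j.
Proof. by rewrite addrC -scaleN1r entL mulN1r addrC. Qed.
Lemma entZ c a i j : ent (c *: a) i j = c * ent a i j.
Proof. by rewrite -[_ *: _]addr0 entL (_ : ent 0 i j = 0) ?addr0 // -(subrr 1) entB subrr. Qed.
Lemma ent0 i j : ent 0 i j = 0.
Proof. by rewrite -(subrr 1) entB subrr. Qed.

Lemma ent_red_x0 : ent red_x 0 0 = 0.
Proof. by rewrite !entB !entZ ent1 // ent_y // mulr1 mulr0 !subrr. Qed.
Lemma ent_red_x1 i : (i < m)%N -> ent red_x i i.+1 = - i%:R.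
Proof.
move=> im; rewrite !entB !entZ ent1 ?ent_y ?(ltnW im) // ent_x1 // eqxx ltn_eqF //=.
by ring.
Qed.

(** In dimension three [x] can be changed by [1] and [y] so that its first
superdiagonal is [(1, 0)]; then that of [z = y - x] is [(0, 1)].  The three
coordinates are the entries [(0, 0)], [(0, 1)] and [(1, 2)], and the product of
two elements with zero diagonal has only the entry [(0, 2)], the product of the
entry [(0, 1)] of the first and the entry [(1, 2)] of the second.  In dimensions
one and two [x] is a combination of [1] and [y]. *)
Lemma tame_small : (m <= 2)%N -> tame (image_alg rho).
Proof.
move=> m2; have [m1|m1] := leqP m 1.
  have yy : im_y * im_y = 0.
    apply: ent_ext => [|i j ij jm]; first by rewrite ent0M ent0 ent_y // mulr0.
    have [-> ->] : i = 0%N /\ j = 1%N by lia.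
    by rewrite ent1M ?ent_y ?ent0 ?mul0r ?mulr0 ?addr0; try lia.
  have xE : im_x = ent im_x 0 0 *: 1 + ent im_x 0 1 *: im_y.
    apply: ent_ext => [|i j ij jm].
      by rewrite entL entZ ent1 // ent_y // mulr1 mulr0 addr0.
    have [-> ->] : i = 0%N /\ j = 1%N by lia.
    by rewrite entL entZ ent1 ?ent_y ?mulr0 ?mulr1 ?add0r; try lia.
  have gen : generates 0 im_y.
    apply: (generates_change im_generates) => Q Q1 _ Qy QL; split=> //.
    rewrite xE -[_ *: im_y]addr0; apply: (QL) => //; apply: (QL) => //.
    by rewrite -(addNr 1) -scaleN1r; apply: QL.
  by apply: (tame_of_square_zero char0 gen) => //; rewrite ?mulr0.
have {m1 m2} mE : m = 2 by lia.
(* The superdiagonal of [x] is [(c, c - 1)]; subtracting [(c - 1) y] makes it [(1, 0)]. *)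
pose x0 := im_x - ent im_x 0 0 *: 1 - (ent im_x 0 1 - 1) *: im_y.
pose z := im_y - x0.
have lt0 : (0 < m)%N by rewrite mE.
have lt1 : (1 < m)%N by rewrite mE.
have x00 : ent x0 0 0 = 0.
  by rewrite !entB !entZ ent1 // ent_y // mulr1 mulr0 !subrr.
have x01 : ent x0 0 1 = 1.
  by rewrite !entB !entZ ent1 // ent_y //=; ring.
have x12 : ent x0 1 2 = 0.
  by rewrite !entB !entZ ent1 // ent_y // ent_x1 //=; ring.
have z00 : ent z 0 0 = 0 by rewrite entB x00 ent_y // subrr.
have z01 : ent z 0 1 = 0 by rewrite entB x01 ent_y // subrr.
have z12 : ent z 1 2 = 1 by rewrite entB x12 ent_y // subr0.
have prod0 a b : ent a 0 0 = 0 -> ent b 0 0 = 0 -> ent a 0 1 * ent b 1 2 = 0 -> a * b = 0.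
  move=> a0 b0 ab; apply: ent_ext => [|i j ij jm]; first by rewrite ent0M a0 mul0r ent0.
  rewrite ent0.
  have [[-> ->]|[[-> ->]|[-> ->]]] : (i = 0 /\ j = 1 \/ i = 1 /\ j = 2 \/ i = 0 /\ j = 2)%N by lia.
  - by rewrite ent1M // a0 b0 mul0r mulr0 addr0.
  - by rewrite ent1M // a0 b0 mul0r mulr0 addr0.
  - by rewrite ent2M // a0 b0 ab mul0r mulr0 !addr0.
have gen : generates x0 z.
  apply: (generates_change im_generates) => Q Q1 Qx Qz QL.
  have Q0 : Q 0 by rewrite -(addNr 1) -scaleN1r; apply: QL.
  have Qy : Q im_y by rewrite -(subrK x0 im_y) -[im_y - x0]scale1r; apply: QL.
  split=> //; have -> : im_x = (ent im_x 0 0 *: 1 + ((ent im_x 0 1 - 1) *: im_y + x0)).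
    by rewrite /x0 [_ *: im_y + _]addrC subrK addrC subrK.
  by apply: (QL) => //; apply: QL.
apply: (@tame_of_coordinates k _ x0 z (fun a => ent a 0 0) (fun a => ent a 0 1)
         (fun a => ent a 1 2)) => //.
- by apply: prod0; rewrite // x12 mulr0.
- by apply: prod0; rewrite // z01 mul0r.
- by apply: prod0; rewrite // z01 mul0r.
- by move=> *; apply: entL.
- by move=> *; apply: entL.
- by move=> *; apply: entL.
- by rewrite ent1.
- by rewrite ent1.
- by rewrite ent1.
- by move=> *; apply: ent0M.
- by move=> *; apply: ent1M.
- by move=> *; apply: ent1M.
Qed.
End Basis.
End JordanImage.

(** * The quotient in dimension at least five *)

Section RingelElements.
Variable k : comNzRingType.

Definition rx : ringel_alg k := quot_pi _ (free_x k).
Definition ry : ringel_alg k := quot_pi _ (free_y k).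

Lemma ringel_relation (r : free_alg2 k) :
  r \in ringel_rels k -> quot_pi (generated_ideal (ringel_rels_proper k)) r = 0.
Proof. exact: quot_relation. Qed.

Lemma ryy : ry * ry = 0.
Proof.
have /ringel_relation : free_y k ^+ 2 \in ringel_rels k.
  by rewrite !inE; apply/or4P; constructor 1.
by rewrite expr2 rmorphM.
Qed.

Lemma ryx : ry * rx = rx * ry.
Proof.
have /ringel_relation : free_y k * free_x k - free_x k * free_y k \in ringel_rels k.
  by rewrite !inE; apply/or4P; constructor 2.
by rewrite rmorphB !rmorphM => /subr0_eq.
Qed.

Lemma rxxy : rx * rx * ry = 0.
Proof.
have /ringel_relation : free_x k ^+ 2 * free_y k \in ringel_rels k.
  by rewrite !inE; apply/or4P; constructor 3.
by rewrite expr2 !rmorphM.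
Qed.

Lemma rxxx : rx * rx * rx = 0.
Proof.
have /ringel_relation : free_x k ^+ 3 \in ringel_rels k.
  by rewrite !inE; apply/or4P; constructor 4.
by rewrite exprSr expr2 !rmorphM.
Qed.

End RingelElements.

Section Comb.
Variables (k : comNzRingType) (R : algType k) (x y : R).

(** The general element of the quotient: it is spanned by [1, x, y, x^2, xy]. *)
Definition comb (al be ga de ep : k) : R :=
  al *: 1 + be *: x + ga *: y + de *: (x * x) + ep *: (x * y).

Lemma combD c al be ga de ep al' be' ga' de' ep' :
  comb (c * al + al') (c * be + be') (c * ga + ga') (c * de + de') (c * ep + ep') =
  c *: comb al be ga de ep + comb al' be' ga' de' ep'.
Proof.
rewrite /comb !scalerDl !scalerDr !scalerA.
by do 4![rewrite [RHS]addrACA; congr (_ + _)].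
Qed.

Hypotheses (yy : y * y = 0) (yx : y * x = x * y) (xxy : x * x * y = 0)
  (xxx : x * x * x = 0).

Lemma comb_mulx al be ga de ep : comb al be ga de ep * x = comb 0 al 0 be ga.
Proof.
rewrite /comb !mulrDl -!scalerAl mul1r yx xxx -(mulrA x y) yx (mulrA x x) xxy.
by rewrite !scaler0 !addr0 !scale0r add0r addr0.
Qed.

Lemma comb_muly al be ga de ep : comb al be ga de ep * y = comb 0 0 al 0 be.
Proof.
rewrite /comb !mulrDl -!scalerAl mul1r yy xxy -(mulrA x y) yy mulr0.
by rewrite !scaler0 !addr0 !scale0r !add0r addr0 addrC.
Qed.
End Comb.

Section RingelQuotient.
Variables (k : closedFieldType) (m : nat) (rho : {lrmorphism jordan_plane k -> 'M[k]_m.+1}).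
Hypotheses (char0 : [pchar k] =i pred0) (m4 : (4 <= m)%N).
Variable P : 'M[k]_m.+1.
Hypotheses (Pu : P \in unitmx) (PY : P *m val (im_y rho) = shift_mx k m *m P).
Local Notation ent := (ent P).
Local Notation x := (red_x rho P).
Local Notation y := (im_y rho).

(** Up to degree two in the grading by superdiagonals, the matrices of the
image have polynomial entries along each superdiagonal; the coefficients of
these polynomials, except the constant one in degree two, are the coordinates
of the image in the quotient. *)
Definition diag_poly (a : image_alg rho) (al be ga de ep : k) : Prop :=
  [/\ ent a 0 0 = al,
      forall i, (i < 4)%N -> ent a i i.+1 = ga - be * i%:R &
      exists e, forall i, (i < 3)%N ->
        ent a i i.+2 = e - ep * i%:R + de * (i%:R * i.+1%:R)].

Lemma diag_polyM a b al be ga de ep al' be' ga' de' ep' :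
  diag_poly a al be ga de ep -> diag_poly b al' be' ga' de' ep' ->
  diag_poly (a * b) (al * al') (al * be' + be * al') (al * ga' + ga * al')
    (al * de' + be * be' + de * al')
    (al * ep' + ga * be' + be * ga' + ep * al').
Proof.
move=> [a0 a1 [e a2]] [b0 b1 [e' b2]]; split.
- by rewrite (ent0M Pu PY) a0 b0.
- move=> i i4; rewrite (ent1M Pu PY) ?a0 ?b0 ?a1 ?b1 //; last by lia.
  by ring.
- exists (al * e' + ga * ga' - ga * be' + e * al') => i i3.
  rewrite (ent2M Pu PY) ?a0 ?b0 ?a1 ?b1 ?a2 ?b2 //; try lia.
  by rewrite -natr1; ring.
Qed.

Lemma red_generates : generates x y.
Proof.
apply: (generates_change (@im_generates k m rho)) => Q Q1 Qx Qy QL.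
have Q0 : Q 0 by rewrite -(addNr 1) -scaleN1r; apply: QL.
split=> //.
have -> : im_x rho = ent (im_x rho) 0 0 *: 1 + (ent (im_x rho) 0 1 *: y + x).
  by rewrite /red_x [_ *: y + _]addrC subrK addrC subrK.
by apply: (QL) => //; apply: QL.
Qed.

Lemma diag_poly_x : diag_poly x 0 1 0 0 0.
Proof.
split; first exact: ent_red_x0.
  by move=> i i4; rewrite (ent_red_x1 Pu PY); [ring | lia].
exists (ent (im_x rho) 0 2) => i i3; rewrite !entB !entZ (ent1 rho Pu); try lia.
rewrite (ent_x2 Pu PY); last by lia.
rewrite (ent_y Pu PY); try lia.
have -> : (i == i.+2) = false by lia.
have -> : (i.+2 == i.+1) = false by lia.
by rewrite /=; ring.
Qed.

Lemma diag_poly_y : diag_poly y 0 0 1 0 0.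
Proof.
split; first by rewrite (ent_y Pu PY).
  by move=> i i4; rewrite (ent_y Pu PY) ?eqxx /=; [ring | lia | lia].
exists 0 => i i3; rewrite (ent_y Pu PY); try lia.
have -> : (i.+2 == i.+1) = false by lia.
by rewrite /=; ring.
Qed.

Lemma diag_poly_all a : exists al be ga de ep, diag_poly a al be ga de ep.
Proof.
apply: (red_generates (P := fun a => exists al be ga de ep, diag_poly a al be ga de ep)).
- exists 1, 0, 0, 0, 0; split; first by rewrite (ent1 rho Pu).
    by move=> i i4; rewrite (ent1 rho Pu) ?ltn_eqF //=; [ring | lia | lia].
  exists 0 => i i3; rewrite (ent1 rho Pu) ?ltn_eqF //=; try lia.
  by ring.
- by exists 0, 1, 0, 0, 0; apply: diag_poly_x.
- by exists 0, 0, 1, 0, 0; apply: diag_poly_y.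
- move=> c {}a b [al [be [ga [de [ep [a0 a1 [e a2]]]]]]].
  move=> [al' [be' [ga' [de' [ep' [b0 b1 [e' b2]]]]]]].
  exists (c * al + al'), (c * be + be'), (c * ga + ga'), (c * de + de'), (c * ep + ep').
  split; first by rewrite entL a0 b0.
    by move=> i i4; rewrite entL a1 // b1 //; ring.
  by exists (c * e + e') => i i3; rewrite entL a2 // b2 //; ring.
- move=> {}a b [al [be [ga [de [ep ap]]]]] [al' [be' [ga' [de' [ep' bp]]]]].
  by do 5!eexists; apply: diag_polyM ap bp.
Qed.

(** The coefficients of the quadratic polynomial [e - ep i + de i (i + 1)] on the
second superdiagonal, from its values at [0], [1], [2]: half the second difference,
and then a first difference. *)
Let de (a : image_alg rho) : k := (ent a 2 4 - ent a 1 3 *+ 2 + ent a 0 2) / 2%:R.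
Let ep (a : image_alg rho) : k := ent a 0 2 + de a *+ 2 - ent a 1 3.

Definition to_ringel (a : image_alg rho) : ringel_alg k :=
  comb (rx k) (ry k) (ent a 0 0) (ent a 0 1 - ent a 1 2) (ent a 0 1) (de a) (ep a).

Lemma to_ringelE a al be ga de' ep' : diag_poly a al be ga de' ep' ->
  to_ringel a = comb (rx k) (ry k) al be ga de' ep'.
Proof.
move=> [a0 a1 [e a2]]; have two0 : (2%:R : k) != 0.
  by rewrite (proj1 (pcharf0P _) char0).
have deE : de a = de'.
  rewrite /de !a2 //; field; exact: two0.
rewrite /to_ringel /ep deE a0 !a1 // !a2 //.
by congr (comb _ _ _ _ _ _ _); ring.
Qed.

Lemma to_ringelL c a b : to_ringel (c *: a + b) = c *: to_ringel a + to_ringel b.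
Proof.
rewrite {2 3}/to_ringel -combD /to_ringel !entL.
by congr (comb _ _ _ _ _ _ _); rewrite /ep /de ?entL; ring.
Qed.

Lemma to_ringel1 : to_ringel 1 = 1.
Proof.
have -> : to_ringel 1 = comb (rx k) (ry k) 1 0 0 0 0.
  rewrite /to_ringel /ep /de !(ent1 rho Pu); try lia.
  by congr (comb _ _ _ _ _ _ _); rewrite /=; ring.
by rewrite /comb !scale0r !addr0 scale1r.
Qed.

Lemma to_ringel_x : to_ringel x = rx k.
Proof.
rewrite (to_ringelE diag_poly_x) /comb !scale0r scale1r.
by rewrite !addr0 add0r.
Qed.

Lemma to_ringel_y : to_ringel y = ry k.
Proof.
rewrite (to_ringelE diag_poly_y) /comb !scale0r scale1r.
by rewrite !addr0 add0r.
Qed.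

(** Multiplicativity is checked only for right multiplication by the generators. *)
Lemma to_ringelM a b : to_ringel (a * b) = to_ringel a * to_ringel b.
Proof.
have [rel1 rel2] := (ryy k, ryx k); have [rel3 rel4] := (rxxy k, rxxx k).
apply: (red_generates (P := fun b => forall a, to_ringel (a * b) = to_ringel a * to_ringel b)).
- by move=> {}a; rewrite mulr1 to_ringel1 mulr1.
- move=> {}a; have [al [be [ga [de' [ep' ap]]]]] := diag_poly_all a.
  rewrite to_ringel_x (to_ringelE ap) comb_mulx // (to_ringelE (diag_polyM ap diag_poly_x)).
  by congr (comb _ _ _ _ _ _ _); ring.
- move=> {}a; have [al [be [ga [de' [ep' ap]]]]] := diag_poly_all a.
  rewrite to_ringel_y (to_ringelE ap) comb_muly // (to_ringelE (diag_polyM ap diag_poly_y)).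
  by congr (comb _ _ _ _ _ _ _); ring.
- move=> c b1 b2 h1 h2 {}a.
  by rewrite mulrDr -scalerAr !to_ringelL h1 h2 [RHS]mulrDr -[X in _ = X + _]scalerAr.
- by move=> b1 b2 h1 h2 {}a; rewrite mulrA h2 h1 h2 mulrA.
Qed.

Lemma ringel_quotient :
  exists f : {lrmorphism image_alg rho -> ringel_alg k}, forall b, exists a, f a = b.
Proof.
have hB : zmod_morphism to_ringel.
  by move=> a b; rewrite -scaleN1r addrC to_ringelL scaleN1r addrC.
have h_mon : monoid_morphism to_ringel by split; [exact: to_ringel1 | exact: to_ringelM].
have hZ : scalable to_ringel.
  have h0 : to_ringel 0 = 0 by rewrite -(subrr 1) hB subrr.
  by move=> c a; have := to_ringelL c a 0; rewrite h0 !addr0.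
pose za := GRing.isZmodMorphism.Build (image_alg rho) (ringel_alg k) to_ringel hB.
pose ma := GRing.isMonoidMorphism.Build (image_alg rho) (ringel_alg k) to_ringel h_mon.
pose sa := GRing.isScalable.Build k (image_alg rho) (ringel_alg k) *:%R to_ringel hZ.
pose f : {lrmorphism image_alg rho -> ringel_alg k} := HB.pack to_ringel za ma sa.
exists f; apply: quot_generates.
- by exists 1; rewrite rmorph1.
- by exists x; apply: to_ringel_x.
- by exists y; apply: to_ringel_y.
- by move=> c a b [a' <-] [b' <-]; exists (c *: a' + b'); rewrite linearP.
- by move=> a b [a' <-] [b' <-]; exists (a' * b'); rewrite rmorphM.
Qed.
End RingelQuotient.

(** * Five glued strings *)

(** Two matrices over [S] that satisfy the relations define a bimodule: evaluate
the free algebra at them, with scalars acting through [S], and descend to the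
quotient. *)
Lemma quotient_bimod (k : fieldType) (S : algType k) n (s : seq (free_alg2 k))
    (s1 : 1 \notin generated s) (X Y : 'M[S]_n.+1) :
  (forall phi : {rmorphism free_alg2 k -> 'M[S]_n.+1},
     phi (free_x k) = X -> phi (free_y k) = Y -> forall r, r \in s -> phi r = 0) ->
  exists M : bimod (quot_alg (generated_ideal s1)) S n.+1,
    M (quot_pi _ (free_x k)) = X /\ M (quot_pi _ (free_y k)) = Y.
Proof.
move=> rels.
pose iota : {rmorphism k -> 'M[S]_n.+1} := (@scalar_mx S n.+1 \o in_alg S).
have iotaE c (N : 'M[S]_n.+1) : iota c * N = map_mx ( *:%R c) N.
  apply/matrixP => i j; rewrite -[_ * _]/(_ *m _) mul_scalar_mx !mxE.
  by rewrite /= mulr_algl.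
have iotaC c (N : 'M[S]_n.+1) : iota c * N = N * iota c.
  rewrite iotaE; apply/matrixP => i j; rewrite !mxE (bigD1 j) //= big1 => [|l lj].
    by rewrite !mxE eqxx mulr_algr addr0.
  by rewrite !mxE (negPf lj) mulr0.
have [phi [phix phiy phiZ]] := free_alg_eval X Y iotaC.
have phi0 r : r \in (generated s : {pred _}) -> phi r = 0.
  move=> /asboolP/(_ (fun a => phi a = 0)); apply; last exact: rels.
  split=> [|u v u0 v0|a u u0|a u u0]; first exact: rmorph0.
  - by rewrite rmorphB /= u0 v0 subr0.
  - by rewrite rmorphM /= u0 mulr0.
  - by rewrite rmorphM /= u0 mul0r.
pose f (q : quot_alg (generated_ideal s1)) : 'M[S]_n.+1 := phi (repr q).
have fE a : f (quot_pi _ a) = phi a.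
  by apply/eqP; rewrite -subr_eq0 -rmorphB /= phi0 //; apply: (repr_quot_pi _ a).
have [||||M ME] := @bimod_build k _ S n.+1 f.
- move=> p q; have [a ->] := quot_piP p; have [b ->] := quot_piP q.
  by rewrite -rmorphD !fE rmorphD.
- move=> c p i j; have [a ->] := quot_piP p.
  by rewrite -linearZ !fE phiZ iotaE mxE.
- by rewrite -(rmorph1 (quot_pi (generated_ideal s1))) fE rmorph1.
- move=> p q; have [a ->] := quot_piP p; have [b ->] := quot_piP q.
  by rewrite -rmorphM !fE rmorphM.
by exists M; rewrite !ME !fE.
Qed.

Section Gluing.
Variable k : fieldType.
Local Notation S := (free_alg2 k).

(** The five vectors of [S^2] to which the five strings are attached at their
common end: [(1, 1), (1, 0), (0, 1), (1, x), (1, y)]. *)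
Definition glue (s l : nat) : S :=
  match s, l with
  | 3, 0 => 0 | 2, _.+1 => 0
  | 4, _.+1 => free_x k | 5, _.+1 => free_y k
  | _, _ => 1
  end.

(** The basis vectors [0] and [1] span the common end [S^2] of the strings.  The
partial map [s] gives the arrows between the other basis vectors, and [t j] is
the number of the string, if any, of which an arrow leads from [j] into the
common end. *)
Definition glue_mx (s t : nat -> option nat) : 'M[S]_25 :=
  \matrix_(l, j) if (l < 2)%N then oapp (glue^~ l) 0 (t j) else (s j == Some (l : nat))%:R.

(** The common end is mapped to zero, and no basis vector has both an arrow to
another one and an arrow into the common end. *)
Definition wf_map (s t : nat -> option nat) :=
  [&& s 0 == None, s 1 == None, t 0 == None, t 1 == None &
     all (fun j => if s j is Some m then [&& 2 <= m, m < 25 & t j == None] else true) (iota 0 25)]%N.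

(** Products of such matrices are again of this kind, so that identities between
them reduce to computations with partial maps. *)
Lemma glue_mxM s t s' t' : wf_map s t -> wf_map s' t' ->
  glue_mx s t *m glue_mx s' t' =
  glue_mx (fun j => obind s (s' j)) (fun j => obind t (s' j)).
Proof.
case/and5P=> /eqP s0 /eqP s1 /eqP t0 /eqP t1 _.
case/and5P=> _ _ _ _ /allP wf'; apply/matrixP => l j; rewrite !mxE.
have := wf' j; rewrite mem_iota => /(_ (ltn_ord j)).
case sj: (s' j) => [n|] /=.
  case/and3P=> n2 n25 /eqP tj; rewrite (bigD1 (Ordinal n25)) //= big1 => [|i ij].
    by rewrite !mxE /= sj eqxx (ltnNge n) n2 /= mulr1 addr0.
  rewrite [X in _ * X]mxE tj sj /=; case: ltnP => _; rewrite ?mulr0 //.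
  case: eqP => [[e]|_]; last by rewrite mulr0.
  by case/eqP: ij; apply: val_inj.
move=> _; rewrite big1 => [|i _]; first by case: ifP.
rewrite mxE [X in _ * X]mxE sj /=; case: (ltnP i 2) => [i2|_]; last by rewrite mulr0.
have [-> ->] : s i = None /\ t i = None by case: (nat_of_ord i) i2 => [|[|]].
by case: ifP => _; rewrite mul0r.
Qed.

Lemma eq_glue_mx s t s' t' :
  all (fun j => (s j == s' j) && (t j == t' j)) (iota 0 25) ->
  glue_mx s t = glue_mx s' t'.
Proof.
move/allP=> e; apply/matrixP => l j; rewrite !mxE.
have j25 : (j : nat) \in iota 0 25 by rewrite mem_iota /= ltn_ord.
by have /andP[/eqP -> /eqP ->] := e j j25.
Qed.

Lemma glue_mx0 s t :
  all (fun j => (s j == None) && (t j == None)) (iota 0 25) -> glue_mx s t = 0.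
Proof.
move/(@eq_glue_mx _ _ (fun=> None) (fun=> None)) ->.
by apply/matrixP => l j; rewrite !mxE; case: ifP.
Qed.

(** Equality is tested with [eqn] to keep kernel computations short. *)
Fixpoint lookup (l : seq (nat * nat)) (j : nat) : option nat :=
  if l is p :: l' then if eqn p.1 j then Some p.2 else lookup l' j else None.

(** The basis vectors lie over the grid as follows, the strings in brackets:
[q_0]: 2-5 (1-4); [p_0]: 6-8 (1-3); [q_(-1)]: 9, 10 (2, 3); [p_(-1)]: 11 (2);
[p_1]: 12-14 (2-4); [q_1]: 15-18 (2-5); [r_1]: 19-21 (2-4); [q_2]: 22, 23 (3, 4);
[r_2]: 24 (3); and [r_0] is the common end. *)
Definition x_arrows := [:: (6, 2); (7, 3); (8, 4); (11, 9); (12, 15); (13, 16);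
  (14, 17); (15, 19); (16, 20); (17, 21); (22, 24)]%N.
Definition x_ends := [:: (2, 1); (3, 2); (4, 3); (5, 4)]%N.
Definition y_arrows := [:: (7, 9); (8, 10); (12, 3); (13, 4); (14, 5); (22, 20); (23, 21)]%N.
Definition y_ends := [:: (15, 2); (16, 3); (17, 4); (18, 5)]%N.

Definition string_x := glue_mx (lookup x_arrows) (lookup x_ends).
Definition string_y := glue_mx (lookup y_arrows) (lookup y_ends).

Lemma wf_x : wf_map (lookup x_arrows) (lookup x_ends). Proof. by []. Qed.
Lemma wf_y : wf_map (lookup y_arrows) (lookup y_ends). Proof. by []. Qed.

Lemma string_yy : string_y *m string_y = 0.
Proof. by rewrite glue_mxM //; apply: glue_mx0. Qed.

Lemma string_yx : string_y *m string_x = string_x *m string_y.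
Proof. by rewrite !glue_mxM //; apply: eq_glue_mx. Qed.

Lemma string_xxy : string_x *m (string_x *m string_y) = 0.
Proof. by rewrite !glue_mxM //; apply: glue_mx0. Qed.

Lemma string_xxx : string_x *m (string_x *m string_x) = 0.
Proof. by rewrite !glue_mxM //; apply: glue_mx0. Qed.

Lemma string_bimod : exists M : bimod (ringel_alg k) S 25,
  M (rx k) = string_x /\ M (ry k) = string_y.
Proof.
apply: quotient_bimod => phi phix phiy r; rewrite !inE => /or4P[] /eqP ->.
- by rewrite expr2 rmorphM /= phiy; apply: string_yy.
- by rewrite rmorphB !rmorphM /= phix phiy; apply/eqP; rewrite subr_eq0; apply/eqP/string_yx.
- by rewrite expr2 -mulrA !rmorphM /= phix phiy; apply: string_xxy.
- by rewrite exprS expr2 !rmorphM /= phix; apply: string_xxx.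
Qed.
End Gluing.

(** * Homomorphisms in block form *)

Definition inverse_arrows (s u : nat -> option nat) :=
  all (fun i => all (fun l => (s l == Some i) == (u i == Some l)) (iota 0 25)) (iota 2 23) &&
  all (fun i => if u i is Some l then (1 < i) && (l < 25) else true)%N (iota 0 25).

Lemma inverse_arrowsE s u i l : inverse_arrows s u -> (1 < i < 25)%N -> (l < 25)%N ->
  (s l == Some i) = (u i == Some l).
Proof.
case/andP=> /allP su _ /andP[i2 i25] l25.
have := su i; rewrite mem_iota i2 => /(_ i25)/allP/(_ l).
by rewrite mem_iota => /(_ l25)/eqP.
Qed.

Lemma inverse_arrows_range s u i l : inverse_arrows s u -> (i < 25)%N -> u i = Some l ->
  (1 < i)%N /\ (l < 25)%N.
Proof.
case/andP=> _ /allP/(_ i); rewrite mem_iota => u25 i25 ui.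
by have := u25 i25; rewrite ui => /andP.
Qed.

Section Blocks.
Variable k : fieldType.

(** Blocks with natural numbers as indices; their values at concrete positions are
found by computation with the arrows. *)
Definition blk e d (Phi : 'M[k]_(\sum_(i < 25) e, \sum_(j < 25) d)) (i j : nat) : 'M[k]_(e, d) :=
  submxblock Phi (inord i) (inord j).

Lemma blkE e d (Phi : 'M[k]_(\sum_(i < 25) e, \sum_(j < 25) d)) :
  Phi = \mxblock_(i < 25, j < 25) blk Phi i j.
Proof.
rewrite -[LHS]submxblockK; apply/eq_mxblock => i j.
by rewrite /blk !inord_val.
Qed.

Lemma blkM d e f (Phi : 'M[k]_(\sum_(i < 25) f, \sum_(j < 25) e))
    (Psi : 'M[k]_(\sum_(i < 25) e, \sum_(j < 25) d)) i j :
  blk (Phi *m Psi) i j = \sum_(l < 25) blk Phi i l *m blk Psi l j.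
Proof.
rewrite {1}[Phi]blkE {1}[Psi]blkE mul_mxblock /blk mxblockK.
by apply: eq_bigr => l _; rewrite !inord_val.
Qed.

Lemma blk1 d i j : (i < 25)%N -> (j < 25)%N ->
  blk (1%:M : 'M[k]_(\sum_(l < 25) d)) i j = (i == j)%:R%:M.
Proof.
move=> i25 j25; rewrite -[1%:M]mxdiagZ /blk mxblockK.
have -> : (inord i == inord j :> 'I_25) = (i == j) by rewrite -val_eqE /= !inordK.
case: (i =P j) => [ij|_]; rewrite ?conform_mx_id //.
by rewrite raddf0.
Qed.

Variables (d e : nat) (V : rep (free_alg2 k) d) (W : rep (free_alg2 k) e).
Variable (Phi : 'M[k]_(\sum_(i < 25) e, \sum_(j < 25) d)).
Local Notation B := (blk Phi).

Section OneMap.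
Variables (s t u : nat -> option nat).
Hypotheses (wf : wf_map s t) (su : inverse_arrows s u).
Hypothesis comm :
  Phi *m (\mxblock_(i < 25, j < 25) V (glue_mx k s t i j)) =
  (\mxblock_(i < 25, j < 25) W (glue_mx k s t i j)) *m Phi.

Lemma block_eq (i j : 'I_25) :
  \sum_(l < 25) B i l *m V (glue_mx k s t l j) =
  \sum_(l < 25) W (glue_mx k s t i l) *m B l j.
Proof.
have := congr1 (fun M => submxblock M i j) comm.
by rewrite {1 2}[Phi]blkE !mul_mxblock !mxblockK.
Qed.

Lemma block_lhs (i j : nat) : (i < 25)%N -> (j < 25)%N ->
  \sum_(l < 25) B i l *m V (glue_mx k s t l (inord j)) =
  if t j is Some a then B i 0 *m V (glue k a 0) + B i 1 *m V (glue k a 1)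
  else oapp (B i) 0 (s j).
Proof.
move=> i25 j25; case/and5P: wf => _ _ _ _ /allP/(_ j).
rewrite mem_iota => /(_ j25).
case tj: (t j) => [a|]; case sj: (s j) => [n|] //= sn.
- by rewrite andbF andbF in sn.
- rewrite big_ord_recl big_ord_recl big1 => [|l _].
    by rewrite addr0 !mxE /= inordK // tj.
  by rewrite mxE /= inordK // sj /= raddf0 mulmx0.
- have /and3P[n2 n25 _] := sn; rewrite (bigD1 (Ordinal n25)) //= big1 => [|l ln].
    by rewrite addr0 mxE /= inordK // sj eqxx ltnNge n2 /= rmorph1 mulmx1.
  rewrite mxE inordK // tj sj /=; case: ltnP => _; first by rewrite raddf0 mulmx0.
  case: eqP => [[nl]|_]; last by rewrite raddf0 mulmx0.
  by case/eqP: ln; apply: val_inj.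
- rewrite big1 // => l _; rewrite mxE inordK // tj sj /=.
  by case: ifP; rewrite raddf0 mulmx0.
Qed.

Lemma block_rhs (i j : nat) : (1 < i < 25)%N ->
  \sum_(l < 25) W (glue_mx k s t (inord i) l) *m B l j = oapp (B^~ j) 0 (u i).
Proof.
move=> i25; have /andP[i2 ilt] := i25.
have WE (l : 'I_25) : W (glue_mx k s t (inord i) l) = (u i == Some (l : nat))%:R%:M.
  rewrite mxE inordK // ltnNge i2 /= (inverse_arrowsE su i25 (ltn_ord l)).
  by case: eqP => _; rewrite ?rmorph1 // !raddf0.
case ui: (u i) => [n|] /=.
  have [_ n25] := inverse_arrows_range su ilt ui.
  rewrite (bigD1 (Ordinal n25)) //= big1 => [|l ln]; rewrite WE ui.
    by rewrite eqxx mul1mx addr0.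
  case: eqP => [[nl]|_]; last by rewrite raddf0 mul0mx.
  by case/eqP: ln; apply: val_inj.
by rewrite big1 // => l _; rewrite WE ui raddf0 mul0mx.
Qed.

(** Comparing the entries of [comm] in row [i] and column [j] moves a block along
the arrows that leave [j] and enter [i]. *)
Lemma arrow_eq i j : (1 < i < 25)%N -> (j < 25)%N -> t j = None ->
  oapp (B i) 0 (s j) = oapp (B^~ j) 0 (u i).
Proof.
move=> i25 j25 tj; have /andP[_ i25'] := i25.
rewrite -(block_rhs j i25); have := block_lhs i25' j25; rewrite tj => <-.
have := block_eq (inord i) (inord j).
by rewrite !inordK.
Qed.

(** The same in a column whose arrow leads into the common end. *)
Lemma end_eq i j a : (1 < i < 25)%N -> (j < 25)%N -> t j = Some a ->
  B i 0 *m V (glue k a 0) + B i 1 *m V (glue k a 1) = oapp (B^~ j) 0 (u i).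
Proof.
move=> i25 j25 tj; have /andP[_ i25'] := i25.
rewrite -(block_rhs j i25); have := block_lhs i25' j25; rewrite tj => <-.
have := block_eq (inord i) (inord j).
by rewrite !inordK.
Qed.

(** In the rows of the common end, when the blocks from [j] to the starts of the
other arrows into the common end vanish. *)
Lemma glue_eq i j a : (i < 2)%N -> (j < 25)%N -> t j = Some a ->
  (forall l, (l < 25)%N -> t l != None -> l != j -> B l j = 0) ->
  B i 0 *m V (glue k a 0) + B i 1 *m V (glue k a 1) = W (glue k a i) *m B j j.
Proof.
move=> i2 j25 tj off; have i25 : (i < 25)%N by apply: leq_trans i2 _.
have := block_lhs i25 j25; rewrite tj => <-.
have := block_eq (inord i) (inord j); rewrite !inordK // => ->.
rewrite (bigD1 (inord j)) //= big1 => [|l lj].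
  by rewrite addr0 mxE !inordK // i2 tj.
rewrite mxE inordK // i2; case tl: (t l) => [b|] /=; last by rewrite raddf0 mul0mx.
rewrite off ?mulmx0 // ?tl //; apply: contra lj => /eqP e'.
by rewrite -e' inord_val.
Qed.
End OneMap.
End Blocks.

(** * Homomorphisms between glued strings *)

Definition flip (l : seq (nat * nat)) := [seq (p.2, p.1) | p <- l].
Definition x_back := lookup (flip x_arrows).
Definition y_back := lookup (flip y_arrows).

(** One step of the search for a proof that the block [(l, j)] of a homomorphism
vanishes.  The block does not change when [l] and [j] both move backwards, or
both forwards, along the arrows of one generator.  It is zero if [j] can move
backwards but not [l], or if [l] can move forwards but not [j]. *)
Definition vanish_step (s t u : nat -> option nat) (rec : nat -> nat -> bool) l j :=
  (if u j is Some j' then if u l is Some l' then rec l' j' else true else false)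
  || (if s l is Some l' then
        if t j is None then if s j is Some j' then rec l' j' else true else false
      else false).

Fixpoint vanishes n l j : bool :=
  if n is n'.+1 then [&& 1 < l, l < 25, j < 25 &
    vanish_step (lookup x_arrows) (lookup x_ends) x_back (vanishes n') l j ||
    vanish_step (lookup y_arrows) (lookup y_ends) y_back (vanishes n') l j]%N
  else false.

(** Whether [j] is joined to one of the [roots] by a walk of at most [n] arrows; both
ends of an arrow carry the same diagonal block. *)
Fixpoint linked (arrows : seq (nat * nat)) n (roots : seq nat) j : bool :=
  (j \in roots) || if n is n'.+1 then
    has (fun p => if p.1 == j then linked arrows n' roots p.2
                  else if p.2 == j then linked arrows n' roots p.1 else false) arrows
  else false.

Section StringHom.
Variables (k : fieldType) (d e : nat).
Variables (V : rep (free_alg2 k) d) (W : rep (free_alg2 k) e).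
Variable (Phi : 'M[k]_(\sum_(i < 25) e, \sum_(j < 25) d)).
Local Notation B := (blk Phi).
Hypothesis comm_x :
  Phi *m (\mxblock_(i < 25, j < 25) V (string_x k i j)) =
  (\mxblock_(i < 25, j < 25) W (string_x k i j)) *m Phi.
Hypothesis comm_y :
  Phi *m (\mxblock_(i < 25, j < 25) V (string_y k i j)) =
  (\mxblock_(i < 25, j < 25) W (string_y k i j)) *m Phi.

Let sux : inverse_arrows (lookup x_arrows) x_back. Proof. by vm_compute. Qed.
Let suy : inverse_arrows (lookup y_arrows) y_back. Proof. by vm_compute. Qed.

Lemma arrow_x i j : (1 < i < 25)%N -> (j < 25)%N -> lookup x_ends j = None ->
  oapp (B i) 0 (lookup x_arrows j) = oapp (B^~ j) 0 (x_back i).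
Proof. exact: (arrow_eq wf_x sux comm_x). Qed.

Lemma arrow_y i j : (1 < i < 25)%N -> (j < 25)%N -> lookup y_ends j = None ->
  oapp (B i) 0 (lookup y_arrows j) = oapp (B^~ j) 0 (y_back i).
Proof. exact: (arrow_eq wf_y suy comm_y). Qed.

Lemma vanish_stepP (s t u : nat -> option nat) (rec : nat -> nat -> bool) l j :
  wf_map s t -> inverse_arrows s u ->
  (forall i j, (1 < i < 25)%N -> (j < 25)%N -> t j = None ->
    oapp (B i) 0 (s j) = oapp (B^~ j) 0 (u i)) ->
  (forall l j, rec l j -> B l j = 0) ->
  (1 < l < 25)%N -> (j < 25)%N -> vanish_step s t u rec l j -> B l j = 0.
Proof.
move=> /and5P[_ _ _ _ /allP wf] su eqs recP l25 j25.
have I0 i : (i < 25)%N -> i \in iota 0 25 by rewrite mem_iota.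
case/orP.
- case uj: (u j) => [j'|] // H.
  have [j2 j'25] := inverse_arrows_range su j25 uj.
  have sj' : s j' = Some j by apply/eqP; rewrite (inverse_arrowsE su) ?j2 // uj.
  have tj' : t j' = None.
    by have := wf j' (I0 j' j'25); rewrite sj' => /and3P[_ _ /eqP].
  have := eqs l j' l25 j'25 tj'; rewrite sj' /= => ->.
  by case: (u l) H => //= l' /recP.
- case sl: (s l) => [l'|] // H.
  have /andP[l2 llt] := l25.
  have := wf l (I0 l llt); rewrite sl => /and3P[l'2 l'25 _].
  have ul' : u l' = Some l by apply/eqP; rewrite -(inverse_arrowsE su) ?l'2 // sl.
  case tj: (t j) H => [//|] H.
  have := eqs l' j; rewrite l'2 l'25 ul' /= => <- //.
  by case: (s j) H => //= j' /recP.
Qed.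

Lemma vanishesP n l j : vanishes n l j -> B l j = 0.
Proof.
elim: n l j => [//|n IHn] l j; rewrite [vanishes _ _ _]/= => /and4P[l2 l25 j25].
have lb : (1 < l < 25)%N by rewrite l2.
case/orP.
  exact: (vanish_stepP wf_x sux arrow_x IHn lb j25).
exact: (vanish_stepP wf_y suy arrow_y IHn lb j25).
Qed.

Lemma linkedP n roots (g : 'M[k]_(e, d)) : (forall j, j \in roots -> B j j = g) ->
  forall j, linked (x_arrows ++ y_arrows) n roots j -> B j j = g.
Proof.
move=> rootsP.
have arrows_x : all (fun p => [&& 1 < p.2, p.2 < 25, p.1 < 25 &
    [&& lookup x_arrows p.1 == Some p.2, x_back p.2 == Some p.1 & lookup x_ends p.1 == None]])%N
    x_arrows by vm_compute.
have arrows_y : all (fun p => [&& 1 < p.2, p.2 < 25, p.1 < 25 &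
    [&& lookup y_arrows p.1 == Some p.2, y_back p.2 == Some p.1 & lookup y_ends p.1 == None]])%N
    y_arrows by vm_compute.
have arrow a b : (a, b) \in x_arrows ++ y_arrows -> B b b = B a a.
  rewrite mem_cat => /orP[] ab.
  - have /and4P[b2 b25 a25 /and3P[/eqP e1 /eqP ba /eqP ta]] := allP arrows_x _ ab.
    by have := @arrow_x b a; rewrite e1 ba b2 b25 /= => ->.
  - have /and4P[b2 b25 a25 /and3P[/eqP e1 /eqP ba /eqP ta]] := allP arrows_y _ ab.
    by have := @arrow_y b a; rewrite e1 ba b2 b25 /= => ->.
move: (x_arrows ++ y_arrows) arrow => arrows arrow.
elim: n => [|n IHn] j /= /orP[/rootsP //|]; first by [].
case/hasP=> -[a b] ab /=; case: eqP => [<- /IHn <-|_]; first by rewrite (arrow _ _ ab).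
by case: eqP => // <- /IHn <-; rewrite (arrow _ _ ab).
Qed.

Lemma lookup_neq_None (l : seq (nat * nat)) j : lookup l j != None -> exists a, (j, a) \in l.
Proof.
elim: l => //= -[b a] l IHl /=; case: eqnP => [<- _|_].
  by exists a; rewrite inE eqxx.
by move=> /IHl[c jc]; exists c; rewrite inE jc orbT.
Qed.

(** Five steps suffice for all pairs of starts of arrows into the common end by the
same generator. *)
Lemma off_diagonal ends l j :
  all (fun p => all (fun q => (p.1 != q.1) ==> vanishes 5 p.1 q.1) ends) ends ->
  lookup ends l != None -> lookup ends j != None -> l != j -> B l j = 0.
Proof.
move=> /allP H /lookup_neq_None[a la] /lookup_neq_None[b jb] lj.
by have /allP/(_ _ jb)/implyP/(_ lj)/vanishesP := H _ la.
Qed.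

(** At the common end the homomorphism is a two-by-two matrix of maps that
respects the five subspaces.  The vectors [(1, 0)] and [(0, 1)] make it diagonal,
[(1, 1)] makes the two diagonal maps equal to one map [g], and [(1, x)], [(1, y)]
make [g] commute with [x] and [y].  The other diagonal blocks are joined to these
by arrows. *)
Lemma string_hom : exists g : 'M[k]_(e, d),
  [/\ forall a, g *m V a = W a *m g, forall j, (j < 25)%N -> B j j = g &
      forall l, (0 < l < 25)%N -> B l 0 = 0].
Proof.
have glue_x i j a : (i < 2)%N -> (j < 25)%N -> lookup x_ends j = Some a ->
    B i 0 *m V (glue k a 0) + B i 1 *m V (glue k a 1) = W (glue k a i) *m B j j.
  move=> i2 j25 tj; apply: (glue_eq wf_x comm_x i2 j25 tj) => l _ tl.
  by apply: off_diagonal tl _; [vm_compute | rewrite tj].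
have glue_y i j a : (i < 2)%N -> (j < 25)%N -> lookup y_ends j = Some a ->
    B i 0 *m V (glue k a 0) + B i 1 *m V (glue k a 1) = W (glue k a i) *m B j j.
  move=> i2 j25 tj; apply: (glue_eq wf_y comm_y i2 j25 tj) => l _ tl.
  by apply: off_diagonal tl _; [vm_compute | rewrite tj].
pose g := B 3 3.
have V1 (U : rep (free_alg2 k) d) : U 1 = 1%:M by exact: rmorph1.
have W1 : W 1 = 1%:M by exact: rmorph1.
have e00 : B 0 0 = g.
  by have := glue_x 0%N 3 2 isT isT erefl; rewrite /= V1 W1 rmorph0 mulmx0 addr0 mulmx1 mul1mx.
have e10 : B 1 0 = 0.
  have := glue_x 1%N 3 2 isT isT erefl.
  by rewrite /= V1 !rmorph0 mulmx0 mul0mx addr0 mulmx1.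
have e01 : B 0 1 = 0.
  have := glue_x 0%N 4 3 isT isT erefl.
  by rewrite /= V1 !rmorph0 mulmx0 mul0mx add0r mulmx1.
have e11' : B 1 1 = B 4 4.
  have := glue_x 1%N 4 3 isT isT erefl.
  by rewrite /= V1 W1 !rmorph0 mulmx0 add0r mulmx1 mul1mx.
have e22 : B 2 2 = g.
  have := glue_x 0%N 2 1 isT isT erefl.
  by rewrite /= !V1 W1 e00 e01 mulmx1 mul0mx addr0 mul1mx.
have e11 : B 1 1 = g.
  have := glue_x 1%N 2 1 isT isT erefl.
  by rewrite /= !V1 W1 e10 e22 mul0mx add0r mulmx1 mul1mx.
have e55 : B 5 5 = g.
  have := glue_x 0%N 5 4 isT isT erefl.
  by rewrite /= V1 W1 e00 e01 mul0mx addr0 mulmx1 mul1mx.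
have e18 : B 18 18 = g.
  have := glue_y 0%N 18 5 isT isT erefl.
  by rewrite /= V1 W1 e00 e01 mul0mx addr0 mulmx1 mul1mx.
have gx : g *m V (free_x k) = W (free_x k) *m g.
  by have := glue_x 1%N 5 4 isT isT erefl; rewrite /= e10 e11 e55 mul0mx add0r.
have gy : g *m V (free_y k) = W (free_y k) *m g.
  by have := glue_y 1%N 18 5 isT isT erefl; rewrite /= e10 e11 e18 mul0mx add0r.
exists g; split.
- exact: (hom_of_generators (@free_alg_generates k) gx gy).
- move=> j j25; apply: (@linkedP 5 [:: 0; 1; 2; 3; 4; 5; 18]%N).
    move=> i; rewrite !inE => /or4P[/eqP->|/eqP->|/eqP->|] //.
    by move=> /or4P[/eqP->|/eqP->|/eqP->|/eqP->] //; rewrite -e11' e11.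
  have : all (linked (x_arrows ++ y_arrows) 5 [:: 0; 1; 2; 3; 4; 5; 18]%N) (iota 0 25).
    by vm_compute.
  by move/allP; apply; rewrite mem_iota.
- case=> [//|[_|l]]; first exact: e10.
  move=> /andP[_ l25].
  have l2 : (1 < l.+2 < 25)%N by [].
  have := end_eq wf_x sux comm_x l2 (isT : 3 < 25)%N (erefl : lookup x_ends 3 = Some 2%N).
  rewrite /= V1 rmorph0 mulmx0 addr0 mulmx1 => ->.
  have : all (fun i => if x_back i is Some l then vanishes 5 l 3 else true) (iota 0 25).
    by vm_compute.
  move/allP/(_ l.+2); rewrite mem_iota => /(_ l25).
  by case: (x_back l.+2) => [l' /vanishesP|].
Qed.
End StringHom.

(** * Wildness *)

Section Wild.
Variables (k : fieldType).
Hypothesis char0 : [pchar k] =i pred0.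

(** The block at position [(0, 0)] is multiplicative on homomorphisms, so isomorphic
images come from isomorphic modules, and an idempotent endomorphism has an
idempotent [g], which is [0] or [1] if [V] is indecomposable.  One of the two
complementary idempotents then has [g = 0], hence trace zero, and the dimension
of its image is zero in characteristic zero. *)
Lemma ringel_wild : wild (ringel_alg k).
Proof.
have [M [Mx My]] := string_bimod k.
have hom d e (V : rep (free_alg2 k) d) (W : rep (free_alg2 k) e) Phi :
    (forall a, Phi *m tensor M V a = tensor M W a *m Phi) ->
    exists g : 'M[k]_(e, d), [/\ forall a, g *m V a = W a *m g,
      forall j, (j < 25)%N -> blk Phi j j = g & forall l, (0 < l < 25)%N -> blk Phi l 0 = 0].
  move=> comm; apply: string_hom.
  - by have := comm (rx k); rewrite /= /tensor_act Mx.
  - by have := comm (ry k); rewrite /= /tensor_act My.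
have blk00M d e f (Phi : 'M[k]_(\sum_(i < 25) f, \sum_(j < 25) e))
    (Psi : 'M[k]_(\sum_(i < 25) e, \sum_(j < 25) d)) :
    (forall l, (0 < l < 25)%N -> blk Psi l 0 = 0) ->
    blk (Phi *m Psi) 0 0 = blk Phi 0 0 *m blk Psi 0 0.
  move=> Psi0; rewrite blkM big_ord_recl big1 ?addr0 // => l _.
  by rewrite Psi0 ?mulmx0 // lift0; exact: (ltn_ord l).
have blkB d e (Phi Psi : 'M[k]_(\sum_(i < 25) e, \sum_(j < 25) d)) i j :
    blk (Phi - Psi) i j = blk Phi i j - blk Psi i j.
  by rewrite /blk; apply/matrixP => a b; rewrite !mxE.
exists 25, M; split=> [d V Vind|d e V W [P [Q [PQ QP PU]]]].
- split=> [|d1 d2 U1 U2 [P [Q [PQ QP PU]]]].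
    by rewrite sum_nat_const card_ord muln_gt0 /=; case: Vind.
  have QU a : Q *m rep_sum U1 U2 a = tensor M V a *m Q.
    exact: inverse_hom PQ QP PU a.
  pose D1 : 'M[k]_(d1 + d2) := block_mx 1%:M 0 0 0.
  pose D2 : 'M[k]_(d1 + d2) := block_mx 0 0 0 1%:M.
  have D12 : D1 + D2 = 1%:M by rewrite add_block_mx !addr0 !add0r -scalar_mx_block.
  pose E D := Q *m D *m P.
  have Ecomm D : (forall a, D *m rep_sum U1 U2 a = rep_sum U1 U2 a *m D) ->
      forall a, E D *m tensor M V a = tensor M V a *m E D.
    move=> DU a; rewrite /E -!mulmxA PU (mulmxA D) DU !mulmxA.
    by rewrite QU.
  have EE D : D *m D = D -> E D *m E D = E D.
    by move=> DD; rewrite /E !mulmxA -(mulmxA _ P Q) PQ mulmx1 -(mulmxA Q) DD.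
  have trE D : \tr (E D) = \tr D by rewrite /E -mulmxA mxtrace_mulC -mulmxA PQ mulmx1.
  have D1U a : D1 *m rep_sum U1 U2 a = rep_sum U1 U2 a *m D1.
    by rewrite /= /sum_act !mulmx_block !mul1mx !mulmx1 !mul0mx !mulmx0 !addr0.
  have D2U a : D2 *m rep_sum U1 U2 a = rep_sum U1 U2 a *m D2.
    by rewrite /= /sum_act !mulmx_block !mul1mx !mulmx1 !mul0mx !mulmx0 !add0r.
  have tr0 D : (forall a, D *m rep_sum U1 U2 a = rep_sum U1 U2 a *m D) ->
      blk (E D) 0 0 = 0 -> \tr D = 0.
    move=> DU E0; have [g [_ gj _]] := hom _ _ _ _ _ (Ecomm _ DU).
    rewrite -trE [E D]blkE mxtrace_mxblock big1 // => i _.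
    by rewrite gj // -(gj 0%N) // E0 mxtrace0.
  have [g [gV gj g0]] := hom _ _ _ _ _ (Ecomm _ D1U).
  have gg : g *m g = g.
    by rewrite -(gj 0%N) // -blk00M // EE // /D1 mulmx_block !mul1mx !mul0mx !addr0.
  have trD1 : \tr D1 = d1%:R by rewrite mxtrace_block mxtrace1 mxtrace0 addr0.
  have trD2 : \tr D2 = d2%:R by rewrite mxtrace_block mxtrace1 mxtrace0 add0r.
  have nat0 n : n%:R = 0 :> k -> n = 0%N.
    by move/eqP; rewrite (proj1 (pcharf0P _) char0) => /eqP.
  have [gE|gE] := indecomposable_idempotent Vind gg gV; [left | right].
    by apply: nat0; rewrite -trD1; apply: tr0 D1U _; rewrite gj.
  apply: nat0; rewrite -trD2; apply: tr0 D2U _.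
  have -> : E D2 = 1%:M - E D1.
    have -> : D2 = 1%:M - D1 by rewrite -D12 addrAC subrr add0r.
    by rewrite /E mulmxBr mulmxBl mulmx1 QP.
  rewrite blkB blk1 // gj // gE; exact: subrr.
- have QU a : Q *m tensor M W a = tensor M V a *m Q.
    exact: inverse_hom PQ QP PU a.
  have [g [gV gj g0]] := hom _ _ _ _ _ PU; have [h [hV hj h0]] := hom _ _ _ _ _ QU.
  exists g, h; split=> //.
    by rewrite -(gj 0%N) // -(hj 0%N) // -blk00M // PQ blk1.
  by rewrite -(gj 0%N) // -(hj 0%N) // -blk00M // QP blk1.
Qed.
End Wild.

Theorem theorem10p2 (k : closedFieldType) (char0 : [pchar k] =i pred0) :
  wild (ringel_alg k) /\
  forall (m : nat) (rho : {lrmorphism jordan_plane k -> 'M[k]_m.+1}),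
    \rank (rho (jordan_y k)) = m ->
    ((5 <= m.+1)%N ->
       wild (image_alg rho) /\
       has_quotient_isomorphic_to (image_alg rho) (ringel_alg k)) /\
    ((m.+1 <= 3)%N -> tame (image_alg rho)).
Proof.
split=> [|m rho rk]; first exact: ringel_wild.
have [P Pu PY] := im_basis char0 rk; split=> [m4|m2]; last first.
  exact: tame_small char0 rk _ Pu PY m2.
have [f surj] := ringel_quotient char0 m4 Pu PY; split.
  exact: wild_pullback surj (ringel_wild char0).
exact: quotient_by_kernel surj.
Qed.
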